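(* Let $N$ be a linear graphon Hawkes process on $\mathscr X=[\boldsymbol a,\boldsymbol b]\subset\mathbb R^m$ and time interval $[0,1]$, starting on an empty history, with parameters $\lambda_\infty,h,W,B$ satisfying all assumptions listed in the context, and with $\rho(T_{\mathrm{hom}})<1$. Let $(\tilde N^d)_{d\in\mathbb N}$ be the approximating ($d$-variate) processes on $[0,1]$ with parameters averaged over the partitions $\mathcal P^d$, as defined in the context, coupled to $N$ through the same Poisson random measure. Then $\tilde N^d\to N$ uniformly on compact sets in probability with respect to the metric $\mathfrak d$, as $d\to\infty$; i.e. for every $\delta>0$ and every nondegenerate compact, convex $m$-dimensional manifold $\mathscr A\subset\mathscr X$, $$\mathbb P\Big(\sup_{\mathscr A'\subset\mathscr A,\ \mathscr A'\text{ compact, convex}}\mathfrak d\big(\tilde N^d_{\mathscr A'},N_{\mathscr A'}\big)>\delta\Big)\longrightarrow0,\qquad d\to\infty,$$ where $N_{\mathscr A'}$ denotes $N$ restricted to the spatial set $\mathscr A'$.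
   Context: Parameters and assumptions. $\mathscr X=[\boldsymbol a,\boldsymbol b]=\prod_{i=1}^m[a_i,b_i]\subset\mathbb R^m$ is a nondegenerate hyperrectangle with Lebesgue measure. $\lambda_\infty:\mathscr X\to\mathbb R_+$ is in $L^1(\mathscr X)\cap L^\infty(\mathscr X)$ with $\|\lambda_\infty\|_{\mathrm{TV}(\mathscr X)}<\infty$; $h:\mathbb R_+\to\mathbb R_+$ is in $L^1(\mathbb R_+)$; $W:\mathscr X^2\to\mathbb R_+$ is measurable with $W\le C_W$, and $W(\cdot,y)$ of bounded variation for all $y\in\mathscr X$ with $\sup_y\|W(\cdot,y)\|_{\mathrm{TV}(\mathscr X)}<\infty$; $B=(B_{xy})$ is a nonnegative stochastic process on $\mathscr X^2$, separable with respect to the open subsets of $\mathscr X^2$, with $\mathbb E[B_{xy}]\le C_B$ for all $x,y$, with $B_{\cdot y}$ a.s. of bounded variation for a.a. $y$ and $\sup_y\mathbb E\|B_{\cdot y}\|_{\mathrm{TV}(\mathscr X)}<\infty$. There are conjugate exponents $p,q\in[1,\infty]$ with $W(\cdot,y)\in L^p(\mathscr X)$, $\mathbb E[B_{\cdot y}]\in L^q(\mathscr X)$ for a.e. $y$. The total variation of $f$ is $\sup\{\int\mathrm{div}(\Phi)f\,\mathrm dx:\Phi\in C^1_c(\Omega,\mathbb R^m),\|\Phi\|_{L^\infty}\le1\}$ with $\Omega$ the interior of $\mathscr X$. Linear graphon Hawkes process: the marked point process of events $(s,y)$ (time $s$, location $y\in\mathscr X$), each carrying an independent realization $B(s)$ of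 $B$ (mark $B_{\cdot y}(s)$), with conditional intensity density (events occur in $\mathrm dt\times\mathrm dx$ at rate $\lambda_t(x)\,\mathrm dt\,\mathrm dx$ given the past) $\lambda_t(x)=\lambda_\infty(x)+\sum_{(s,y)\in N,s<t}B_{xy}(s)W(x,y)h(t-s)$. Operator. $(T_{\mathrm{hom}}f)(x)=\|h\|_{L^1(\mathbb R_+)}\int_{\mathscr X}\mathbb E[B_{xy}]W(x,y)f(y)\,\mathrm dy$ on $L^1(\mathscr X)$, with spectral radius $\rho(T_{\mathrm{hom}})$. Averaged processes. $(\mathcal P^d)_{d\in\mathbb N}$ are partitions of $\mathscr X$ into $d$ hyperrectangles $\mathscr X^d_1,\dots,\mathscr X^d_d$, with $\mathrm{mesh}(\mathcal P^d):=\max_n\mathrm{diam}(\mathscr X^d_n)\to0$ monotonically as $d\to\infty$. $\tilde\lambda^d_\infty$ is constant on each $\mathscr X^d_i$, equal to the average of $\lambda_\infty$ over $\mathscr X^d_i$; $\tilde W^d$ and $\tilde B^d(s)$ are constant on each $\mathscr X^d_i\times\mathscr X^d_j$, equal to the averages of $W$ and of the realization $B(s)$ over $\mathscr X^d_i\times\mathscr X^d_j$. $\tilde N^d$ is the linear graphon Hawkes process started on an empty history with conditional intensity density $\tilde\lambda^d_t(x)=\tilde\lambda^d_\infty(x)+\sum_{(s,y)\in\tilde N^d,s<t}\tilde B^d_{xy}(s)\tilde W^d(x,y)h(t-s)$ and marks $\tilde B^d_{\cdot y}(s)$. Coupling. All processes are defined from one Poisson random measure $\Pi$ on $[0,1]\times\mathscr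 X\times\mathcal E\times\mathbb R_+$ with intensity $\mathrm dt\times\mathrm dx\times\mathrm{Law}(B)\times\mathrm dr$ ($\mathcal E$ the path space of $B$): a point $(t,x,b,r)$ of $\Pi$ gives an event of $N$ at $(t,x)$ with mark realization $b$ iff $r\le\lambda_t(x)$, and an event of $\tilde N^d$ at $(t,x)$ with the averaged realization $\tilde b^d$ iff $r\le\tilde\lambda^d_t(x)$. Metric. For two such marked processes $N,M$ with sets of event times $\mathcal T_N,\mathcal T_M$, $$\mathfrak d(N,M):=\sum_{t\in\mathcal T_N\cap\mathcal T_M}\big(\|y^N-y^M\|_{\mathbb R^m}+\|B^N_{\cdot y^N}-B^M_{\cdot y^M}\|_{L^1(\mathscr X)}\big)+\sum_{t\in\mathcal T_N\triangle\mathcal T_M}\big(1+\|y\|_{\mathbb R^m}+\|B_{\cdot y}\|_{L^1(\mathscr X)}\big),$$ where $(t,y^N,B^N)$ and $(t,y^M,B^M)$ are the events of $N$, $M$ at a common time $t$, and $(t,y,B)$ is the event, of whichever process has one, at a non-common time $t$. *)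

(* Defs.v *)
From HB Require Import structures.
From mathcomp Require Import all_boot all_order all_algebra.
From mathcomp Require Import all_classical all_reals all_analysis.
From mathcomp Require Import measurable_realfun complex.

Set Implicit Arguments.
Unset Strict Implicit.
Unset Printing Implicit Defensive.
Import Order.TTheory GRing.Theory Num.Theory.
Import numFieldNormedType.Exports.

Local Open Scope classical_set_scope.
Local Open Scope ring_scope.

Definition rV_display : measure_display -> measure_display.
Proof. exact. Qed.

(* The sigma-algebra generated by the coordinates, as the library does for
   n.-tuple; it is the Borel sigma-algebra of the topology of 'rV[R]_m. *)
Section measurable_rV.
Variables (R : realType) (m : nat).

Let coords : 'I_m -> 'rV[R]_m -> R := fun i x => x ord0 i.

Let rV_set0 : g_sigma_preimage coords set0.
Proof. exact: sigma_algebra0. Qed.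

Let rV_setC A : g_sigma_preimage coords A -> g_sigma_preimage coords (~` A).
Proof. exact: sigma_algebraC. Qed.

Let rV_bigcup (F : (set 'rV[R]_m)^nat) :
  (forall i, g_sigma_preimage coords (F i)) ->
  g_sigma_preimage coords (\bigcup_i (F i)).
Proof. exact: sigma_algebra_bigcup. Qed.

HB.instance Definition _ :=
  @isMeasurable.Build (rV_display default_measure_display) 'rV[R]_m
    (g_sigma_preimage coords) rV_set0 rV_setC rV_bigcup.

End measurable_rV.

Lemma measurable_coord (R : realType) m (i : 'I_m) :
  measurable_fun setT (fun x : 'rV[R]_m => x ord0 i).
Proof.
move=> _ Y mY; rewrite setTI; apply: sub_sigma_algebra => /=.
rewrite -bigcup_seq/=; exists i => /=; first by rewrite mem_index_enum.
by exists Y => //; rewrite setTI.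
Qed.

Lemma measurable_fun_rV d (T : measurableType d) (R : realType) m
    (f : T -> 'rV[R]_m) :
  (forall i, measurable_fun setT (fun t => f t ord0 i)) ->
  measurable_fun setT f.
Proof.
move=> mf; pose coords := fun i (x : 'rV[R]_m) => x ord0 i.
have sub : g_sigma_preimage (fun i => coords i \o f) `<=` measurable.
  apply: smallest_sub; first exact: sigma_algebra_measurable.
  case: m => [|m] in f mf coords *; first by rewrite big_ord0.
  rewrite -bigcup_mkord_ord; apply: bigcup_sub => i Ii.
  by move=> A [B mB <-]; exact: mf.
move=> _ A mA; apply: sub.
by rewrite g_sigma_preimage_comp; exists A.
Qed.

Section lebesgue_measure_rV.
Variable R : realType.

Definition cons_rV n (p : measurableTypeR R * 'rV[R]_n) : 'rV[R]_n.+1 :=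
  \row_(j < n.+1) oapp (fun k => p.2 ord0 k) p.1 (unlift ord0 j).

Lemma measurable_cons_rV n : measurable_fun setT (@cons_rV n).
Proof.
apply: measurable_fun_rV => i.
rewrite (_ : (fun _ => _) = (fun p : measurableTypeR R * 'rV[R]_n =>
    oapp (fun k => p.2 ord0 k) p.1 (unlift ord0 i))).
  case: unliftP => [k _|_] /=; last exact: measurable_fst.
  exact: (measurableT_comp (measurable_coord k) measurable_snd).
by apply/funext => p; rewrite mxE.
Qed.

HB.instance Definition _ n :=
  isMeasurableFun.Build _ _ _ _ (@cons_rV n) (@measurable_cons_rV n).

Lemma cons_rV_surj n (x : 'rV[R]_n.+1) :
  x = cons_rV (x ord0 ord0, \row_j x ord0 (lift ord0 j)).
Proof.
apply/rowP => j; rewrite !mxE.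
by case: unliftP => [k ->|->] //=; rewrite mxE.
Qed.

Section cons_measure.
Variables (n : nat) (mu : {sigma_finite_measure set 'rV[R]_n -> \bar R}).
Local Open Scope ereal_scope.

Definition cons_measure : set 'rV[R]_n.+1 -> \bar R :=
  pushforward (lebesgue_measure \x mu) (@cons_rV n).

Let cons_measure0 : cons_measure set0 = 0.
Proof. exact: measure0. Qed.

Let cons_measure_ge0 A : 0 <= cons_measure A.
Proof. exact: measure_ge0. Qed.

Let cons_measure_sigma_additive : semi_sigma_additive cons_measure.
Proof. exact: measure_semi_sigma_additive. Qed.

HB.instance Definition _ := isMeasure.Build _ _ _ cons_measure
  cons_measure0 cons_measure_ge0 cons_measure_sigma_additive.

Let cons_measure_sigma_finite : sigma_finite setT cons_measure.
Proof.
have /sigma_finiteP[F [TF ndF Foo]] := sigma_finiteT (@lebesgue_measure R).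
have /sigma_finiteP[G [TG ndG Goo]] := sigma_finiteT mu.
pose tl (x : 'rV[R]_n.+1) : 'rV[R]_n := \row_j x ord0 (lift ord0 j).
have mtl : measurable_fun setT tl.
  apply: measurable_fun_rV => i.
  apply: (eq_measurable_fun (fun x : 'rV[R]_n.+1 => x ord0 (lift ord0 i))).
    by move=> x _; rewrite mxE.
  exact: measurable_coord.
exists (fun k => (fun x : 'rV[R]_n.+1 => x ord0 ord0) @^-1` F k `&` tl @^-1` G k).
  apply/esym; rewrite -subTset => x _.
  have [i _ Fi] : (\bigcup_i F i) (x ord0 ord0) by rewrite -TF.
  have [j _ Gj] : (\bigcup_i G i) (tl x) by rewrite -TG.
  exists (maxn i j) => //; split.
    exact: (subsetPset _ _ (ndF _ _ (leq_maxl i j))).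
  exact: (subsetPset _ _ (ndG _ _ (leq_maxr i j))).
move=> k; split.
  apply: measurableI.
    by rewrite -[X in measurable X]setTI; apply: measurable_coord => //; exact: (Foo k).1.
  by rewrite -[X in measurable X]setTI; apply: mtl => //; exact: (Goo k).1.
have [mF Fk] := Foo k; have [mG Gk] := Goo k.
rewrite /cons_measure /pushforward.
rewrite (_ : _ @^-1` _ = F k `*` G k).
  by rewrite product_measure1E// lte_mul_pinfty// ge0_fin_numE.
apply/seteqP; split => -[r v] /=; rewrite mxE unlift_none /=.
  move=> [Fr Gv]; split => //; move: Gv; congr (G k _); apply/rowP => j.
  by rewrite !mxE liftK.
move=> [Fr Gv]; split => //; move: Gv; congr (G k _); apply/rowP => j.
by rewrite !mxE liftK.
Qed.

HB.instance Definition _ := Measure_isSigmaFinite.Build _ _ _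
  cons_measure cons_measure_sigma_finite.

End cons_measure.

Fixpoint leb m : {sigma_finite_measure set 'rV[R]_m -> \bar R} :=
  match m with
  | 0 => dirac (0 : 'rV[R]_0)
  | n.+1 => cons_measure (leb n)
  end.

End lebesgue_measure_rV.
Arguments leb {R m}.

Lemma measurable_prod_rV (R : realType) m (A : 'I_m -> set R) :
  (forall i, measurable (A i)) ->
  measurable [set x : 'rV[R]_m | forall i, A i (x ord0 i)].
Proof.
move=> mA.
have -> : [set x : 'rV[R]_m | forall i, A i (x ord0 i)] =
    \bigcap_(i in [set: 'I_m]) ((fun x : 'rV[R]_m => x ord0 i) @^-1` A i).
  by apply/seteqP; split => x /= h i; [move=> _; exact: h|exact: (h i I)].
apply: fin_bigcap_measurable; first exact: finite_finset.
move=> i _; rewrite -[X in measurable X]setTI.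
exact: measurable_coord.
Qed.

Lemma leb_prod (R : realType) m (A : 'I_m -> set R) :
  (forall i, measurable (A i)) ->
  (leb [set x : 'rV[R]_m | forall i, A i (x ord0 i)] =
   \prod_(i < m) lebesgue_measure (A i))%E.
Proof.
elim: m A => [|m IH] A mA; first by rewrite big_ord0 /= diracE mem_set// => -[].
rewrite big_ord_recl -IH// /= /cons_measure /pushforward.
have -> : @cons_rV R m @^-1` [set x | forall i, A i (x ord0 i)] = A ord0 `*`
    [set x : 'rV[R]_m | forall i, A (lift ord0 i) (x ord0 i)].
  apply/seteqP; split => -[r v] /=.
    move=> Arv; split; first by have := Arv ord0; rewrite mxE unlift_none.
    by move=> i; have := Arv (lift ord0 i); rewrite mxE liftK.
  by move=> [Ar Av] i; rewrite mxE; case: unliftP => [k ->|->] //=.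
rewrite product_measure1E //=.
- exact: mA.
- by apply: (measurable_prod_rV (A := fun i => A (lift ord0 i))) => i; exact: mA.

Qed.

Section geometry.
Context {R : realType} {m : nat}.
Implicit Types (x y a b : 'rV[R]_m) (A X : set 'rV[R]_m) (f : 'rV[R]_m -> R).

Definition enorm x : R := Num.sqrt (\sum_(i < m) x ord0 i ^+ 2).

Definition ediam A : \bar R :=
  ereal_sup [set (enorm (z.1 - z.2))%:E | z in A `*` A].

Definition closed_box a b : set 'rV[R]_m :=
  [set x | forall i, a ord0 i <= x ord0 i <= b ord0 i].

(* Each side may be open or closed at either end, so that a closed box can
   be split into pairwise disjoint hyperrectangles. *)
Definition hyperrectangle A :=
  exists I : 'I_m -> interval R, A = [set x | forall i, x ord0 i \in I i].

(* Cells have positive volume, so that averages over them make sense. *)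
Definition hyperrectangle_partition X d (C : 'I_d -> set 'rV[R]_m) :=
  [/\ forall n, hyperrectangle (C n), forall n, (0 < leb (C n))%E,
      trivIset setT C & \bigcup_n C n = X].

Definition mesh d (C : 'I_d -> set 'rV[R]_m) : \bar R :=
  \big[maxe/0%E]_(n < d) ediam (C n).

Definition basis_vec (i : 'I_m) : 'rV[R]_m := delta_mx ord0 i.

(* Compactly supported C^1 fields on [U], extended by zero. *)
Definition C1c_field (U : set 'rV[R]_m) (Phi : 'rV[R]_m -> 'rV[R]_m) :=
  [/\ forall i j x, derivable (fun z => Phi z ord0 j) x (basis_vec i),
      forall i j, continuous (fun x => 'D_(basis_vec i) (fun z => Phi z ord0 j) x) &
      exists K : set 'rV[R]_m, [/\ compact K, K `<=` U &
        forall x, ~ K x -> Phi x = 0]].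

Definition divergence (Phi : 'rV[R]_m -> 'rV[R]_m) x : R :=
  \sum_(i < m) 'D_(basis_vec i) (fun z => Phi z ord0 i) x.

Definition TV_norm X f : \bar R :=
  ereal_sup [set (\int[leb]_(x in interior X) (divergence Phi x * f x)%:E)%E
            | Phi in [set Phi | C1c_field (interior X) Phi /\
                                forall x, enorm (Phi x) <= 1]].

(* Integrability over [X] only: [f] may be anything outside of [X]. *)
Definition in_Lp X (p : \bar R) f :=
  measurable_fun X f /\ finite_norm leb p (f \_ X).

Definition in_BV X f :=
  in_Lp X 1%E f /\ (TV_norm X f < +oo)%E.

Implicit Types (T : ('rV[R]_m -> R) -> 'rV[R]_m -> R) (F G : 'rV[R]_m -> R[i]).

Definition complex_L1 X F :=
  in_Lp X 1%E (@complex.Re R \o F) /\ in_Lp X 1%E (@complex.Im R \o F).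

Definition complex_L1_norm X F : \bar R :=
  (\int[leb]_(x in X) (Normc.normc (F x))%:E)%E.

Definition complexify T F : 'rV[R]_m -> R[i] :=
  fun x => Complex (T (@complex.Re R \o F) x) (T (@complex.Im R \o F) x).

Definition ae_eq_on X F G := {ae leb, forall x, X x -> F x = G x}.

(* [z - T] has a bounded inverse on the complexification of [L^1(X)];
   functions stand for their a.e. classes. *)
Definition resolvent_set X T (z : R[i]) :=
  exists C : R, forall G, complex_L1 X G -> exists F,
    [/\ complex_L1 X F,
        ae_eq_on X (fun x => z * F x - complexify T F x) G,
        (complex_L1_norm X F <= C%:E * complex_L1_norm X G)%E &
        forall F', complex_L1 X F' ->
          ae_eq_on X (fun x => z * F' x - complexify T F' x) G ->
          ae_eq_on X F' F].

Definition spectral_radius X T : \bar R :=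
  ereal_sup [set (Normc.normc z)%:E | z in ~` resolvent_set X T].

End geometry.

Definition T_hom (R : realType) m (X : set 'rV[R]_m) (h : R -> R)
    (EB W : 'rV[R]_m -> 'rV[R]_m -> R) (f : 'rV[R]_m -> R) (x : 'rV[R]_m) : R :=
  (\int[lebesgue_measure]_(t in `[0%R, +oo[) `|h t|) *
  \int[leb]_(y in X) (EB x y * W x y * f y).

Definition average d (T : measurableType d) (R : realType)
    (mu : {measure set T -> \bar R}) (A : set T) (f : T -> R) : R :=
  (fine (mu A))^-1 * \int[mu]_(x in A) f x.

Section cell_averages.
Context {R : realType} {m d : nat}.
Variable C : 'I_d -> set 'rV[R]_m.

Definition cell_average1 (f : 'rV[R]_m -> R) (x : 'rV[R]_m) : R :=
  \sum_(i < d) \1_(C i) x * average leb (C i) f.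

Definition cell_average2 (g : 'rV[R]_m -> 'rV[R]_m -> R) (x y : 'rV[R]_m) : R :=
  \sum_(i < d) \sum_(j < d) \1_(C i) x * \1_(C j) y *
    average (leb \x leb)%E (C i `*` C j) (fun z => g z.1 z.2).

End cell_averages.

(* The random measure is the counting measure of a random countable set of
   points of [D], and [nu] restricted to [D] is its intensity.  The Poisson
   mass function is written out because [poisson_pmf 0 k] is [1] for all [k]. *)
Definition poisson_random_measure d (Omega : measurableType d) (R : realType)
    (P : probability Omega R) d' (S : measurableType d') (D : set S)
    (nu : set S -> \bar R) (Pi : Omega -> set S) :=
  let N A w : \bar R := counting (Pi w `&` A) in
  [/\ forall w, countable (Pi w) /\ Pi w `<=` D,
      forall A, measurable A -> measurable_fun setT (N A),
      forall A, measurable A -> A `<=` D -> (nu A < +oo)%E -> forall k : nat,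
        P [set w | N A w = k%:R%:E] =
        (expR (- fine (nu A)) * fine (nu A) ^+ k / k`!%:R)%:E,
      forall A, measurable A -> A `<=` D -> nu A = +oo%E ->
        {ae P, forall w, N A w = +oo%E} &
      forall n (A : 'I_n -> set S) (c : 'I_n -> \bar R),
        (forall i, measurable (A i)) -> trivIset setT A ->
        P [set w | forall i, N (A i) w = c i] =
        (\prod_(i < n) P [set w | N (A i) w = c i])%E].

(* Separability in the sense of Doob, relative to closed sets of values and to
   the relatively open subsets of the index set [X]. *)
Definition separable_process d (E : measurableType d) (R : realType)
  (Q : probability E R) (I : topologicalType) (X : set I) (B : E -> I -> R) :=
  exists D : set I, [/\ countable D, D `<=` X &
    {ae Q, forall w, forall (U : set I) (F : set R), open U -> closed F ->
      (forall z, U z -> D z -> F (B w z)) -> forall z, U z -> X z -> F (B w z)}].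

Section hawkes.
Context {R : realType} {m : nat} {dE : measure_display} {E : measurableType dE}.
Implicit Types (H : set (R * 'rV[R]_m * E)).
Variables (lam : 'rV[R]_m -> R) (W : 'rV[R]_m -> 'rV[R]_m -> R)
  (K : E -> 'rV[R]_m -> 'rV[R]_m -> R) (h : R -> R).

(* An event [(s, y, w)] carries a path [w] of the process; [K w] is the kernel
   it contributes: the realization itself, or its average over cells. *)
Definition intensity H (t : R) (x : 'rV[R]_m) : \bar R :=
  ((lam x)%:E + \esum_(e in [set e | H e /\ (e.1.1 < t)%R])
     (K e.2 x e.1.2 * W x e.1.2 * h (t - e.1.1))%:E)%E.

Definition thinning_domain (X : set 'rV[R]_m) : set (R * 'rV[R]_m * E * R) :=
  [set z | [/\ 0 <= z.1.1.1 <= 1, X z.1.1.2 & 0 <= z.2]].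

(* Finiteness of [N w] is part of being a point process: without it, the
   thinning equation also has explosive solutions. *)
Definition hawkes_process d (Omega : measurableType d) (P : probability Omega R)
    (Pi : Omega -> set (R * 'rV[R]_m * E * R))
    (N : Omega -> set (R * 'rV[R]_m * E)) :=
  {ae P, forall w, finite_set (N w) /\
    N w = [set e | exists2 r, Pi w (e, r) & (r%:E <= intensity (N w) e.1.1 e.1.2)%E]}.

Definition marked H : set (R * 'rV[R]_m * ('rV[R]_m -> R)) :=
  [set (e.1.1, e.1.2, fun x => K e.2 x e.1.2) | e in H].

End hawkes.
Arguments thinning_domain {R m dE E} X.

Section metric.
Context {R : realType} {m : nat}.
Local Notation marked_pp := (set (R * 'rV[R]_m * ('rV[R]_m -> R))).
Implicit Types N M : marked_pp.

Definition event_times N : set R := [set e.1.1 | e in N].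

(* In a simple process, the event at time [t] is unique. *)
Definition event_at N (t : R) : R * 'rV[R]_m * ('rV[R]_m -> R) :=
  xget (t, 0, fun=> 0) [set e | N e /\ e.1.1 = t].

Definition L1_norm (X : set 'rV[R]_m) (f : 'rV[R]_m -> R) : \bar R :=
  (\int[leb]_(x in X) `|f x|%:E)%E.

(* At a time of the symmetric difference, [N `|` M] has a single event
   when both processes are simple. *)
Definition pp_dist X N M : \bar R :=
  let T_N := event_times N in let T_M := event_times M in
  (\esum_(t in T_N `&` T_M)
     ((enorm ((event_at N t).1.2 - (event_at M t).1.2))%:E +
      L1_norm X (fun x => (event_at N t).2 x - (event_at M t).2 x)%R)
   + \esum_(t in (T_N `\` T_M) `|` (T_M `\` T_N))
     (1 + (enorm (event_at (N `|` M) t).1.2)%:E +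
      L1_norm X (event_at (N `|` M) t).2))%E.

Definition restrict_pp N (A : set 'rV[R]_m) : marked_pp := [set e | N e /\ A e.1.2].

End metric.

(* Main.v *)
(* Let Psi_M be the points of Pi of level at most M, a finite Poisson process.
   Almost surely N is a finite set, so with probability close to 1 it consists of
   at most J points of Psi_M.  On that event, the points of N satisfy the equation
   of the averaged process as well, and N~^d = N by uniqueness, unless some point
   p of Pi lies between the two intensities computed from the events of N before
   p.  This forces p, followed by these events, to be a decreasing tuple in a
   small set: a Campbell-type inequality bounds its probability by the integral
   over tuples of the L^1 distance of the two rates, that is, by a multiple of
   the L^1 averaging errors of lam and of B W, which vanish as the mesh does (the
   averages of an integrable function over shrinking boxes converge in L^1).
   Once N~^d = N, the distance only sees the averaging error of the marks, which
   Markov's inequality controls in the same way. *)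

(* Neither [N] nor [Nt] comes with any measurability in the sample point: each is tied to [Pi] by an
   almost sure equation only. Every event whose probability is estimated is therefore phrased
   through the finite sets [Psi M w], and the processes themselves are recovered pathwise from the
   uniqueness of finite solutions.

   The history before a point p is itself made of points of [Pi]. In place of a filtration and a
   compensator, Campbell's inequality is applied to the whole tuple formed by p and its history.
   Since almost surely no two points share a time, the entries of such a tuple lie in disjoint
   slices of time once the grid is fine enough, and counts in disjoint slices are independent.

   Only the history is confined to levels at most M. The level of p stays free, because no bound on
   the intensities is known in advance; for a fixed history the region between the two rates has
   measure at most their L^1 distance, whatever its height. The resulting estimate does not depend
   on the strip that contains p, so that strip can grow to the whole domain. *)
Require Import Defs.
From HB Require Import structures.
From mathcomp Require Import all_boot all_order all_algebra.
From mathcomp Require Import finmap.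
From mathcomp Require Import all_classical all_reals all_analysis.
From mathcomp Require Import measurable_realfun complex.
From mathcomp Require Import ring lra.

Set Implicit Arguments.
Unset Strict Implicit.
Unset Printing Implicit Defensive.
Import Order.TTheory GRing.Theory Num.Theory.
Import numFieldNormedType.Exports.

Local Open Scope classical_set_scope.
Local Open Scope ring_scope.

(** * Random finite sets *)

Section counting_facts.
Context {R : realType} {T : choiceType}.
Local Open Scope ereal_scope.
Implicit Types A B : set T.
Local Notation count := (@counting _ R).

Lemma counting_ge0 A : 0 <= count A.
Proof. by rewrite /counting; case: ifPn; rewrite ?lee_fin// lee_pinfty. Qed.

Lemma counting_set0 : count (@set0 T) = 0.
Proof. by rewrite /counting asboolT// fset_set0. Qed.

Lemma counting_fin A : finite_set A -> count A = (#|` fset_set A|)%:R%:E.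
Proof. by move=> fA; rewrite /counting asboolT. Qed.

Lemma counting_fin_num A : (count A \is a fin_num) = `[< finite_set A >].
Proof. by rewrite /counting; case: asboolP. Qed.

Lemma counting_set1 (x : T) : count [set x] = 1.
Proof. by rewrite counting_fin// fset_set1 cardfs1. Qed.

Lemma le_counting A B : A `<=` B -> count A <= count B.
Proof.
move=> AB; have [fB|iB] := pselect (finite_set B).
  have fA : finite_set A by exact: sub_finite_set fB.
  rewrite !counting_fin// lee_fin ler_nat fsubset_leq_card//.
  by rewrite -fset_set_sub.
by rewrite [leRHS]/counting asboolF// leey.
Qed.

Lemma counting_ge1 A : A !=set0 -> 1 <= count A.
Proof. by move=> [x Ax]; rewrite -(counting_set1 x); apply: le_counting => _ ->. Qed.

Lemma counting_eq0 A : (count A == 0) = (A == set0).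
Proof.
apply/eqP/eqP => [A0|->]; last exact: counting_set0.
apply/eqP/negPn/negP => /set0P/counting_ge1; rewrite A0.
by rewrite leNgt lte01.
Qed.

Lemma counting_ge2 A (x y : T) : A x -> A y -> x <> y -> 2%:E <= count A.
Proof.
move=> Ax Ay xy; apply: (@le_trans _ _ (count [set x; y])); last first.
  by apply: le_counting => z [->|->].
rewrite counting_fin// fset_setU// !fset_set1 cardfsU1 inE cardfs1.
by case: eqP xy => //= _ _; rewrite lee_fin.
Qed.

End counting_facts.

Lemma counting_setX {R : realType} (T T' : choiceType) (A : set T) (B : set T') :
  finite_set A -> finite_set B ->
  (counting (A `*` B) = counting A * counting B :> \bar R)%E.
Proof.
move=> fA fB; rewrite (counting_fin fA) (counting_fin fB).
rewrite (counting_fin (finite_setX fA fB)).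
rewrite fset_setX//; set a := fset_set A; set b := fset_set B.
have -> : (a `*` b = [fset z | z in [seq (x, y) | x <- a, y <- b]])%fset.
  apply/fsetP => -[x y]; rewrite in_fsetM !inE /=.
  apply/idP/allpairsP => [/andP[xa yb]|[[u v] [ua vb [-> ->]]]]; last exact/andP.
  by exists (x, y).
rewrite card_fseq undup_id; last first.
  by apply: allpairs_uniq => // -[? ?] [? ?] _ _ [-> ->].
by rewrite size_allpairs natrM.
Qed.

Lemma counting_image {R : realType} (T T' : choiceType) (f : T -> T') (A : set T) :
  finite_set A -> injective f -> counting (f @` A) = counting A :> \bar R.
Proof.
move=> fA injf; rewrite !counting_fin//; last exact: finite_image.
by rewrite fset_set_image// card_imfset.
Qed.

Lemma counting_bigcup {R : realType} (T : pointedType) (F : (set T)^nat) :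
  trivIset setT F ->
  (counting (\bigcup_n F n) = \sum_(n <oo) counting (F n) :> \bar R)%E.
Proof.
move=> tF.
pose count : {measure set (g_sigma_algebraType (@setT (set T))) -> \bar R} := counting.
have := (@measure_semi_bigcup _ R _ count F).
by apply; [move=> n; exact: sub_sigma_algebra|exact: tF|exact: sub_sigma_algebra].
Qed.

Definition random_finite {R : realType} d (Omega : measurableType d)
    d' (T : measurableType d') (Phi : Omega -> set T) :=
  (forall w, finite_set (Phi w)) /\
  forall A, measurable A ->
    measurable_fun setT (fun w => counting (Phi w `&` A) : \bar R).

Section random_finite.
Context {R : realType} d (Omega : measurableType d).
Local Open Scope ereal_scope.
Local Notation random_finite := (@random_finite R).

(** A Dynkin argument. Finiteness of every [Phi w] keeps the counts finite, so the count in a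
    complement is a difference of two measurable counts; disjoint unions become series. *)
Lemma random_finite_gen d' (T : measurableType d') (G : set (set T))
    (Phi : Omega -> set T) :
  @measurable _ T = <<s G >> -> setI_closed G -> G setT ->
  (forall w, finite_set (Phi w)) ->
  (forall A, G A -> measurable_fun setT (fun w => counting (Phi w `&` A) : \bar R)) ->
  random_finite Phi.
Proof.
move=> GE GI GT Phifin PhiG; split=> // A mA.
have cfin B w : (counting (Phi w `&` B) : \bar R) \is a fin_num.
  by rewrite counting_fin_num; apply/asboolP; exact: finite_setIl.
rewrite GE in mA; move: A mA.
apply: (@dynkin_induction _ _ G (fun A =>
  measurable_fun setT (fun w => counting (Phi w `&` A) : \bar R))) => //.
- exact: PhiG.
- move=> B mB ih.
  rewrite (_ : (fun _ => _) = (fun w => counting (Phi w `&` setT) - counting (Phi w `&` B))).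
    by apply: emeasurable_funB => //; exact: PhiG.
  apply/funext => w; rewrite setIT.
  have -> : counting (Phi w) = counting (Phi w `&` B) + counting (Phi w `&` ~` B) :> \bar R.
    rewrite !counting_fin//; try exact: finite_setIl.
    rewrite -EFinD -natrD -cardfsUI -fset_setU; try exact: finite_setIl.
    rewrite -fset_setI; try exact: finite_setIl.
    by rewrite setIACA setICr setI0 fset_set0 cardfs0 addn0 -setIUr setUv setIT.
  by rewrite addeAC subee// add0e.
- move=> F mF tF ih.
  rewrite (_ : (fun _ => _) = (fun w => \sum_(n <oo) counting (Phi w `&` F n))).
    apply: ge0_emeasurable_sum => [n w _ _|n _]; [exact: counting_ge0|exact: ih].
  apply/funext => w; rewrite setI_bigcupr.
  apply: counting_bigcup; exact: trivIset_setIl.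
Qed.

Lemma random_finiteX d1 d2 (T1 : measurableType d1) (T2 : measurableType d2)
    (Phi : Omega -> set T1) (Psi : Omega -> set T2) :
  random_finite Phi -> random_finite Psi ->
  random_finite (fun w => Phi w `*` Psi w).
Proof.
move=> [Pf Pm] [Qf Qm].
apply: (@random_finite_gen _ _ [set A `*` B | A in measurable & B in measurable]).
- exact: measurable_prod_measurableType.
- move=> _ _ [A1 mA1 [B1 mB1 <-]] [A2 mA2 [B2 mB2 <-]].
  exists (A1 `&` A2); first exact: measurableI.
  by exists (B1 `&` B2); [exact: measurableI|rewrite setXI].
- by exists setT => //; exists setT => //; rewrite setXTT.
- by move=> w; exact: finite_setX.
- move=> _ [A mA [B mB <-]].
  apply: (eq_measurable_fun (fun w => counting (Phi w `&` A) * counting (Psi w `&` B))).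
    by move=> w _; rewrite -setXI counting_setX//; exact: finite_setIl.
  by apply: emeasurable_funM; [exact: Pm|exact: Qm].
Qed.

(** With [[set w]] as one factor of a product, a set [U] of pairs (sample point, point) can be
    tested against a random finite set: counting in the section of [U] at w is counting in a product
    set. *)
Lemma random_finite_diag : random_finite (fun w : Omega => [set w]).
Proof.
split=> // A mA; apply: (eq_measurable_fun (fun w => (\1_A w)%:E : \bar R)).
  move=> w _; rewrite indicE; have [wA|wA] := boolP (w \in A).
    by rewrite setIidl ?counting_set1// => _ ->; exact/set_mem.
  rewrite (_ : [set w] `&` A = set0) ?counting_set0//.
  by apply/seteqP; split => // x [->] /mem_set; exact/negP.
exact/measurable_EFinP/measurable_indic.
Qed.

Lemma measurable_counting_section d' (T : measurableType d')
    (Phi : Omega -> set T) (U : set (Omega * T)) :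
  random_finite Phi -> measurable U ->
  measurable_fun setT (fun w => counting [set x | Phi w x /\ U (w, x)] : \bar R).
Proof.
move=> Phi_rf mU; have [_ /(_ _ mU)] := random_finiteX random_finite_diag Phi_rf.
apply: eq_measurable_fun => w _.
rewrite (_ : _ `&` _ = pair w @` [set x | Phi w x /\ U (w, x)]).
  rewrite counting_image//; last by move=> ? ? [].
  by apply: sub_finite_set (Phi_rf.1 w) => x [].
apply/seteqP; split=> [[v x] [[/= -> Px] Ux]|_ [x [Px Ux] <-]] //.
by exists x.
Qed.

End random_finite.

Lemma random_finite_comp {R : realType} d (Omega : measurableType d) d0
    (Omega0 : measurableType d0) d' (T : measurableType d')
    (f : Omega0 -> Omega) (Phi : Omega -> set T) :
  measurable_fun setT f -> @random_finite R _ _ _ _ Phi ->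
  @random_finite R _ _ _ _ (Phi \o f).
Proof.
move=> mf [Pf Pm]; split=> [w|A mA]; first exact: Pf.
exact: (measurableT_comp (Pm A mA) mf).
Qed.

(** A projection of a measurable set need not be measurable. Here the quantifier ranges over a
    random finite set, so the projection is the event that a measurable count is nonzero. *)
Lemma random_finite_exists {R : realType} d (Omega : measurableType d)
    d' (T : measurableType d') (Phi : Omega -> set T) (U : set (Omega * T)) :
  @random_finite R _ _ _ _ Phi -> measurable U ->
  measurable [set w | exists2 x, Phi w x & U (w, x)].
Proof.
move=> Phi_rf mU.
rewrite (_ : [set w | _] = setT `&`
    (fun w => counting [set x | Phi w x /\ U (w, x)] : \bar R) @^-1` (~` [set 0%E])).
  by apply: measurable_counting_section => //; exact: measurableC.
apply/seteqP; split=> w /=.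
  move=> [x Px Ux]; split=> //= /eqP; rewrite counting_eq0 => /eqP E.
  by have : set0 x by rewrite -E.
move=> [_ /eqP]; rewrite counting_eq0 => /set0P[x [Px Ux]].
by exists x.
Qed.

(** * Measures on tuples *)

Section poisson_mass.
Context {R : realType}.
Local Open Scope ereal_scope.
Implicit Types r : R.

Definition poisson_mass r (k : nat) : R := (expR (- r) * r ^+ k / k`!%:R)%R.

Lemma poisson_mass_ge0 r k : (0 <= r)%R -> (0 <= poisson_mass r k)%R.
Proof. by move=> r0; rewrite !mulr_ge0 ?expR_ge0 ?exprn_ge0 ?invr_ge0. Qed.

Lemma poisson_mass_sum r : (0 <= r)%R -> \sum_(k <oo) (poisson_mass r k)%:E = 1.
Proof.
move=> r0; rewrite [RHS](_ : _ = (expR (- r))%:E * (expR r)%:E); last first.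
  by rewrite -EFinM expRN mulVf ?gt_eqF ?expR_gt0.
under eq_eseriesr do rewrite /poisson_mass -mulrA EFinM.
rewrite nneseriesZl/=; last first.
  by move=> n _; rewrite lee_fin divr_ge0// exprn_ge0.
congr *%E; rewrite expRE -EFin_lim; last first.
  rewrite /pseries/=; under eq_fun do rewrite mulrC.
  exact: is_cvg_series_exp_coeff.
apply/congr_lim/funext => n/=; rewrite /pseries/= /series/= -sumEFin//.
by under eq_bigr do rewrite mulrC.
Qed.

Lemma poisson_mass_mean r : (0 <= r)%R ->
  \sum_(k <oo) k%:R%:E * (poisson_mass r k)%:E = r%:E.
Proof.
move=> r0; rewrite nneseries_recl//; last first.
  by move=> k _; rewrite mule_ge0 ?lee_fin ?poisson_mass_ge0.
rewrite mul0e add0e -nneseries_addn; last first.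
  by move=> k; rewrite mule_ge0 ?lee_fin ?poisson_mass_ge0.
rewrite (eq_eseriesr (g := fun k => r%:E * (poisson_mass r k)%:E)); last first.
  move=> k _; rewrite -!EFinM addn1 /poisson_mass exprS factS natrM invfM.
  congr (_%:E); rewrite [LHS](_ : _ = (k.+1%:R / k.+1%:R) *
    (r * (expR (- r) * r ^+ k / k`!%:R)))%R; last by ring.
  by rewrite divff ?mul1r// pnatr_eq0.
rewrite nneseriesZl ?poisson_mass_sum ?mule1// => k _.
by rewrite lee_fin poisson_mass_ge0.
Qed.

(** The probability of two or more points is quadratic in the mean, because exp(-r) >= 1 - r. Hence
    it stays small when summed over n cells of mass of order 1/n, as in [distinct_times]. *)
Lemma poisson_mass_ge2 r : (0 <= r)%R ->
  (1 - poisson_mass r 0 - poisson_mass r 1 <= r ^+ 2)%R.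
Proof.
move=> r0; rewrite /poisson_mass expr0 expr1 !divr1 mulr1.
have := expR_ge1Dx (- r); have := expR_ge0 (- r).
move=> e0 e1.
have : (expR (- r) * (1 + r) >= (1 - r) * (1 + r))%R.
  by apply: ler_wpM2r => //; lra.
by move=> ?; nra.
Qed.

End poisson_mass.

Section tuple_measure.
Context {R : realType} d (S : measurableType d).
Local Open Scope ereal_scope.

Definition cons_tup n (p : S * n.-tuple S) : n.+1.-tuple S := [tuple of p.1 :: p.2].

Lemma measurable_cons_tup n : measurable_fun setT (@cons_tup n).
Proof. exact: measurable_cons. Qed.

HB.instance Definition _ n :=
  isMeasurableFun.Build _ _ _ _ (@cons_tup n) (@measurable_cons_tup n).

Lemma cons_tup_inj n : injective (@cons_tup n).
Proof. by move=> [p s] [q t] /(congr1 val)/= [-> /val_inj ->]. Qed.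

Lemma cons_tupK n (s : n.+1.-tuple S) : cons_tup (thead s, [tuple of behead s]) = s.
Proof. by rewrite [in RHS](tuple_eta s). Qed.

Section step.
Variables (mu : {finite_measure set S -> \bar R}) (n : nat)
  (nu : {finite_measure set (n.-tuple S) -> \bar R}).

Definition cons_tup_measure : set (n.+1.-tuple S) -> \bar R :=
  pushforward (mu \x nu) (@cons_tup n).

Let cons_tup_measure0 : cons_tup_measure set0 = 0.
Proof. exact: measure0. Qed.

Let cons_tup_measure_ge0 A : 0 <= cons_tup_measure A.
Proof. exact: measure_ge0. Qed.

Let cons_tup_measure_sigma_additive : semi_sigma_additive cons_tup_measure.
Proof. exact: measure_semi_sigma_additive. Qed.

HB.instance Definition _ := isMeasure.Build _ _ _ cons_tup_measure
  cons_tup_measure0 cons_tup_measure_ge0 cons_tup_measure_sigma_additive.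

Lemma cons_tup_measure_setT : cons_tup_measure setT = mu setT * nu setT.
Proof.
by rewrite /cons_tup_measure /pushforward preimage_setT -setXTT product_measure1E.
Qed.

Let cons_tup_measure_fin : fin_num_fun cons_tup_measure.
Proof.
apply: lty_fin_num_fun; rewrite [ltLHS]cons_tup_measure_setT.
by rewrite ltey_eq fin_numM// fin_num_measure.
Qed.

HB.instance Definition _ := Measure_isFinite.Build _ _ _ cons_tup_measure
  cons_tup_measure_fin.

End step.

Variable mu : {finite_measure set S -> \bar R}.

(** The n-th power of [mu], built from the head because the later arguments separate the latest
    point of a tuple from its past. *)
Fixpoint tuple_measure n : {finite_measure set (n.-tuple S) -> \bar R} :=
  match n with
  | 0 => dirac [tuple]
  | n.+1 => cons_tup_measure mu (tuple_measure n)
  end.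

Lemma tuple_measureS n Z :
  tuple_measure n.+1 Z = (mu \x tuple_measure n) (@cons_tup n @^-1` Z).
Proof. by []. Qed.

Lemma tuple_measure_setT n : tuple_measure n setT = mu setT ^+ n.
Proof.
elim: n => [|n ih]; first by rewrite /= diracT.
by rewrite expeS -ih; exact: cons_tup_measure_setT.
Qed.

Lemma integral_tuple_measureS n (f : n.+1.-tuple S -> \bar R) :
  measurable_fun setT f -> (forall s, 0 <= f s) ->
  \int[tuple_measure n.+1]_s f s =
  \int[mu]_p \int[tuple_measure n]_s f (cons_tup (p, s)).
Proof.
move=> mf f0.
have := @ge0_integral_pushforward _ _ _ _ R _ (measurable_cons_tup (n := n))
  (mu \x tuple_measure n) setT f.
move=> -> //; rewrite preimage_setT fubini_tonelli1//.
  by apply: measurableT_comp => //; exact: measurable_cons_tup.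
by move=> x; exact: f0.
Qed.

(** Each of the n coordinates contributes the integral of [g] times the mass of the n - 1 others.
    The value of [n.-1] at 0 does not matter, since the factor n vanishes there. *)
Lemma integral_tuple_measure_sum n (g : S -> \bar R) :
  measurable_fun setT g -> (forall p, 0 <= g p) ->
  \int[tuple_measure n]_s (\sum_(p <- s) g p) =
  n%:R%:E * (mu setT ^+ n.-1 * \int[mu]_p g p).
Proof.
move=> mg g0; elim: n => [|n ih].
  by rewrite mul0e; apply: integral0_eq => s _; rewrite tuple0 big_nil.
have msum k : measurable_fun setT (fun s : k.-tuple S => \sum_(p <- s) g p).
  under eq_fun do rewrite big_tuple.
  apply: emeasurable_sum => i.
  by apply: (measurableT_comp mg); exact: measurable_tnth.
have sum0 (s : seq S) : 0 <= \sum_(p <- s) g p by exact: sume_ge0.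
have cstE (c : \bar R) : \int[tuple_measure n]_s c = c * mu setT ^+ n.
  by rewrite integral_cst// -tuple_measure_setT.
rewrite integral_tuple_measureS//.
under eq_integral => p _.
  under eq_integral => s _ do rewrite /= big_cons.
  rewrite ge0_integralD//; last exact: msum.
  rewrite cstE ih.
  over.
have muT : mu setT \is a fin_num by exact: fin_num_measure.
rewrite ge0_integralD//; first last.
- by move=> p _; rewrite mule_ge0// mule_ge0 ?expe_ge0// integral_ge0.
- exact: emeasurable_funM.
- by move=> p _; rewrite mule_ge0// expe_ge0.
rewrite ge0_integralZr// ?expe_ge0// integral_cst//.
case: n ih {cstE} => [|n] ih; first by rewrite !mul0e adde0 /= mule1 !mul1e.
rewrite /= [\int[_]_p g p * _]muleC; set I := \int[mu]_p g p.
have -> : n.+1%:R%:E * (mu setT ^+ n * I) * mu setT =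
    n.+1%:R%:E * (mu setT ^+ n.+1 * I).
  by rewrite -!muleA [I * _]muleC (muleA _ _ I) [mu _ ^+ n * _]muleC -expeS.
by rewrite -[X in X + _]mul1e -ge0_muleDl// -EFinD nat1r.
Qed.

End tuple_measure.

(** * Finite Poisson processes *)

Section finite_poisson.
Context {R : realType} d (Omega : measurableType d) (P : probability Omega R).
Context d' (S : measurableType d').
Local Open Scope ereal_scope.

Lemma eq_probability_ae (G A B : set Omega) :
  measurable G -> measurable A -> measurable B -> P (~` G) = 0 ->
  (forall w, G w -> A w <-> B w) -> P A = P B.
Proof.
move=> mG mA mB G0 AB.
suff H (A' B' : set Omega) : measurable A' -> measurable B' ->
    (forall w, G w -> A' w -> B' w) -> P A' <= P B'.
  by apply/eqP; rewrite eq_le !H// => w /AB[].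
move=> mA' mB' sub; rewrite -[leRHS]adde0 -G0.
apply: (le_trans _ (measureU2 P mB' (measurableC mG))).
apply: le_measure; rewrite ?inE//; first by apply: measurableU => //; exact: measurableC.
move=> w A'w; have [Gw|nGw] := pselect (G w); last by right.
by left; exact: sub.
Qed.

Definition finite_poisson (mu : set S -> \bar R) (Psi : Omega -> set S) :=
  [/\ @random_finite R _ _ _ _ Psi,
      forall A, measurable A -> forall k : nat,
        P [set w | counting (Psi w `&` A) = k%:R%:E :> \bar R] =
        (poisson_mass (fine (mu A)) k)%:E &
      forall n (A : 'I_n -> set S) (c : 'I_n -> \bar R),
        (forall i, measurable (A i)) -> trivIset setT A ->
        P [set w | forall i, counting (Psi w `&` A i) = c i] =
        \prod_(i < n) P [set w | counting (Psi w `&` A i) = c i]].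

(** The Poisson masses of finite mean add up to one, so the count in [DM] is almost surely finite.
    Replacing the points by the empty set on the exceptional event makes [Psi] finite for every
    sample point, which [random_finite] demands, and changes no probability. *)
Lemma poisson_restrict (D : set S) (nu : {measure set S -> \bar R})
    (Pi : Omega -> set S) (DM : set S) (mDM : measurable DM) :
  poisson_random_measure P D nu Pi -> DM `<=` D -> nu DM < +oo ->
  exists Psi, [/\ finite_poisson (mrestr nu mDM) Psi,
    {ae P, forall w, Psi w = Pi w `&` DM} & forall w, Psi w `<=` DM].
Proof.
move=> [Pi_ctbl Pi_meas Pi_mass _ Pi_indep] DMD nuDM.
pose G := [set w | finite_set (Pi w `&` DM)].
have GE : G = \bigcup_k [set w | counting (Pi w `&` DM) = k%:R%:E :> \bar R].
  apply/seteqP; split => w /=.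
    by move=> fw; eexists => //=; rewrite counting_fin.
  by move=> [k _ /= E]; apply/asboolP; rewrite -(@counting_fin_num R) E.
have mev A (c : \bar R) : measurable A ->
    measurable [set w | counting (Pi w `&` A) = c].
  move=> mA; rewrite [X in measurable X](_ : _ = setT `&`
    (fun w => counting (Pi w `&` A)) @^-1` [set c]); last by rewrite setTI.
  by apply: Pi_meas => //; exact: emeasurable_set1.
have mG : measurable G.
  by rewrite GE; apply: bigcupT_measurable => k; exact: mev.
have PG : P (~` G) = 0.
  rewrite probability_setC// GE measure_bigcup//=.
  - rewrite (eq_eseriesr (g := fun k => (poisson_mass (fine (nu DM)) k)%:E)).
      rewrite (eq_eseriesl (Q := xpredT)); last by move=> k; rewrite in_setT.
      by rewrite poisson_mass_sum ?fine_ge0// subee.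
    by move=> k _; exact: Pi_mass.
  - by move=> k _; exact: mev.
  - by move=> i j _ _ [w [/= -> /eqP]]; rewrite eqe eqr_nat => /eqP.
pose Psi w := [set p | G w /\ (Pi w `&` DM) p].
have PsiE w A : G w -> Psi w `&` A = Pi w `&` (DM `&` A).
  move=> Gw; apply/seteqP; split => p /=.
    by move=> [[_ [? ?]] ?]; split.
  by move=> [? [? ?]].
have PsiN w A : ~ G w -> Psi w `&` A = set0.
  by move=> Gw; apply/seteqP; split => p //= [[]].
have Psi_rf : @random_finite R _ _ _ _ Psi.
  split=> [w|A mA].
    have [Gw|Gw] := pselect (G w); last by rewrite -(setIT (Psi w)) PsiN.
    by rewrite -(setIT (Psi w)) PsiE// setIT.
  apply: (eq_measurable_fun (fun w => counting (Pi w `&` (DM `&` A)) * (\1_G w)%:E)).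
    move=> w _; rewrite indicE; case: (boolP (w \in G)) => [/set_mem Gw|/negP Gw].
      by rewrite PsiE// mule1.
    by rewrite PsiN ?mule0 ?counting_set0// => /mem_set.
  apply: emeasurable_funM; first by apply: Pi_meas; exact: measurableI.
  exact/measurable_EFinP/measurable_indic.
have mev' A (c : \bar R) : measurable A ->
    measurable [set w | counting (Psi w `&` A) = c].
  move=> mA; rewrite [X in measurable X](_ : _ = setT `&`
    (fun w => counting (Psi w `&` A)) @^-1` [set c]); last by rewrite setTI.
  by apply: Psi_rf.2 => //; exact: emeasurable_set1.
have Pev A (c : \bar R) : measurable A ->
    P [set w | counting (Psi w `&` A) = c] =
    P [set w | counting (Pi w `&` (DM `&` A)) = c].
  move=> mA; apply: (eq_probability_ae mG) => //; first exact: mev'.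
    by apply: mev; exact: measurableI.
  by move=> w Gw /=; rewrite PsiE.
exists Psi; split.
- split => //.
    move=> A mA k; rewrite Pev// /mrestr setIC Pi_mass//.
    + exact: measurableI.
    + by move=> p [] // _ /DMD.
    + by apply: le_lt_trans nuDM; apply: le_measure; rewrite ?inE//; exact: measurableI.
  move=> n A c mA tA.
  rewrite (eq_probability_ae (G := G) (B := [set w | forall i,
    counting (Pi w `&` (DM `&` A i)) = c i]))//.
  + rewrite Pi_indep//.
    * by apply: eq_bigr => i _; rewrite Pev.
    * by move=> i; exact: measurableI.
    * exact: trivIset_setIl.
  + rewrite [X in measurable X](_ : _ = \bigcap_(i in [set: 'I_n])
      [set w | counting (Psi w `&` A i) = c i]).
      by apply: fin_bigcap_measurable => // i _; exact: mev'.
    by apply/seteqP; split => w /= H i; [move=> _; exact: H|exact: (H i I)].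
  + rewrite [X in measurable X](_ : _ = \bigcap_(i in [set: 'I_n])
      [set w | counting (Pi w `&` (DM `&` A i)) = c i]).
      apply: fin_bigcap_measurable => // i _; apply: mev.
      exact: measurableI.
    by apply/seteqP; split => w /= H i; [move=> _; exact: H|exact: (H i I)].
  + by move=> w Gw /=; split => H i; have := H i; rewrite PsiE.
- exists (~` G); split; [exact: measurableC|by []|].
  move=> w /= H Gw; apply: H; rewrite -(setIT (Psi w)) PsiE// setIT//.
- by move=> w p [_ []].
Qed.

Variables (mu : {finite_measure set S -> \bar R}) (Psi : Omega -> set S).
Hypothesis Psi_poisson : finite_poisson mu Psi.

Let Psi_rf : @random_finite R _ _ _ _ Psi. Proof. by case: Psi_poisson. Qed.

Lemma measurable_count_event A (c : \bar R) : measurable A ->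
  measurable [set w | counting (Psi w `&` A) = c].
Proof.
move=> mA; rewrite [X in measurable X](_ : _ = setT `&`
  (fun w => counting (Psi w `&` A)) @^-1` [set c]); last by rewrite setTI.
by apply: Psi_rf.2 => //; exact: emeasurable_set1.
Qed.

(** These events stand in for the sigma-algebra generated by the points in [V]. They suffice because
    the induction only ever adds the count of one more disjoint set, and for them independence is
    literally the hypothesis on [Psi]. *)
Definition count_cylinder (V : set S) (F : set Omega) :=
  exists n (B : 'I_n -> set S) (c : 'I_n -> \bar R),
    [/\ forall i, measurable (B i), forall i, B i `<=` V, trivIset setT B &
        F = [set w | forall i, counting (Psi w `&` B i) = c i]].

Lemma count_cylinderT V : count_cylinder V setT.
Proof.
exists 0%N, (fun=> set0), (fun=> 0); split.
- by [].
- by case.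
- by case.
- by apply/seteqP; split => // w _ [].
Qed.

Lemma count_cylinderS V V' F : V `<=` V' ->
  count_cylinder V F -> count_cylinder V' F.
Proof.
move=> VV' [n [B [c [mB BV tB FE]]]]; exists n, B, c; split => //.
by move=> i; exact: subset_trans (BV i) VV'.
Qed.

Lemma measurable_count_cylinder V F : count_cylinder V F -> measurable F.
Proof.
move=> [n [B [c [mB BV tB ->]]]].
rewrite [X in measurable X](_ : _ = \bigcap_(i in [set: 'I_n])
  [set w | counting (Psi w `&` B i) = c i]).
  by apply: fin_bigcap_measurable => // i _; exact: measurable_count_event.
by apply/seteqP; split => w /= H i; [move=> _; exact: H|exact: (H i I)].
Qed.

Lemma count_cylinderI V F A (c : \bar R) :
  count_cylinder V F -> measurable A -> A `&` V = set0 ->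
  let E := [set w | counting (Psi w `&` A) = c] in
  count_cylinder (V `|` A) (F `&` E) /\ P (F `&` E) = P F * P E.
Proof.
move=> [n [B [b [mB BV tB FE]]]] mA AV E.
pose B' (i : 'I_n.+1) := oapp B A (unlift ord0 i).
pose b' (i : 'I_n.+1) := oapp b c (unlift ord0 i).
have mB' i : measurable (B' i) by rewrite /B'; case: unliftP => [j _|_] /=.
have tB' : trivIset setT B'.
  move=> i j _ _ [p []]; rewrite /B'.
  case: unliftP => [i' ->|->]; case: unliftP => [j' ->|->] //=.
  - by move=> Bi Bj; congr lift; apply: tB => //; exists p.
  - by move=> /BV Vp Ap; exfalso; have : set0 p by rewrite -AV.
  - by move=> Ap /BV Vp; exfalso; have : set0 p by rewrite -AV.
have FEE : F `&` E = [set w | forall i, counting (Psi w `&` B' i) = b' i].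
  rewrite FE; apply/seteqP; split => w /=.
    move=> [H1 H2] i; rewrite /B' /b'.
    by case: unliftP => [i' _|_] /=; [exact: H1|exact: H2].
  move=> H; split; last by have := H ord0; rewrite /B' /b' unlift_none.
  by move=> i; have := H (lift ord0 i); rewrite /B' /b' liftK.
split.
  exists n.+1, B', b'; split => //.
  move=> i; rewrite /B'; case: unliftP => [i' _|_] /=.
    by apply: subset_trans (BV i') _; exact: subsetUl.
  exact: subsetUr.
have [_ _ indep] := Psi_poisson.
rewrite FEE (indep _ _ _ mB' tB') big_ord_recl muleC FE (indep _ _ _ mB tB).
congr (_ * _); last by rewrite /B' /b' unlift_none.
by apply: eq_bigr => i _; rewrite /B' /b' liftK.
Qed.

(* Both factors are computed on the events fixing the count in [A]. *)
Lemma integral_count_cylinder V F A (g : Omega -> \bar R) (a : R) :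
  count_cylinder V F -> measurable A -> A `&` V = set0 ->
  measurable_fun setT g -> (forall w, 0 <= g w) -> (0 <= a)%R ->
  (forall F', count_cylinder (V `|` A) F' -> \int[P]_(w in F') g w = a%:E * P F') ->
  \int[P]_(w in F) (counting (Psi w `&` A) * g w) = mu A * a%:E * P F.
Proof.
move=> FV mA AV mg g0 a0 Hg.
have mF := measurable_count_cylinder FV.
pose E k := [set w | counting (Psi w `&` A) = k%:R%:E :> \bar R].
have mE k : measurable (E k) by exact: measurable_count_event.
have countE w : counting (Psi w `&` A) * g w =
    \sum_(k <oo) k%:R%:E * (g w * (\1_(E k) w)%:E).
  have fA : finite_set (Psi w `&` A) by apply: finite_setIl; exact: Psi_rf.1.
  have cE := counting_fin (R := R) fA; set k0 := #|` _| in cE.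
  rewrite (nneseriesD1 (n := k0))//; last first.
    by move=> k _; rewrite mule_ge0 ?lee_fin// mule_ge0// lee_fin.
  rewrite eseries0 ?adde0.
    by rewrite cE indicE mem_set ?mule1.
  move=> k _ /= kk0; rewrite indicE memNset ?mule0//.
  rewrite /E /= cE => -[] /eqP; rewrite eqr_nat => /eqP k0k.
  by rewrite k0k eqxx in kk0.
under eq_integral do rewrite countE.
rewrite integral_nneseries//; last 2 first.
- move=> k; apply: measurable_funTS; apply: emeasurable_funM => //.
  apply: emeasurable_funM => //; exact/measurable_EFinP/measurable_indic.
- by move=> k w _; rewrite mule_ge0 ?lee_fin// mule_ge0// lee_fin.
have muA0 : (0 <= fine (mu A))%R by rewrite fine_ge0.
have fPF : P F \is a fin_num by exact: fin_num_measure.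
rewrite (eq_eseriesr (g := fun k => P F * (a%:E * (k%:R%:E * (poisson_mass (fine (mu A)) k)%:E)))).
  rewrite -{1}(fineK fPF) nneseriesZl; last first.
    by move=> k _; rewrite !mule_ge0 ?lee_fin ?poisson_mass_ge0.
  rewrite fineK// nneseriesZl; last first.
    by move=> k _; rewrite !mule_ge0 ?lee_fin ?poisson_mass_ge0.
  rewrite poisson_mass_mean// fineK ?fin_num_measure//.
  by rewrite muleC [a%:E * _]muleC.
move=> k _; rewrite ge0_integralZl//; last 2 first.
- apply: measurable_funTS; apply: emeasurable_funM => //.
  exact/measurable_EFinP/measurable_indic.
- by move=> w _; rewrite mule_ge0// lee_fin.
rewrite (eq_integral (g \_ (E k))); last first.
  move=> w _; rewrite patchE indicE; case: ifPn => _; first by rewrite mule1.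
  by rewrite mule0.
rewrite -integral_mkcondr.
rewrite Hg; last by have [] := count_cylinderI (k%:R%:E) FV mA AV.
have [_ ->] := count_cylinderI (k%:R%:E) FV mA AV.
have [_ Pm _] := Psi_poisson; rewrite Pm//.
by rewrite [a%:E * (P F * _)]muleCA [LHS]muleCA [in LHS](muleCA k%:R%:E).
Qed.

End finite_poisson.

(** * Campbell's formula for decreasing tuples *)

Lemma counting_setU {R : realType} (T : choiceType) (A B : set T) :
  finite_set A -> finite_set B -> A `&` B = set0 ->
  (counting (A `|` B) = counting A + counting B :> \bar R)%E.
Proof.
move=> fA fB AB; rewrite (counting_fin fA) (counting_fin fB).
rewrite counting_fin ?finite_setU//.
by rewrite -EFinD -natrD -cardfsUI -fset_setU// -fset_setI// AB fset_set0 cardfs0 addn0.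
Qed.

Section random_finite_operations.
Context {R : realType} d (Omega : measurableType d).
Local Open Scope ereal_scope.
Local Notation random_finite := (@random_finite R).

Lemma random_finiteI d' (T : measurableType d') (Phi : Omega -> set T) (A : set T) :
  measurable A -> random_finite Phi -> random_finite (fun w => Phi w `&` A).
Proof.
move=> mA [Pf Pm]; split=> [w|B mB]; first exact: finite_setIl.
by under eq_fun do rewrite -setIA; apply: Pm; exact: measurableI.
Qed.

Lemma random_finite_image d1 d2 (T1 : measurableType d1) (T2 : measurableType d2)
    (f : T1 -> T2) (Phi : Omega -> set T1) :
  measurable_fun setT f -> injective f -> random_finite Phi ->
  random_finite (fun w => f @` Phi w).
Proof.
move=> mf injf [Pf Pm]; split=> [w|B mB]; first exact: finite_image.
apply: (eq_measurable_fun (fun w => counting (Phi w `&` f @^-1` B))).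
  move=> w _; rewrite -(counting_image _ injf); last exact: finite_setIl.
  congr counting; apply/seteqP; split=> [_ [x [Px Bx] <-]|_ [[x Px <-] Bx]].
    by split => //; exists x.
  by exists x.
by apply: Pm; rewrite -[X in measurable X]setTI; exact: mf.
Qed.

Section mean_count.
Context (P : probability Omega R) d' (T : measurableType d') (Phi : Omega -> set T)
  (F : set Omega).

(** The intensity measure of [Phi] on the event [F]. The two proofs are arguments so that the
    measure structure, which rests on them, can be attached to the term; two such measures can then
    be compared on a generating class. *)
Definition mean_count of random_finite Phi & measurable F := fun U : set T =>
  \int[P]_(w in F) counting (Phi w `&` U).

Variables (Phi_rf : random_finite Phi) (mF : measurable F).
Local Notation mc := (mean_count Phi_rf mF).

Let mean_count0 : mc set0 = 0.
Proof.
by rewrite /mean_count integral0_eq// => w _; rewrite setI0 counting_set0.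
Qed.

Let mean_count_ge0 U : 0 <= mc U.
Proof. by apply: integral_ge0 => w _; exact: counting_ge0. Qed.

Let mean_count_sigma_additive : semi_sigma_additive mc.
Proof.
move=> U mU tU _; rewrite [X in _ --> X](_ : _ = \sum_(n <oo) mc (U n)).
  by apply: is_cvg_ereal_nneg_natsum => n _; exact: mean_count_ge0.
rewrite /mean_count -integral_nneseries//.
- apply: eq_integral => w _; rewrite setI_bigcupr counting_bigcup//.
  exact: trivIset_setIl.
- by move=> n; apply: measurable_funTS; exact: Phi_rf.2.
Qed.

HB.instance Definition _ := isMeasure.Build _ _ _ mc
  mean_count0 mean_count_ge0 mean_count_sigma_additive.

End mean_count.

End random_finite_operations.

Section chains.
Context {S : Type} (T : nat -> set S).

(** For an increasing [T], these are the sequences with entries in the layers [T j.+1 \ T j], j < i,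
    at most one per layer and the outer layers first. Disjointness of the layers is what gives
    access to independence. *)
Fixpoint chain i (s : seq S) : Prop :=
  match i with
  | 0 => s = [::]
  | j.+1 => chain j s \/
    if s is p :: s' then (T i `\` T j) p /\ chain j s' else False
  end.

Lemma chain_nil i : chain i [::].
Proof. by elim: i => //= i ih; left. Qed.

Lemma chainW i j s : (i <= j)%N -> chain i s -> chain j s.
Proof.
by move=> /subnKC <-; elim: (j - i)%N => [|k ih] H; rewrite ?addn0// addnS; left; exact: ih.
Qed.

Hypothesis TS : forall i, T i `<=` T i.+1.

Lemma chain_head i p s : chain i (p :: s) -> T i p.
Proof. by elim: i => //= i ih [/ih/TS//|[[]]]. Qed.

End chains.

Definition chain_tuples {S : Type} (T : nat -> set S) i n : set (n.-tuple S) :=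
  [set s | chain T i s].

Definition tuples_in {S : choiceType} (A : set S) n : set (n.-tuple S) :=
  [set s | forall p, p \in (s : seq S) -> A p].

Lemma tuples_in0 {S : choiceType} (A : set S) : tuples_in A (n:=0) = [set [tuple]].
Proof. by apply/seteqP; split => s //= _; rewrite tuple0. Qed.

Lemma tuples_inS d (S : measurableType d) (A : set S) n :
  tuples_in A (n:=n.+1) = @cons_tup _ S n @` (A `*` tuples_in A (n:=n)).
Proof.
apply/seteqP; split => [s sA|_ [[p s] [/= Ap As] <-] q].
  exists (thead s, [tuple of behead s]); last exact: cons_tupK.
  split => /=; first by apply: sA; rewrite (tuple_eta s) inE eqxx.
  by move=> q qs; apply: sA; exact: mem_behead.
by rewrite inE => /orP[/eqP ->//|]; exact: As.
Qed.

Section campbell.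
Context {R : realType} d (Omega : measurableType d) (P : probability Omega R).
Context d' (S : measurableType d').
Variables (mu : {finite_measure set S -> \bar R}) (Psi : Omega -> set S).
Hypothesis Psi_poisson : finite_poisson P mu Psi.
Local Open Scope ereal_scope.
Local Notation random_finite := (@random_finite R).
Local Notation cylinder := (@count_cylinder R _ _ _ _ Psi).

Let Psi_rf : random_finite Psi. Proof. by case: Psi_poisson. Qed.

Lemma random_finite_tuples n : random_finite (fun w => tuples_in (Psi w) (n:=n)).
Proof.
elim: n => [|n ih].
  under eq_fun do rewrite tuples_in0.
  by split=> // A mA; exact: measurable_cst.
under eq_fun do rewrite tuples_inS.
apply: random_finite_image; [exact: measurable_cons_tup|exact: cons_tup_inj|].
exact: random_finiteX.
Qed.

(** For a rectangle [U] this is [integral_count_cylinder]. Both sides are finite measures in [U], so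
    their agreement on the rectangles, which are closed under intersection, extends it to all
    measurable sets. *)
Lemma mean_count_prod d1 (Y : measurableType d1) (nu : {finite_measure set Y -> \bar R})
    (Phi : Omega -> set Y) (V A : set S) (C : set Y) (F : set Omega) (U : set (S * Y)) :
  random_finite Phi -> measurable A -> measurable C -> A `&` V = set0 ->
  (forall F' Z, cylinder (V `|` A) F' -> measurable Z ->
    \int[P]_(w in F') counting (Phi w `&` Z) = nu (Z `&` C) * P F') ->
  cylinder V F -> measurable U ->
  \int[P]_(w in F) counting (((Psi w `&` A) `*` Phi w) `&` U) =
  (mu \x nu) (U `&` A `*` C) * P F.
Proof.
move=> Phi_rf mA mC AV Hnu FV mU.
have mF := measurable_count_cylinder Psi_poisson FV.
have rf := random_finiteX (random_finiteI mA Psi_rf) Phi_rf.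
have PF0 : (0 <= fine (P F))%R by exact: fine_ge0.
pose m2 := mscale (NngNum PF0) (mrestr (mu \x nu) (measurableX mA mC)).
have fPF : P F \is a fin_num by exact: fin_num_measure.
have m2E W : m2 W = (fine (P F))%:E * (mu \x nu) (W `&` A `*` C) by [].
have rectE A1 A2 : measurable A1 -> measurable A2 ->
    mean_count P rf mF (A1 `*` A2) = m2 (A1 `*` A2).
  move=> mA1 mA2.
  have -> : m2 (A1 `*` A2) = mu (A `&` A1) * nu (A2 `&` C) * P F.
    rewrite m2E fineK// -setXI product_measure1E//; try exact: measurableI.
    by rewrite muleC (setIC A).
  rewrite /mean_count (eq_integral (fun w => counting (Psi w `&` (A `&` A1)) *
      counting (Phi w `&` A2))); last first.
    move=> w _; rewrite -setXI counting_setX ?setIA//.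
    + by do 2 apply: finite_setIl; exact: Psi_rf.1.
    + by apply: finite_setIl; exact: Phi_rf.1.
  have fnu : nu (A2 `&` C) \is a fin_num by apply: fin_num_measure; exact: measurableI.
  rewrite (integral_count_cylinder (a := fine (nu (A2 `&` C))) Psi_poisson FV)//.
  - by rewrite fineK.
  - exact: measurableI.
  - by apply/seteqP; split => // p [[Ap _] Vp]; rewrite -AV.
  - exact: Phi_rf.2.
  - by rewrite fine_ge0.
  - by move=> F' F'V; rewrite fineK// Hnu//; apply: count_cylinderS F'V => p [|[]]; [left|right].
apply: etrans (_ : m2 U = _).
  apply: (measure_unique [set A1 `*` A2 | A1 in measurable & A2 in measurable]
    (fun=> setT) _ _ _ _ (mean_count P rf mF) m2) => //.
  - exact: measurable_prod_measurableType.
  - move=> _ _ [A1 mA1 [B1 mB1 <-]] [A2 mA2 [B2 mB2 <-]].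
    exists (A1 `&` A2); first exact: measurableI.
    by exists (B1 `&` B2); [exact: measurableI|rewrite setXI].
  - by move=> _; exists setT => //; exists setT => //; rewrite setXTT.
  - by rewrite bigcup_const//; exists 0%N.
  - by move=> _ [A1 mA1 [A2 mA2 <-]]; exact: rectE.
  - move=> _; have := rectE setT setT measurableT measurableT.
    move=> E; apply: (@le_lt_trans _ _ (m2 ([set: S] `*` [set: Y]))).
      by rewrite -E setXTT.
    rewrite m2E setXTT setTI.
    rewrite lte_mul_pinfty// ?lee_fin//; rewrite product_measure1E//.
    by rewrite lte_mul_pinfty// ?fin_num_measure// ltey_eq fin_num_measure.
by rewrite m2E fineK// muleC.
Qed.

Variable T : nat -> set S.
Hypothesis mT : forall i, measurable (T i).
Hypothesis TS : forall i, T i `<=` T i.+1.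

Local Notation chains i n := (chain_tuples T i (n:=n)).

Lemma chain_tuplesT i : chains i 0 = setT.
Proof.
apply/seteqP; split => // s _; rewrite /chain_tuples /= tuple0; exact: chain_nil.
Qed.

Lemma chain_tuples0 n : chains 0 n.+1 = set0.
Proof.
by apply/seteqP; split => // s; rewrite /chain_tuples /= (tuple_eta s).
Qed.

Lemma chain_tuplesS i n : chains i.+1 n.+1 =
  chains i n.+1 `|` @cons_tup _ S n @` ((T i.+1 `\` T i) `*` chains i n).
Proof.
apply/seteqP; split => s; rewrite /chain_tuples /=.
  case=> [|sA]; [by left|right].
  exists (thead s, [tuple of behead s]); last exact: cons_tupK.
  by move: sA; case: s => -[//|p s] ?.
by case=> [|[[p t] [/= Ap Ct] <-]]; [left|right].
Qed.

Lemma measurable_cons_image n (A : set S) (C : set (n.-tuple S)) :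
  measurable A -> measurable C -> measurable (@cons_tup _ S n @` (A `*` C)).
Proof.
move=> mA mC; rewrite (_ : _ @` _ = ((fun s : n.+1.-tuple S => thead s) @^-1` A) `&`
     ((fun s : n.+1.-tuple S => [tuple of behead s]) @^-1` C)).
  apply: measurableI; first by rewrite -[X in measurable X]setTI; exact: measurable_tnth.
  by rewrite -[X in measurable X]setTI; exact: measurable_behead.
apply/seteqP; split => [_ [[p t] [/= Ap Ct] <-] /=|s [/= As Cs]].
  split; first by [].
  by rewrite (_ : [tuple of _] = t)//; exact: val_inj.
by exists (thead s, [tuple of behead s]); last exact: cons_tupK.
Qed.

Lemma measurable_chain i n : measurable (chains i n).
Proof.
elim: i n => [|i ih] [|n]; rewrite ?chain_tuplesT ?chain_tuples0//.
rewrite chain_tuplesS; apply: measurableU; first exact: ih.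
by apply: measurable_cons_image; [exact: measurableD|exact: ih].
Qed.

(** Induction on the number of layers: a chain either avoids the newest layer or has its head there
    and its tail in the previous ones, and then [mean_count_prod] factors the two. The event [F] is
    carried along because fixing the count in the newest layer turns an event outside [T i.+1] into
    one outside [T i], to which the induction hypothesis applies. *)
Lemma campbell_chain i n Z F : measurable Z -> cylinder (~` T i) F ->
  \int[P]_(w in F) counting (tuples_in (Psi w) (n:=n) `&` Z `&` chain_tuples T i (n:=n)) =
  tuple_measure mu n (Z `&` chain_tuples T i (n:=n)) * P F.
Proof.
move=> mZ cF; have mF := measurable_count_cylinder Psi_poisson cF.
elim: i n Z F mF mZ cF => [|i ih] [|n] Z F mF mZ cF.
- rewrite !chain_tuplesT setIT; under eq_integral do rewrite setIT tuples_in0.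
  rewrite integral_cst// /= diracE; congr (_ * _).
  case: (boolP (_ \in Z)) => [/set_mem Zn|/negP Zn].
    by rewrite setIidl ?counting_set1// => _ ->.
  rewrite (_ : _ `&` _ = set0) ?counting_set0//.
  by apply/seteqP; split => // x [->] /mem_set.
- rewrite !chain_tuples0 setI0 measure0 mul0e; apply: integral0_eq => w _.
  by rewrite setI0 counting_set0.
- rewrite !chain_tuplesT -(chain_tuplesT i); apply: ih => //.
  by apply: count_cylinderS cF; apply: subsetC; exact: TS.
set A := T i.+1 `\` T i; set C := fun k => chain_tuples T i (n:=k).
have mA : measurable A by exact: measurableD.
have mC k : measurable (C k) by exact: measurable_chain.
pose Ac := @cons_tup _ S n @` (A `*` C n).
have chainE : chains i.+1 n.+1 = C n.+1 `|` Ac by exact: chain_tuplesS.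
have disj : C n.+1 `&` Ac = set0.
  apply/seteqP; split => // s [/= Cs [[p t] [/= [_ Tp] _] E]].
  by move: Cs; rewrite -E => /(chain_head TS).
have mAc : measurable Ac by exact: measurable_cons_image.
have cF' : cylinder (~` T i) F.
  by apply: count_cylinderS cF; apply: subsetC; exact: TS.
rewrite chainE setIUr measureU; first last.
- by rewrite setIACA disj setI0.
- exact: measurableI.
- by apply: measurableI => //; exact: mC.
have mtup k Z' : measurable Z' -> measurable_fun F
    (fun w => counting (tuples_in (Psi w) (n:=k) `&` Z') : \bar R).
  by move=> mZ'; apply: measurable_funTS; exact: (random_finite_tuples k).2.
rewrite ge0_muleDl//.
rewrite -(ih n.+1 Z F)//.
have step : \int[P]_(w in F) counting (((Psi w `&` A) `*`
      (tuples_in (Psi w) (n:=n) `&` C n)) `&` (@cons_tup _ S n @^-1` Z)) =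
    tuple_measure mu n.+1 (Z `&` Ac) * P F.
  have mU : measurable (@cons_tup _ S n @^-1` Z).
    by rewrite -[X in measurable X]setTI; exact: measurable_cons_tup.
  have AT : A `&` ~` T i.+1 = set0.
    by apply/seteqP; split => // p [[]].
  rewrite (mean_count_prod (nu := tuple_measure mu n)
    (random_finiteI (mC n) (random_finite_tuples n)) mA (mC n) AT _ cF mU).
    rewrite tuple_measureS; congr (_ * _); congr (_ _).
    apply/seteqP; split => [[p t] [/= Zpt [/= Ap Ct]]|[p t] [/= Zpt [[q u] [/= Aq Cu] E]]].
      by split => //; exists (p, t).
    by case: (cons_tup_inj E) => qp ut; rewrite qp ut in Aq Cu; split.
  move=> F' Z' cF'' mZ'.
  under eq_integral do rewrite -setIA [C n `&` Z']setIC setIA.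
  have mF'' := measurable_count_cylinder Psi_poisson cF''.
  apply: (ih n Z' F' mF'' mZ').
  by apply: count_cylinderS cF'' => p [Tp /TS//|[]//].
have countE w : counting (((Psi w `&` A) `*`
      (tuples_in (Psi w) (n:=n) `&` C n)) `&` (@cons_tup _ S n @^-1` Z)) =
    counting (tuples_in (Psi w) (n:=n.+1) `&` (Z `&` Ac)) :> \bar R.
  rewrite -(counting_image _ (@cons_tup_inj _ _ n)); last first.
    apply: finite_setIl; apply: finite_setX; apply: finite_setIl.
      exact: Psi_rf.1.
    exact: (random_finite_tuples n).1.
  congr counting; rewrite tuples_inS; apply/seteqP; split.
    move=> _ [[p t] [[[/= Pp Ap] [tP Ct]] Zpt] <-]; split; first by exists (p, t).
    by split => //; exists (p, t).
  move=> _ [[[p t] [/= Pp tP] <-] [Zpt [[q u] [/= Aq Cu] /cons_tup_inj -[E1 E2]]]].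
  by rewrite E1 E2 in Aq Cu; exists (p, t).
rewrite -step -ge0_integralD//.
- apply: eq_integral => w _; rewrite countE -counting_setU.
  + by rewrite setIUr [in RHS]setIA.
  + by do 2 apply: finite_setIl; exact: (random_finite_tuples _).1.
  + by apply: finite_setIl; exact: (random_finite_tuples _).1.
  + apply/seteqP; split => // s [[_ Cs] [_ [_ As]]].
    by have : (C n.+1 `&` Ac) s by []; rewrite disj.
- apply: (eq_measurable_fun (fun w =>
    counting (tuples_in (Psi w) (n:=n.+1) `&` (Z `&` C n.+1)))).
    by move=> w _; rewrite setIA.
  by apply: mtup; exact: measurableI.
- apply: (eq_measurable_fun (fun w =>
    counting (tuples_in (Psi w) (n:=n.+1) `&` (Z `&` Ac)))).
    by move=> w _; rewrite countE.
  by apply: mtup; exact: measurableI.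
Qed.

End campbell.

(** * Tuples with decreasing times, seen on fine grids of the time axis *)

Section decreasing_tuples.
Context {R : realType} d (Omega : measurableType d) (P : probability Omega R).
Context d' (S : measurableType d').
Variables (mu : {finite_measure set S -> \bar R}) (Psi : Omega -> set S).
Hypothesis Psi_poisson : finite_poisson P mu Psi.
Variable tau : S -> R.
Hypothesis mtau : measurable_fun setT tau.
Hypothesis tau01 : forall w p, Psi w p -> 0 <= tau p <= 1.

Let Psi_rf : @random_finite R _ _ _ _ Psi. Proof. by case: Psi_poisson. Qed.

Definition before n (i : nat) : set S := [set p | tau p < i%:R / n.+1%:R].

Lemma measurable_before n i : measurable (before n i).
Proof.
rewrite [X in measurable X](_ : _ = setT `&` tau @^-1` `]-oo, (i%:R / n.+1%:R)[).
  by apply: mtau => //; exact: measurable_itv.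
by rewrite setTI; apply/seteqP; split => p /=; rewrite in_itv.
Qed.

Lemma beforeS n i : before n i `<=` before n i.+1.
Proof.
move=> p; rewrite /before /= => /lt_le_trans; apply.
by rewrite ler_pM2r ?invr_gt0// ler_nat.
Qed.

Local Notation decreasing := (sorted (fun p q => tau q < tau p)).

(** A finite strictly decreasing sequence has a smallest gap; a grid finer than that gap separates
    all the times. The bound [x] on the times is what makes the induction on the tail possible. *)
Lemma chain_eventually s (x : R) : decreasing s ->
  (forall p, p \in s -> 0 <= tau p < x) ->
  exists n0, forall n, (n0 <= n)%N -> forall i, x <= i%:R / n.+1%:R ->
    chain (before n) i s.
Proof.
elim: s x => [|p s ih] x dec sx.
  by exists 0%N => n _ i _; exact: chain_nil.
have /andP[p0 px] : 0 <= tau p < x by apply: sx; rewrite inE eqxx.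
(* A time strictly between the head and the tail: the midpoint of the two latest times, or anything
   below [tau p] when the tail is empty. *)
have [y yp ys] : exists2 y, y < tau p & forall q, q \in s -> tau q < y.
  case: s dec {ih sx} => [_|q s /= /andP[qp dec]]; first by exists (tau p - 1) => //; lra.
  exists ((tau q + tau p) / 2); first lra.
  move=> r; rewrite inE => /orP[/eqP ->|rs]; first lra.
  have : tau r < tau q.
    have tr : transitive (fun p q : S => tau q < tau p).
      by move=> a b c ba cb; exact: lt_trans ba.
    by have /allP /(_ _ rs) := order_path_min tr dec.
  lra.
have [n1 Hn1] := ih y (path_sorted dec)
  (fun q qs => introT andP (conj (andP (sx q (mem_behead (s := p :: s) qs))).1 (ys q qs))).
(* With such a mesh the left end of the grid cell of [p] is still at least [y], so the tail is a
   chain in the cells before it. *)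
have [n2 Hn2] : exists n2, forall n, (n2 <= n)%N -> n.+1%:R^-1 <= tau p - y.
  have d0 : 0 < tau p - y by rewrite subr_gt0.
  exists (Num.truncn (tau p - y)^-1) => n n2n.
  rewrite -[leRHS]invrK lef_pV2 ?posrE ?invr_gt0//.
  by apply/ltW/(lt_le_trans (truncnS_gt _)); rewrite ler_nat.
exists (maxn n1 n2) => n; rewrite geq_max => /andP[n1n n2n] i xi.
pose j := Num.truncn (tau p * n.+1%:R).
have /andP[j1 j2] : (j%:R <= tau p * n.+1%:R < j.+1%:R).
  by apply: truncn_itv; rewrite mulr_ge0.
have n0 : 0 < n.+1%:R :> R by [].
have j1' : j%:R / n.+1%:R <= tau p by rewrite ler_pdivrMr.
have j2' : tau p < j.+1%:R / n.+1%:R by rewrite ltr_pdivlMr.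
apply: (@chainW _ _ j.+1).
  rewrite -(ltr_nat R) -(ltr_pM2r (x := n.+1%:R^-1)) ?invr_gt0//.
  exact: le_lt_trans j1' (lt_le_trans px xi).
right; split; first by split => //=; rewrite /before /=; apply/negP; rewrite -leNgt.
apply: Hn1 => //; have := Hn2 n n2n; move: j2'.
rewrite -[j.+1%:R](natr1 j) mulrDl mul1r => h1 h2.
by rewrite -(lerD2r n.+1%:R^-1); apply: le_trans (ltW h1); rewrite addrC -lerBrDr.
Qed.

Local Open Scope ereal_scope.

(* A decreasing tuple lies in distinct cells of every fine enough grid. *)
Lemma campbell_decreasing n (Z : set (n.-tuple S)) : measurable Z ->
  (forall s : n.-tuple S, Z s -> decreasing s) ->
  measurable [set w | exists2 s, tuples_in (Psi w) (n:=n) s & Z s] /\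
  P [set w | exists2 s, tuples_in (Psi w) (n:=n) s & Z s] <= tuple_measure mu n Z.
Proof.
move=> mZ Zdec.
have mex U : measurable U ->
    measurable [set w | exists2 s, tuples_in (Psi w) (n:=n) s & U s].
  move=> mU; rewrite (_ : [set w | _] = [set w | exists2 s,
      tuples_in (Psi w) (n:=n) s & ([set: Omega] `*` U) (w, s)]).
    apply: (random_finite_exists (R := R)); last exact: measurableX.
    exact: random_finite_tuples Psi_poisson n.
  by apply/seteqP; split => w [s Ps Us]; exists s => //; case: Us.
split; first exact: mex.
(* The 2(k+1) cells of length 1/(k+1) reach time 2, strictly beyond every event time; time 1 itself
   would be missed by the strict inequality in [before]. *)
pose C k := chain_tuples (before k) (k.+1).*2 (n:=n).
have mC k : measurable (C k).
  by apply: measurable_chain; exact: measurable_before.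
pose E k := [set w | exists2 s, tuples_in (Psi w) (n:=n) s & (Z `&` C k) s].
have mE k : measurable (E k) by apply: mex; exact: measurableI.
have PE k : P (E k) <= tuple_measure mu n Z.
  have := campbell_chain Psi_poisson (measurable_before k) (beforeS (n:=k))
    (i := (k.+1).*2) mZ (count_cylinderT Psi _).
  rewrite probability_setT mule1 => H.
  apply: (@le_trans _ _ (tuple_measure mu n (Z `&` C k))); last first.
    by apply: le_measure; rewrite ?inE//; exact: measurableI.
  rewrite -H -[X in P X]setIT -(integral_indic P measurableT (mE k)).
  apply: ge0_le_integral => //.
  - exact/measurable_EFinP/measurable_indic.
  - apply: (eq_measurable_fun (fun w => counting (tuples_in (Psi w) (n:=n) `&` (Z `&` C k)))).
      by move=> w _; rewrite setIA.
    by apply: (random_finite_tuples Psi_poisson n).2; exact: measurableI.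
  - move=> w _; rewrite indicE; case: (boolP (w \in E k)) => [|_].
      move=> /set_mem[s Ps [Zs Cs]]; apply: counting_ge1.
      by exists s; split; first by split.
    exact: counting_ge0.
(* The sets [C k] need not be monotone in k, but each decreasing tuple belongs to all of them from
   some index on. The tail intersections increase, so continuity from below applies to them. *)
pose G k := \bigcap_(j in [set j | (k <= j)%N]) E j.
have mG k : measurable (G k) by apply: bigcap_measurable => [|j _]; [by exists k => /=|exact: mE].
have GS : nondecreasing_seq G.
  by move=> i j ij; apply/subsetPset => w Gw l /= jl; apply: Gw => /=; exact: leq_trans jl.
have sub : [set w | exists2 s, tuples_in (Psi w) (n:=n) s & Z s] `<=` \bigcup_k G k.
  move=> w [s Ps Zs].
  have [|k0 Hk0] := @chain_eventually s 2 (Zdec s Zs).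
    by move=> p /Ps /tau01 /andP[-> /= /le_lt_trans]; apply; lra.
  exists k0 => // j /= k0j; exists s => //; split => //.
  apply: (Hk0 _ k0j); rewrite -muln2 natrM mulrAC divff ?mul1r//.
have mUG : measurable (\bigcup_k G k) by exact: bigcupT_measurable.
apply: (@le_trans _ _ (P (\bigcup_k G k))).
  by apply: le_measure; rewrite ?inE//; exact: mex.
have cvgG := nondecreasing_cvg_mu (mu := P) mG mUG GS.
rewrite -(cvg_lim _ cvgG)//; apply: lime_le; first by apply/cvg_ex; eexists; exact: cvgG.
near=> k; apply: le_trans (PE k); apply: le_measure; rewrite ?inE//.
by move=> w; apply => /=.
Unshelve. all: by end_near. Qed.

(** Two points with the same time share a cell of every time grid. A cell of length 1/(n+1) holds
    two points with probability at most (c/(n+1))^2, and the sum over the cells is of order 1/n. *)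
Lemma distinct_times (c : R) : (0 <= c)%R ->
  (forall a b, (a <= b)%R -> mu [set p | (a <= tau p < b)%R] <= (c * (b - a))%:E) ->
  {ae P, forall w, forall p q, Psi w p -> Psi w q -> tau p = tau q -> p = q}.
Proof.
move=> c0 mu_le.
pose cell n i := before n i.+1 `\` before n i.
have mcell n i : measurable (cell n i) by apply: measurableD; exact: measurable_before.
pose E n i := [set w | counting (Psi w `&` cell n i) = 0%:R%:E :> \bar R] `|`
  [set w | counting (Psi w `&` cell n i) = 1%:R%:E :> \bar R].
have mE n i : measurable (E n i).
  by apply: measurableU; exact: (measurable_count_event Psi_poisson).
have PE n i : P (~` E n i) <= ((c / n.+1%:R) ^+ 2)%:E.
  have mc m := measurable_count_event Psi_poisson m%:R%:E (mcell n i).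
  have [_ Pm _] := Psi_poisson.
  have PEU : P (E n i) = (poisson_mass (fine (mu (cell n i))) 0)%:E +
      (poisson_mass (fine (mu (cell n i))) 1)%:E.
    rewrite -!Pm//; apply: measureU => //.
    by apply/seteqP; split => // w [/= -> [] /eqP]; rewrite eq_sym oner_eq0.
  rewrite probability_setC// PEU.
  set v := fine (mu (cell n i)).
  have v0 : (0 <= v)%R by exact: fine_ge0.
  have vc : (v <= c / n.+1%:R)%R.
    rewrite -lee_fin fineK ?fin_num_measure//.
    have -> : cell n i = [set p | (i%:R / n.+1%:R <= tau p < i.+1%:R / n.+1%:R)%R].
      apply/seteqP; split => p; rewrite /cell /before /=.
        by move=> [-> /negP]; rewrite -leNgt => ->.
      by move=> /andP[h ->]; split => //; apply/negP; rewrite -leNgt.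
    apply: (le_trans (mu_le _ _ _)); first by rewrite ler_pM2r ?invr_gt0// ler_nat.
    by rewrite -mulrBl -natrB// subSnn mul1r.
  rewrite -[leLHS]/((1 - (poisson_mass v 0 + poisson_mass v 1))%R%:E).
  rewrite lee_fin opprD addrA.
  apply: (le_trans (poisson_mass_ge2 v0)).
  by rewrite lerXn2r// nnegrE// divr_ge0.
(* The cells are closed on the left, so time 1 falls in the cell of index [n.+1]. The factor 2 in
   the next bound absorbs n + 2 <= 2(n + 1). *)
pose U n := \bigcup_(i < n.+2) ~` E n i.
have mU n : measurable (U n).
  by apply: bigcup_measurable => i _; apply: measurableC.
have PU n : P (U n) <= (2 * c ^+ 2 / n.+1%:R)%:E.
  rewrite /U bigcup_mkord; apply: (@le_trans _ _ (\sum_(i < n.+2) P (~` E n i))).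
    by apply: (Boole_inequality P (A := fun i => ~` E n i)) => i _; exact: measurableC.
  apply: (@le_trans _ _ (\sum_(i < n.+2) ((c / n.+1%:R) ^+ 2)%:E)).
    by apply: lee_sum => i _; exact: PE.
  rewrite sumEFin lee_fin sumr_const card_ord -[leLHS]mulr_natl.
  have n0 : (0 < n.+1%:R :> R)%R by [].
  rewrite expr_div_n [leLHS]mulrA ler_pdivrMr ?exprn_gt0//.
  rewrite [leRHS](_ : _ = (2 * n.+1%:R * c ^+ 2))%R; last by field; lra.
  by rewrite ler_wpM2r ?exprn_ge0// -natrM ler_nat mul2n -addnn addSn ltnS leq_addl.
exists (\bigcap_n U n); split.
- exact: bigcapT_measurable.
- apply/eqP; rewrite eq_le measure_ge0 andbT; apply/lee_addgt0Pr => e e0.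
  rewrite add0e; pose n := Num.truncn (2 * c ^+ 2 / e)%R.
  apply: (@le_trans _ _ (P (U n))).
    apply: le_measure; rewrite ?inE//; first exact: bigcapT_measurable.
    exact: bigcap_inf.
  apply: le_trans (PU n) _; rewrite lee_fin ler_pdivrMr// [leRHS]mulrC -ler_pdivrMr//.
  by apply/ltW; exact: truncnS_gt.
move=> w /= /existsNP[p /existsNP[q /not_implyP[Pp /not_implyP[Pq /not_implyP[pq neq]]]]].
move=> n _.
have /andP[p0 p1] := tau01 Pp.
pose j := Num.truncn (tau p * n.+1%:R)%R.
have n0 : (0 < n.+1%:R :> R)%R by [].
have /andP[j1 j2] : (j%:R <= tau p * n.+1%:R < j.+1%:R)%R.
  by apply: truncn_itv; rewrite mulr_ge0.
exists j => /=.
  rewrite /mkset ltnS -(ler_nat R) (le_trans j1)//.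
  by rewrite -[leRHS]mul1r ler_wpM2r.
have cellp r : tau r = tau p -> cell n j r.
  move=> rp; rewrite /cell /before /= rp ltr_pdivlMr//; split => //.
  by apply/negP; rewrite -leNgt ler_pdivrMr.
have := @counting_ge2 R _ (Psi w `&` cell n j) _ _ (conj Pp (cellp p erefl)) (conj Pq (cellp q (esym pq))) neq.
by move=> h [] /= E'; move: h; rewrite [X in _ <= X]E' lee_fin ?ler_nat// ; lra.
Qed.

End decreasing_tuples.

(** * Averaging over the cells of a partition *)

Section cell_averages.
Context {R : realType} d (T : measurableType d) (mu : {measure set T -> \bar R}).
Variables (X : set T) (mX : measurable X) (muX : (mu X < +oo)%E).
Local Notation L1 f := (mu.-integrable X (EFin \o f)).

(** An arbitrary finite index type lets one theory serve both the cells of the box, indexed by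
    ['I_n.+1], and the product cells of its square, indexed by pairs. *)
Definition cell_partition (I : finType) (c : I -> set T) :=
  [/\ forall i, measurable (c i), forall i, (0 < mu (c i))%E,
      trivIset setT c & \bigcup_i c i = X].

Section one_partition.
Variables (I : finType) (c : I -> set T).
Hypothesis cP : cell_partition c.

Definition average_on_cells (f : T -> R) (x : T) : R :=
  \sum_(i : I) \1_(c i) x * average mu (c i) f.

Local Notation avg := average_on_cells.

Definition averaging_error (f : T -> R) : \bar R :=
  (\int[mu]_(x in X) `|avg f x - f x|%:E)%E.

Let mc i : measurable (c i). Proof. by case: cP. Qed.

Lemma cell_sub i : c i `<=` X.
Proof. by case: cP => _ _ _ <-; exact: bigcup_sup. Qed.

Lemma cell_cover x : X x -> exists i, c i x.
Proof. by case: cP => _ _ _ <- [i _ cix]; exists i. Qed.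

Lemma cell_fin_num i : mu (c i) \is a fin_num.
Proof.
rewrite ge0_fin_numE//; apply: le_lt_trans muX.
by apply: le_measure; rewrite ?inE//; exact: cell_sub.
Qed.

Lemma cell_gt0 i : 0 < fine (mu (c i)).
Proof.
by rewrite fine_gt0//; case: cP => _ c0 _ _; rewrite c0/= -ge0_fin_numE// cell_fin_num.
Qed.

Lemma average_on_cellsE f i x : c i x -> avg f x = average mu (c i) f.
Proof.
move=> cix; rewrite /avg (bigD1 i)//= indicE mem_set// mul1r big1 ?addr0// => j ji.
rewrite indicE memNset ?mul0r// => cjx.
case: cP => _ _ /(_ j i Logic.I Logic.I) tc _.
by rewrite tc ?eqxx// in ji; exists x.
Qed.

Lemma measurable_average_on_cells f : measurable_fun setT (avg f).
Proof.
by apply: measurable_sum => i; apply: measurable_funM => //; exact: measurable_indic.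
Qed.

Lemma integrable_cell f i : L1 f -> mu.-integrable (c i) (EFin \o f).
Proof. by move=> fi; apply: integrableS fi => //; exact: cell_sub. Qed.

Lemma average_on_cellsB f g x : L1 f -> L1 g ->
  avg (f \- g) x = avg f x - avg g x.
Proof.
move=> fi gi; rewrite /avg -sumrB; apply: eq_bigr => i _.
rewrite -mulrBr /average -[in RHS]mulrBr; congr (_ * (_ * _)).
by rewrite (RintegralB (mc i) (integrable_cell i fi) (integrable_cell i gi)).
Qed.

Lemma average_on_cellsZ k f x : L1 f -> avg (fun x => k * f x) x = k * avg f x.
Proof.
move=> fi; rewrite /avg mulr_sumr; apply: eq_bigr => i _.
rewrite /average (RintegralZl _ (mc i) (integrable_cell i fi)).
by rewrite (mulrCA _ k) (mulrCA _ k).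
Qed.

Lemma integral_cells (f : T -> \bar R) : measurable_fun X f ->
  (forall x, X x -> 0 <= f x)%E ->
  (\int[mu]_(x in X) f x = \sum_(i : I) \int[mu]_(x in c i) f x)%E.
Proof.
case: cP => _ _ tc cX mf f0.
have XE : X = \big[setU/set0]_(i <- index_enum I) c i.
  rewrite -cX; apply/seteqP; split => x.
    by move=> [i _ cix]; rewrite -bigcup_seq; exists i => //=; exact: mem_index_enum.
  by rewrite -bigcup_seq => -[i _ cix]; exists i.
rewrite {1}XE ge0_integral_bigsetU//.
- exact: index_enum_uniq.
- exact: sub_trivIset tc.
- by rewrite -XE.
- by rewrite -XE.
Qed.

(** Averaging contracts L^1, cell by cell. This makes the averaging error stable under L^1
    approximation, uniformly over the partitions. *)
Lemma integral_average_le f : L1 f ->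
  (\int[mu]_(x in X) `|avg f x|%:E <= \int[mu]_(x in X) `|f x|%:E)%E.
Proof.
move=> fi; have mf : measurable_fun X f by move/integrableP: fi => [/measurable_EFinP].
have mnf : measurable_fun X (fun x => `|f x|%:E).
  by apply/measurable_EFinP; exact: measurableT_comp.
have mna : measurable_fun X (fun x => `|avg f x|%:E).
  apply/measurable_EFinP; apply: measurableT_comp => //.
  by apply: measurable_funTS; exact: measurable_average_on_cells.
rewrite !integral_cells//; apply: lee_sum => i _.
have ci := integrable_cell i fi.
rewrite (eq_integral (cst `|average mu (c i) f|%:E)); last first.
  by move=> x /[1!inE] cix; rewrite (average_on_cellsE _ cix).
rewrite integral_cst// -(fineK (cell_fin_num i)) -EFinM.
rewrite normrM ger0_norm; last by rewrite invr_ge0 ltW// cell_gt0.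
rewrite mulrAC mulVf ?mul1r ?gt_eqF ?cell_gt0//.
have nfi : (\int[mu]_(x in c i) `|f x|%:E \is a fin_num)%E.
  by apply: integrable_fin_num => //; exact: integrable_norm.
rewrite -(fineK nfi) lee_fin; exact: le_normr_Rintegral.
Qed.

Lemma measurable_error f : measurable_fun X f ->
  measurable_fun X (fun x => `|avg f x - f x|%:E).
Proof.
move=> mf; apply/measurable_EFinP; apply: measurableT_comp => //.
apply: measurable_funB => //; apply: measurable_funTS.
exact: measurable_average_on_cells.
Qed.

Lemma averaging_error_le f : L1 f ->
  (averaging_error f <= 2%:E * \int[mu]_(x in X) `|f x|%:E)%E.
Proof.
move=> fi; have mf : measurable_fun X f by move/integrableP: fi => [/measurable_EFinP].
have mnf : measurable_fun X (fun x => `|f x|%:E).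
  by apply/measurable_EFinP; exact: measurableT_comp.
have mna : measurable_fun X (fun x => `|avg f x|%:E).
  apply/measurable_EFinP; apply: measurableT_comp => //.
  by apply: measurable_funTS; exact: measurable_average_on_cells.
apply: (@le_trans _ _ (\int[mu]_(x in X) (`|avg f x|%:E + `|f x|%:E))%E).
  apply: ge0_le_integral => //.
  - exact: measurable_error.
  - exact: emeasurable_funD.
  - by move=> x _; rewrite -EFinD lee_fin ler_normB.
rewrite ge0_integralD//.
rewrite [leRHS](_ : _ = \int[mu]_(x in X) `|f x|%:E + \int[mu]_(x in X) `|f x|%:E)%E.
  by rewrite leeD2r// integral_average_le.
by rewrite -{2 3}[(\int[mu]_(x in X) _)%E]mul1e -ge0_muleDl// -EFinD.
Qed.

Lemma averaging_error_triangle f g : L1 f -> L1 g ->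
  (averaging_error f <= averaging_error g + averaging_error (f \- g)%R)%E.
Proof.
move=> fi gi.
have mf : measurable_fun X f by move/integrableP: fi => [/measurable_EFinP].
have mg : measurable_fun X g by move/integrableP: gi => [/measurable_EFinP].
have mfg : measurable_fun X (f \- g) by exact: measurable_funB.
rewrite /averaging_error -ge0_integralD//; try exact: measurable_error.
apply: ge0_le_integral => //; first exact: measurable_error.
  by apply: emeasurable_funD; exact: measurable_error.
move=> x _; rewrite -EFinD lee_fin average_on_cellsB//.
rewrite [X in `|X|](_ : _ = (avg g x - g x) + (avg f x - avg g x - (f x - g x))).
  exact: ler_normD.
by ring.
Qed.

Lemma averaging_errorZ k f : L1 f ->
  averaging_error (fun x => k * f x) = (`|k|%:E * averaging_error f)%E.
Proof.
move=> fi; have mf : measurable_fun X f by move/integrableP: fi => [/measurable_EFinP].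
rewrite /averaging_error -ge0_integralZl//; last exact: measurable_error.
apply: eq_integral => x _; rewrite average_on_cellsZ// -mulrBr normrM EFinM//.
Qed.

Definition split_cells (G : set T) : set T :=
  \bigcup_(i in [set i | (exists2 x, c i x & G x) /\ (exists2 x, c i x & ~ G x)]) c i.

Lemma measurable_split_cells G : measurable (split_cells G).
Proof. by apply: fin_bigcup_measurable => // i _; exact: mc. Qed.

Lemma split_cells_sub G : split_cells G `<=` X.
Proof. by move=> x [i _]; exact: cell_sub. Qed.

Lemma split_cellsI G H : split_cells (G `&` H) `<=` split_cells G `|` split_cells H.
Proof.
move=> x [i [[y ciy [Gy Hy]] [z ciz /not_andP[nGz|nHz]]] cix].
  by left; exists i => //; split; [exists y|exists z].
by right; exists i => //; split; [exists y|exists z].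
Qed.

Lemma integrable_indic_X G : measurable G -> L1 (\1_G : T -> R).
Proof.
move=> mG; apply/integrableP; split.
  by apply/measurable_EFinP; apply: measurable_funTS; exact: measurable_indic.
apply: (@le_lt_trans _ _ (\int[mu]_(x in X) 1)%E); last by rewrite integral_cst// mul1e.
apply: ge0_le_integral => //.
- apply: measurableT_comp => //; apply/measurable_EFinP; apply: measurable_funTS.
  exact: measurable_indic.
- by move=> x _ /=; rewrite lee_fin indicE; case: (_ \in _); rewrite ?normr1 ?normr0.
Qed.

(* On a cell that does not meet both [G] and its complement, [\1_G] is constant. *)
Lemma averaging_error_indic G : measurable G ->
  (averaging_error (\1_G : T -> R) <= mu (split_cells G))%E.
Proof.
move=> mG.
have iG := integrable_indic_X mG.
have ms := measurable_split_cells G.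
rewrite [leRHS](_ : _ = \int[mu]_(x in X) (\1_(split_cells G) x)%:E)%E; last first.
  rewrite integral_indic// setIidl//; exact: split_cells_sub.
apply: ge0_le_integral => //.
- by apply: measurable_error; apply: measurable_funTS; exact: measurable_indic.
- by apply/measurable_EFinP; apply: measurable_funTS; exact: measurable_indic.
move=> x Xx; rewrite lee_fin.
have [i cix] := cell_cover Xx.
rewrite (average_on_cellsE _ cix).
have avg_cst (k : R) : (forall y, c i y -> \1_G y = k) -> average mu (c i) \1_G = k.
  move=> Gk; rewrite /average /Rintegral.
  rewrite (eq_integral (cst k%:E)); last by move=> y /[1!inE] ciy; rewrite Gk.
  by rewrite integral_cst// fineM ?cell_fin_num// /= mulrC -mulrA divff ?mulr1// gt_eqF// cell_gt0.
have [splitx|nsplitx] := pselect (split_cells G x).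
  rewrite [leRHS]indicE mem_set//.
  have : 0 <= average mu (c i) \1_G <= 1.
    rewrite /average mulr_ge0 ?invr_ge0 ?(ltW (cell_gt0 i))//=; last first.
      by apply: Rintegral_ge0 => y _; rewrite indicE.
    rewrite mulrC ler_pdivrMr ?cell_gt0// mul1r /Rintegral integral_indic// fine_le//.
    + by rewrite fin_num_abs gee0_abs// (le_lt_trans _ muX)//; apply: le_measure; rewrite ?inE//; [exact: measurableI|by move=> y [_ /cell_sub]].
    + exact: cell_fin_num.
    + by apply: le_measure; rewrite ?inE//; exact: measurableI.
  by rewrite indicE; case: (_ \in _) => /andP[h0 h1] /=; rewrite ler_norml; lra.
rewrite (_ : average _ _ _ - _ = 0) ?normr0 ?indicE//.
apply/eqP; rewrite subr_eq0; apply/eqP/avg_cst => y ciy; rewrite !indicE.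
have [Gx|Gx] := pselect (G x); have [Gy|Gy] := pselect (G y).
- by rewrite !mem_set.
- by exfalso; apply: nsplitx; exists i => //; split; [exists x|exists y].
- by exfalso; apply: nsplitx; exists i => //; split; [exists y|exists x].
- by rewrite !memNset.
Qed.

End one_partition.

End cell_averages.

(** * Extended real sequences that become arbitrarily small *)

Section vanishing.
Context {R : realType}.
Local Open Scope ereal_scope.
Implicit Types u v : (\bar R)^nat.

(** For nonnegative sequences this is convergence to 0, see [vanishing_cvgP]. The explicit form
    bears domination, sums and errors known up to an arbitrary constant, and asks for no finiteness
    of the first terms. *)
Definition vanishing u :=
  forall e : R, (0 < e)%R -> exists n0, forall n, (n0 <= n)%N -> u n <= e%:E.

Lemma vanishing_le u v : (forall n, u n <= v n) -> vanishing v -> vanishing u.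
Proof.
move=> uv Hv e e0; have [n0 Hn0] := Hv e e0.
by exists n0 => n n0n; apply: le_trans (uv n) _; exact: Hn0.
Qed.

Lemma vanishing0 : vanishing (fun=> 0).
Proof. by move=> e e0; exists 0%N => n _; rewrite lee_fin ltW. Qed.

Lemma vanishingD u v : vanishing u -> vanishing v -> vanishing (fun n => u n + v n).
Proof.
move=> Hu Hv e e0; have e2 : (0 < e / 2)%R by lra.
have [n0 Hn0] := Hu _ e2; have [n1 Hn1] := Hv _ e2.
exists (maxn n0 n1) => n; rewrite geq_max => /andP[n0n n1n].
by rewrite [e]splitr EFinD; apply: leeD; [exact: Hn0|exact: Hn1].
Qed.

Lemma vanishing_sum (I : Type) (r : seq I) (u : I -> (\bar R)^nat) :
  (forall i, vanishing (u i)) -> vanishing (fun n => \sum_(i <- r) u i n).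
Proof.
move=> Hu; elim: r => [|i r ih].
  by apply: vanishing_le vanishing0 => n; rewrite big_nil.
by apply: vanishing_le (vanishingD (Hu i) ih) => n; rewrite big_cons.
Qed.

Lemma vanishingZ (k : R) u : (0 <= k)%R -> vanishing u -> vanishing (fun n => k%:E * u n).
Proof.
move=> k0 Hu e e0; have ek : (0 < e / (k + 1))%R by rewrite divr_gt0//; lra.
have [n0 Hn0] := Hu _ ek; exists n0 => n n0n.
apply: (@le_trans _ _ (k%:E * (e / (k + 1))%:E)).
  by apply: lee_wpmul2l; rewrite ?lee_fin//; exact: Hn0.
have k1 : (0 < k + 1)%R by lra.
rewrite -EFinM lee_fin mulrCA; apply: ler_piMr; first exact: ltW.
by rewrite ler_pdivrMr//; lra.
Qed.

Lemma vanishing_approx u :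
  (forall e : R, (0 < e)%R -> exists2 v, vanishing v & forall n, u n <= v n + e%:E) ->
  vanishing u.
Proof.
move=> H e e0; have e2 : (0 < e / 2)%R by lra.
have [v Hv uv] := H _ e2; have [n0 Hn0] := Hv _ e2.
exists n0 => n n0n; apply: (le_trans (uv n)).
by rewrite [in leRHS](splitr e) EFinD leeD2r// Hn0.
Qed.

Lemma vanishing_cvgP u : (forall n, 0 <= u n) -> u @ \oo --> 0 <-> vanishing u.
Proof.
move=> u0; split=> [ucvg e e0|Hu].
  have /fine_cvgP[[n0 _ Hn0] /cvgrPdist_le /(_ _ e0)[n1 _ Hn1]] := ucvg.
  exists (maxn n0 n1) => n; rewrite geq_max => /andP[n0n n1n].
  rewrite -(fineK (Hn0 _ n0n)) lee_fin.
  by have := Hn1 _ n1n; rewrite /= sub0r normrN; apply: le_trans; exact: ler_norm.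
have fin n (e : R) : u n <= e%:E -> u n \is a fin_num.
  by move=> ue; rewrite ge0_fin_numE// (le_lt_trans ue)// ltry.
apply/fine_cvgP; split.
  by have [n0 Hn0] := Hu 1%R ltr01; exists n0 => // n /= n0n; apply: fin; exact: Hn0.
apply/cvgrPdist_le => e e0; have [n0 Hn0] := Hu e e0.
exists n0 => // n /= n0n; rewrite sub0r normrN ger0_norm ?fine_ge0//.
by rewrite -lee_fin fineK ?Hn0//; apply: fin; exact: Hn0.
Qed.

End vanishing.

(** * Convergence of cell averages in L^1 *)

Section averaging_convergence.
Context {R : realType} d (T : measurableType d) (mu : {measure set T -> \bar R}).
Variables (X : set T) (mX : measurable X) (muX : (mu X < +oo)%E).
Variables (I : nat -> finType) (c : forall n, I n -> set T).
Hypothesis cP : forall n, cell_partition mu X (@c n).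
Local Notation L1 f := (mu.-integrable X (EFin \o f)).
Local Notation err n f := (averaging_error mu X (@c n) f).

Definition approximable (f : T -> R) := L1 f /\ vanishing (fun n => err n f).

Let mfun f : L1 f -> measurable_fun X f.
Proof. by move/integrableP => [/measurable_EFinP]. Qed.

Lemma approximableD f g : approximable f -> approximable g -> approximable (f \+ g).
Proof.
move=> [fi fv] [gi gv]; have fgi : L1 (f \+ g) by apply: (integrableD mX fi gi).
split => //; apply: vanishing_le (vanishingD fv gv) => n.
apply: (le_trans (averaging_error_triangle mX (cP n) fgi fi)).
rewrite (_ : _ \- _ = g)//; apply/funext => x /=; ring.
Qed.

Lemma approximableZ k f : approximable f -> approximable (fun x => k * f x).
Proof.
move=> [fi fv]; split.
  by have := integrableZl mX k fi; apply: eq_integrable => // x _; rewrite /= EFinM.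
apply: vanishing_le (vanishingZ (normr_ge0 k) fv) => n.
by rewrite (averaging_errorZ mX (cP n)).
Qed.

Lemma approximable_sum (J : Type) (r : seq J) (f : J -> T -> R) :
  approximable (fun=> 0) -> (forall j, approximable (f j)) ->
  approximable (fun x => \sum_(j <- r) f j x).
Proof.
move=> f0 Hf; elim: r => [|j r ih]; first by under eq_fun do rewrite big_nil.
by under eq_fun do rewrite big_cons; exact: approximableD.
Qed.

(** The averaging error changes by at most twice the L^1 distance of the functions, with the same
    constant for all n; hence the tolerance e/2. *)
Lemma approximable_lim f : L1 f ->
  (forall e : R, 0 < e -> exists2 g, approximable g &
    (\int[mu]_(x in X) `|f x - g x|%:E <= e%:E)%E) ->
  approximable f.
Proof.
move=> fi H; split => //; apply: vanishing_approx => e e0.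
have e2 : 0 < e / 2 by lra.
have [g [gi gv] fg] := H _ e2.
exists (fun n => err n g) => // n.
apply: (le_trans (averaging_error_triangle mX (cP n) fi gi)).
rewrite leeD2l//.
have fgi : L1 (f \- g)%R by apply: (integrableB mX fi gi).
apply: (le_trans (averaging_error_le mX muX (cP n) fgi)).
apply: (@le_trans _ _ (2%:E * (e / 2)%:E)%E); first by rewrite lee_wpmul2l.
by rewrite -EFinM lee_fin; lra.
Qed.

(** A form of Jordan measurability relative to the given partitions: the cells crossed by the
    boundary of [G] have vanishing total mass. *)
Definition regular_set (G : set T) :=
  measurable G /\ vanishing (fun n => mu (split_cells (@c n) G)).

Lemma regular_setI : setI_closed regular_set.
Proof.
move=> G H [mG vG] [mH vH]; split; first exact: measurableI.
have ms n G' := measurable_split_cells (cP n) G'.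
apply: vanishing_le (vanishingD vG vH) => n.
apply: le_trans (measureU2 mu (ms n G) (ms n H)).
apply: le_measure; rewrite ?inE//; first exact: measurableU.
exact: split_cellsI.
Qed.

Lemma regular_setT : regular_set setT.
Proof.
split => //; apply: vanishing_le vanishing0 => n.
rewrite (_ : split_cells _ _ = set0) ?measure0//.
by apply/seteqP; split => // x [i [_ [y _ nT]]]; case: nT.
Qed.

Lemma approximable_regular G : regular_set G -> approximable (\1_G).
Proof.
move=> [mG vG]; split; first exact: integrable_indic_X.
by apply: vanishing_le vG => n; exact: averaging_error_indic.
Qed.

Lemma approximable0 : approximable (fun=> 0).
Proof.
have := approximableZ 0 (approximable_regular regular_setT).
by congr approximable; apply/funext => x; rewrite mul0r.
Qed.

Hypothesis regular_gen : @measurable _ T `<=` <<s regular_set >>.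

(** Regular sets are closed under intersection and generate, so Dynkin's theorem applies.
    Complements are handled by linearity, disjoint unions as L^1 limits of finite sums. *)
Lemma approximable_indic G : measurable G -> approximable (\1_G).
Proof.
have genE : @measurable _ T = <<s regular_set >>.
  apply/seteqP; split; first exact: regular_gen.
  by apply: smallest_sub; [exact: sigma_algebra_measurable|move=> ? []].
move=> mG; have : <<s regular_set >> G by rewrite -genE.
apply: (@dynkin_induction _ _ regular_set (fun G => approximable (\1_G))) => //.
- exact: regular_setI.
- exact/approximable_regular/regular_setT.
- by move=> H rH; exact: approximable_regular.
- move=> H mH Hg.
  have := approximableD (approximable_regular regular_setT) (approximableZ (-1) Hg).
  rewrite (_ : _ \+ _ = \1_(~` H))//; apply/funext => x /=.
  rewrite !indicE in_setT in_setC; case: (_ \in _) => /=; ring.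
move=> F mF tF Fg.
have mUF : measurable (\bigcup_k F k) by exact: bigcupT_measurable.
apply: approximable_lim; first exact: integrable_indic_X.
move=> e e0.
(* The part of the union missed by the first k sets. It decreases to the empty set since the [F i]
   are disjoint, and [X] has finite measure. *)
pose B k := X `&` \bigcup_(i in [set i | (k <= i)%N]) F i.
have mB k : measurable (B k).
  by apply: measurableI => //; apply: bigcup_measurable => i _; exact: mF.
have : (mu \o B) k @[k --> \oo] --> mu (\bigcap_k B k).
  apply: nonincreasing_cvg_mu => //.
  - by apply: le_lt_trans muX; apply: le_measure; rewrite ?inE// => x [].
  - exact: bigcapT_measurable.
  - move=> i j ij; apply/subsetPset => x [Xx [k /= jk Fkx]]; split => //.
    by exists k => //=; exact: leq_trans jk.
rewrite (_ : \bigcap_k B k = set0); last first.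
  apply/seteqP; split => // x Bx.
  have [_ [k _ Fkx]] := Bx 0%N Logic.I.
  have [_ [j /= kj Fjx]] := Bx k.+1 Logic.I.
  have kj' := tF _ _ Logic.I Logic.I (ex_intro _ x (conj Fkx Fjx)).
  by rewrite kj' ltnn in kj.
rewrite measure0 => Bcvg.
have B0 n : (0 <= (mu \o B) n)%E by exact: measure_ge0.
have [k Hk] := (vanishing_cvgP B0).1 Bcvg e e0.
exists (fun x => \sum_(i <- index_iota 0 k) \1_(F i) x).
  by apply: approximable_sum; [exact: approximable0|exact: Fg].
apply: le_trans (Hk k (leqnn k)); rewrite /=.
rewrite [leRHS](_ : _ = \int[mu]_(x in X) (\1_(B k) x)%:E)%E; last first.
  by rewrite integral_indic// setIidl// => x [].
have mS : measurable_fun setT (fun x => \sum_(i <- index_iota 0 k) \1_(F i) x : R).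
  by apply: measurable_sum => i; exact: measurable_indic.
apply: ge0_le_integral => //.
- apply/measurable_EFinP; apply: measurableT_comp => //.
  by apply: measurable_funTS; apply: measurable_funB => //; exact: measurable_indic.
- by apply/measurable_EFinP; apply: measurable_funTS; exact: measurable_indic.
move=> x Xx; rewrite lee_fin.
have [[i _ Fix]|nF] := pselect ((\bigcup_k F k) x); last first.
  rewrite indicE memNset// big1 ?subrr ?normr0 ?indicE// => i _.
  by rewrite indicE memNset// => Fix; apply: nF; exists i.
have Fj j : j != i -> \1_(F j) x = 0 :> R.
  move=> ji; rewrite indicE memNset// => Fjx; move: ji.
  by rewrite (tF j i) ?eqxx//; exists x.
rewrite [\1_(\bigcup_k F k) x]indicE mem_set; last by exists i.
have [ik|ki] := ltnP i k.
  rewrite (bigD1_seq i) ?mem_index_iota ?iota_uniq//=.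
  rewrite [\1_(F i) x]indicE mem_set// big1; last by move=> j /Fj.
  by rewrite addr0 subrr normr0 indicE.
rewrite big_seq big1; last first.
  move=> j; rewrite mem_index_iota => /andP[_ jk]; apply: Fj.
  by apply: contraTneq jk => ->; rewrite -leqNgt.
rewrite subr0 normr1 indicE mem_set//; split => //.
by exists i.
Qed.

Import HBSimple.

(** Simple functions are dense in L^1 and are finite combinations of indicators. The partitions are
    not assumed nested, so martingale convergence is replaced by this density argument. *)
Theorem averaging_converges f : L1 f -> vanishing (fun n => err n f).
Proof.
move=> fi; apply: (approximable_lim fi _).2 => e e0.
have [g [gi _ gcvg]] := approximation_sfun_integrable mX fi.
have [k Hk] := (vanishing_cvgP (fun n => integral_ge0 mu (fun x _ => abse_ge0 _))).1 gcvg e e0.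
exists (g k); last exact: Hk.
rewrite (_ : (g k : T -> R) = fun x => \sum_(i < #|` fset_set (g k @` setT)|)
    ((fset_set (g k @` setT))`_i * \1_(g k @^-1` [set (fset_set (g k @` setT))`_i]) x)).
  apply: approximable_sum; first exact: approximable0.
  by move=> i; apply: approximableZ; apply: approximable_indic.
by apply/funext => x; exact: fimfunEord.
Qed.

End averaging_convergence.

(** * Hyperrectangle partitions of a box and of its square *)

Section box_partitions.
Context {R : realType} {m : nat}.
Variables (a b : 'rV[R]_m).
Local Notation X := (closed_box a b).
Local Notation leb := (@leb R m).
Local Open Scope ereal_scope.

Lemma closed_boxE : X = [set x | forall i, `[a ord0 i, b ord0 i]%classic (x ord0 i)].
Proof. by apply/seteqP; split => x H i; have := H i; rewrite /= in_itv. Qed.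

Lemma measurable_closed_box : measurable X.
Proof.
rewrite closed_boxE.
exact: (measurable_prod_rV (fun i => measurable_itv `[a ord0 i, b ord0 i])).
Qed.

Lemma leb_closed_box_fin_num : leb X \is a fin_num.
Proof.
rewrite closed_boxE (leb_prod (fun i => measurable_itv `[a ord0 i, b ord0 i])).
apply: (big_ind (fun x : \bar R => x \is a fin_num)) => //.
  by move=> x y; exact: fin_numM.
move=> i _; rewrite lebesgue_measure_itv /=; case: ifP => _ //.
Qed.

Lemma leb_closed_box_lty : leb X < +oo.
Proof. by rewrite ltey_eq leb_closed_box_fin_num. Qed.

Lemma le_coord_enorm (x : 'rV[R]_m) i : (`|x ord0 i| <= enorm x)%R.
Proof.
rewrite /enorm -sqrtr_sqr ler_wsqrtr// (bigD1 i)//= lerDl.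
by apply: sumr_ge0 => j _; exact: sqr_ge0.
Qed.

Lemma le_coord_ediam (A : set 'rV[R]_m) (x y : 'rV[R]_m) i (e : R) :
  ediam A <= e%:E -> A x -> A y -> (`|x ord0 i - y ord0 i| <= e)%R.
Proof.
move=> Ae Ax Ay; rewrite -lee_fin; apply: le_trans Ae.
apply: (@le_trans _ _ (enorm (x - y))%:E).
  by rewrite lee_fin; have := le_coord_enorm (x - y)%R i; rewrite !mxE.
by apply: ereal_sup_ubound; exists (x, y).
Qed.

(** The slabs decrease to a piece of a hyperplane, which is null because one factor of its product
    formula is the Lebesgue measure of a subset of a point. *)
Lemma vanishing_slab k t :
  vanishing (fun n => leb (X `&` [set x | (`|x ord0 k - t| <= n.+1%:R^-1)%R])).
Proof.
pose B n := X `&` [set x : 'rV[R]_m | (`|x ord0 k - t| <= n.+1%:R^-1)%R].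
have mB n : measurable (B n).
  apply: measurableI; first exact: measurable_closed_box.
  rewrite [X in measurable X](_ : _ = setT `&` (fun x : 'rV[R]_m => x ord0 k) @^-1`
      `[(t - n.+1%:R^-1)%R, (t + n.+1%:R^-1)%R]).
    by apply: measurable_coord => //; exact: measurable_itv.
  by rewrite setTI; apply/seteqP; split => x /=; rewrite in_itv/= ler_distl.
apply/(vanishing_cvgP (fun n => measure_ge0 leb (B n))).
(* The sides of the limit set: those of the box, except that side k is cut down to the point t, or
   to nothing if t lies outside. *)
pose A' (i : 'I_m) : set R :=
  if i == k then [set t] `&` `[a ord0 i, b ord0 i] else `[a ord0 i, b ord0 i]%classic.
have mA' i : measurable (A' i).
  by rewrite /A'; case: eqP => _ //; exact: measurableI.
have -> : 0 = leb (\bigcap_n B n).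
  have -> : \bigcap_n B n = [set x : 'rV[R]_m | forall i, A' i (x ord0 i)].
    apply/seteqP; split => x.
      move=> Bx i; have xi : `[a ord0 i, b ord0 i]%classic (x ord0 i).
        by have [+ _] := Bx 0%N Logic.I; rewrite closed_boxE => /(_ i).
      rewrite /A'; case: eqP => // ik; split; last exact: xi.
      rewrite ik /=.
      apply/eqP; rewrite -subr_eq0 -normr_le0; apply/ler_addgt0Pr => e e0.
      rewrite add0r; have [_ /= h] := Bx (Num.truncn e^-1) Logic.I.
      apply: le_trans h _; rewrite -[leRHS]invrK lef_pV2 ?posrE ?invr_gt0//.
      by apply/ltW; exact: truncnS_gt.
    move=> Hx n _; split.
      by rewrite closed_boxE => i; have := Hx i; rewrite /A'; case: eqP => [_ []|].
    have := Hx k; rewrite /A' eqxx => -[/= -> _].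
    by rewrite subrr normr0.
  rewrite (leb_prod mA') (bigD1 k)//= {1}/A' eqxx.
  have -> : lebesgue_measure ([set t] `&` `[a ord0 k, b ord0 k]) = 0.
    apply/eqP; rewrite eq_le measure_ge0 andbT -(lebesgue_measure_set1 t).
    by apply: le_measure; rewrite ?inE// => //; exact: measurableI.
  by rewrite mul0e.
apply: (nonincreasing_cvg_mu _ mB (bigcapT_measurable mB)).
- apply: le_lt_trans leb_closed_box_lty; apply: le_measure; rewrite ?inE//.
    exact: measurable_closed_box.
  by move=> x [].
- move=> i j ij; apply/subsetPset => x [Xx /= h]; split => //=; apply: (le_trans h).
  by rewrite lef_pV2 ?posrE// ler_nat.
Qed.

Variable C : forall d : nat, 'I_d -> set 'rV[R]_m.
Hypothesis C_part : forall d, (0 < d)%N -> hyperrectangle_partition X (@C d).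
Hypothesis C_mesh : (fun d => mesh (@C d)) @ \oo --> 0.

Lemma measurable_hyperrectangle (A : set 'rV[R]_m) : hyperrectangle A -> measurable A.
Proof.
move=> [I ->]; apply: (measurable_prod_rV (A := fun i => [set` I i])) => i.
exact: measurable_itv.
Qed.

(** The shift skips [C 0], about which [C_part] says nothing. *)
Let c n : 'I_n.+1 -> set 'rV[R]_m := @C n.+1.

Lemma box_cell_partition n : cell_partition leb X (@c n).
Proof.
have [hC C0 tC UC] := @C_part n.+1 (ltn0Sn n).
by split; [move=> i; exact: measurable_hyperrectangle (hC i)|exact: C0|exact: tC|exact: UC].
Qed.

Let vanishing_mesh : vanishing (fun n => mesh (@c n)).
Proof.
have mesh_ge0 d : 0 <= mesh (@C d) by exact: bigmax_ge_id.
have /(vanishing_cvgP mesh_ge0) H := C_mesh.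
move=> e e0; have [n0 Hn0] := H e e0; exists n0 => n n0n.
by apply: Hn0; exact: leqW.
Qed.

(** A cell with points on both sides of the hyperplane lies within one cell diameter of it, hence in
    a slab of half-width 1/(n1+1) as soon as the mesh is at most that. *)
Lemma regular_halfspace k t :
  regular_set leb (fun n => @c n) [set x : 'rV[R]_m | (t < x ord0 k)%R].
Proof.
split.
  rewrite [X in measurable X](_ : _ = setT `&` (fun x : 'rV[R]_m => x ord0 k) @^-1` `]t, +oo[).
    by apply: measurable_coord => //; exact: measurable_itv.
  by rewrite setTI; apply/seteqP; split => x /=; rewrite in_itv/= andbT.
move=> e e0; have [n1 Hn1] := vanishing_slab k t e0.
have e1 : (0 < n1.+1%:R^-1 :> R)%R by rewrite invr_gt0.
have [n0 Hn0] := vanishing_mesh e1.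
exists n0 => n n0n; apply: le_trans (Hn1 n1 (leqnn n1)).
have cP := box_cell_partition n.
apply: le_measure; rewrite ?inE.
- exact: measurable_split_cells cP _.
- apply: measurableI; first exact: measurable_closed_box.
  rewrite [X in measurable X](_ : _ = setT `&` (fun x : 'rV[R]_m => x ord0 k) @^-1`
      `[(t - n1.+1%:R^-1)%R, (t + n1.+1%:R^-1)%R]).
    by apply: measurable_coord => //; exact: measurable_itv.
  by rewrite setTI; apply/seteqP; split => x /=; rewrite in_itv/= ler_distl.
move=> x [i [[y ciy /= ty] [z ciz /= /negP]]]; rewrite -leNgt => zt cix.
split; first exact: cell_sub cP _ _ cix.
have ci : ediam (c i) <= (n1.+1%:R^-1)%:E.
  by apply: le_trans (Hn0 n n0n); rewrite /mesh; exact: (le_bigmax _ (fun i => ediam (c i)) i).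
have := le_coord_ediam k ci cix ciy; have := le_coord_ediam k ci cix ciz.
rewrite /=; move: (n1.+1%:R^-1)%R => r.
by rewrite !ler_norml => /andP[h1 h2] /andP[h3 h4]; apply/andP; split; lra.
Qed.

Lemma sigma_regular_coord d (T : measurableType d) (reg : set (set T)) (f : T -> R) :
  (forall t, reg [set x | (t < f x)%R]) ->
  measurable_fun setT (f : g_sigma_algebraType reg -> R).
Proof.
move=> Hf; apply: (measurability _ (RGenOInfty.measurableE R)).
move=> _ [_ [t ->] <-]; apply: sub_sigma_algebra; rewrite setTI.
rewrite [X in reg X](_ : _ = [set x | (t < f x)%R]); first exact: Hf.
by apply/seteqP; split => x /=; rewrite in_itv/= andbT.
Qed.

(** The half-spaces are regular, so every coordinate is measurable for the sigma-algebra generated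
    by the regular sets. The identity out of that sigma-algebra is then measurable, which is the
    inclusion. *)
Lemma box_regular_gen :
  measurable `<=` <<s regular_set leb (fun n => @c n) >>.
Proof.
set reg := regular_set _ _ => A mA.
have : measurable_fun setT (id : g_sigma_algebraType reg -> 'rV[R]_m).
  by apply: measurable_fun_rV => i; apply: sigma_regular_coord; exact: regular_halfspace.
by move=> /(_ measurableT A mA); rewrite setTI.
Qed.

Theorem box_averaging_converges (f : 'rV[R]_m -> R) :
  leb.-integrable X (EFin \o f) ->
  vanishing (fun n => averaging_error leb X (@c n) f).
Proof.
apply: averaging_converges; [exact: measurable_closed_box|exact: leb_closed_box_lty| |].
  exact: box_cell_partition.
exact: box_regular_gen.
Qed.

Let c2 n (ij : 'I_n.+1 * 'I_n.+1) : set ('rV[R]_m * 'rV[R]_m) := c ij.1 `*` c ij.2.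

Lemma box2_cell_partition n : cell_partition (leb \x leb) (X `*` X) (@c2 n).
Proof.
have [mc c0 tc cX] := box_cell_partition n.
split.
- by move=> ij; apply: measurableX.
- move=> ij; rewrite -[ltRHS]/((leb \x leb) (c ij.1 `*` c ij.2)).
  by rewrite (product_measure1E _ _ (mc _) (mc _)); apply: mule_gt0; exact: c0.
- move=> [i j] [i' j'] _ _ [[x y] [[/= ix jy] [i'x j'y]]].
  by congr pair; [apply: tc => //; exists x|apply: tc => //; exists y].
- rewrite -cX; apply/seteqP; split => [[x y] [[i j] _ [/= ix jy]]|[x y] [[i _ ix] [j _ jy]]].
    by split; [exists i|exists j].
  by exists (i, j).
Qed.

(** A product cell crossed by a condition on one factor is a crossed cell times any cell, so its
    mass is controlled by the one-factor bound times the volume of the box. *)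
Lemma regular_halfspace2 k t (s : 'rV[R]_m * 'rV[R]_m -> 'rV[R]_m) :
  s = fst \/ s = snd ->
  regular_set (leb \x leb) (fun n => @c2 n) [set z | (t < (s z) ord0 k)%R].
Proof.
move=> s12; have [mH vH] := regular_halfspace k t.
have ms : measurable_fun setT s by case: s12 => ->.
split.
  rewrite [X in measurable X](_ : _ = setT `&` s @^-1` [set x | (t < x ord0 k)%R]).
    exact: ms.
  by rewrite setTI.
have lX0 : (0 <= fine (leb X))%R by exact: fine_ge0.
apply: vanishing_le (vanishingZ lX0 vH) => n.
have cP := box_cell_partition n; have cP2 := box2_cell_partition n.
have mS := measurable_split_cells cP [set x : 'rV[R]_m | (t < x ord0 k)%R].
have mX := measurable_closed_box.
rewrite fineK ?leb_closed_box_fin_num//.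
case: s12 => sE; rewrite sE.
  rewrite muleC -product_measure1E//; apply: le_measure; rewrite ?inE.
  - exact: measurable_split_cells cP2 _.
  - exact: measurableX.
  move=> [x y] [[i j] [[[u v] [/= iu jv] tu] [[u' v'] [/= iu' jv'] tu']] [/= ix jy]].
  split; last exact: cell_sub cP _ _ jy.
  by exists i => //; split; [exists u|exists u'].
rewrite -product_measure1E//; apply: le_measure; rewrite ?inE.
- exact: measurable_split_cells cP2 _.
- exact: measurableX.
move=> [x y] [[i j] [[[u v] [/= iu jv] tu] [[u' v'] [/= iu' jv'] tu']] [/= ix jy]].
split; first exact: cell_sub cP _ _ ix.
by exists j => //; split; [exists v|exists v'].
Qed.

Lemma box2_regular_gen :
  measurable `<=` <<s regular_set (leb \x leb) (fun n => @c2 n) >>.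
Proof.
set reg := regular_set _ _ => A mA.
have : measurable_fun setT (id : g_sigma_algebraType reg -> ('rV[R]_m * 'rV[R]_m)%type).
  apply/measurable_fun_pairP; split.
    apply: measurable_fun_rV => i; apply: sigma_regular_coord => t.
    by apply: regular_halfspace2; left.
  apply: measurable_fun_rV => i; apply: sigma_regular_coord => t.
  by apply: regular_halfspace2; right.
by move=> /(_ measurableT A mA); rewrite setTI.
Qed.

Lemma leb2_box_lty : (leb \x leb) (X `*` X) < +oo.
Proof.
have mX := measurable_closed_box.
by rewrite product_measure1E// ltey_eq fin_numM// leb_closed_box_fin_num.
Qed.

Theorem box2_averaging_converges (f : 'rV[R]_m * 'rV[R]_m -> R) :
  (leb \x leb).-integrable (X `*` X) (EFin \o f) ->
  vanishing (fun n => averaging_error (leb \x leb) (X `*` X) (@c2 n) f).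
Proof.
apply: averaging_converges.
- by apply: measurableX; exact: measurable_closed_box.
- exact: leb2_box_lty.
- exact: box2_cell_partition.
- exact: box2_regular_gen.
Qed.

Lemma cell_average2E n g x y :
  cell_average2 (@c n) g x y =
  average_on_cells (leb \x leb) (@c2 n) (fun z => g z.1 z.2) (x, y).
Proof.
rewrite /cell_average2 /average_on_cells pair_big /=; apply: eq_bigr => -[i j] _ /=.
by rewrite !indicE in_setX /= -natrM mulnb.
Qed.

End box_partitions.

(** * The thinning equation *)

Lemma finite_set_min {R : realDomainType} {T : choiceType} (f : T -> R) (A : set T) :
  finite_set A -> A !=set0 -> exists2 x, A x & forall y, A y -> f x <= f y.
Proof.
move=> /finite_seqP[s ->]; elim: s => [|x s ih] [y /=]; first by [].
move=> _; have [s0|] := pselect ([set` s] !=set0); last first.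
  move=> s0; exists x => /=; first exact: mem_head.
  by move=> z /=; rewrite inE => /orP[/eqP ->//|zs]; exfalso; apply: s0; exists z.
have [z zs zmin] := ih s0.
have [fxz|fzx] := leP (f x) (f z).
  exists x => /=; first exact: mem_head.
  by move=> u /=; rewrite inE => /orP[/eqP ->//|/zmin]; exact: le_trans.
exists z => /=; first by rewrite inE zs orbT.
by move=> u /=; rewrite inE => /orP[/eqP ->|/zmin//]; exact: ltW.
Qed.

Lemma decreasing_enum {R : realDomainType} {T : choiceType} (f : T -> R) (A : set T) :
  finite_set A -> (forall x y, A x -> A y -> f x = f y -> x = y) ->
  exists2 s, sorted (fun p q => f q < f p) s & A = [set` s].
Proof.
move=> /finite_seqP[s0 ->] injf.
pose le p q := f q <= f p.
pose s := sort le (undup s0).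
have mem_s x : (x \in s) = (x \in s0) by rewrite mem_sort mem_undup.
exists s; last by apply/seteqP; split => x /=; rewrite mem_s.
have : sorted le s by apply: sort_sorted => x y; exact: le_total.
have us : uniq s by rewrite sort_uniq undup_uniq.
have := injf; have -> : [set` s0] = [set` s].
  by apply/seteqP; split => x /=; rewrite mem_s.
elim: s us {mem_s} => //= x s ih /andP[xs us] inj.
case: s ih xs us inj => //= y s ih xs us inj /andP[lxy srt].
rewrite ih//; last by move=> u v us' vs'; apply: inj; rewrite /= inE (us', vs') orbT.
rewrite andbT lt_neqAle; apply/andP; split; last exact: lxy.
apply: contra xs => /eqP fyx.
by rewrite (inj y x)// ?inE ?eqxx ?orbT// mem_head.
Qed.

Section thinning.
Context {R : realType} {m : nat} {dE : measure_display} {E : measurableType dE}.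
Local Notation event := (R * 'rV[R]_m * E)%type.
Local Notation point := (R * 'rV[R]_m * E * R)%type.

Definition point_time (p : point) : R := p.1.1.1.

Section one_process.
Variables (lam : 'rV[R]_m -> R) (W : 'rV[R]_m -> 'rV[R]_m -> R)
  (K : E -> 'rV[R]_m -> 'rV[R]_m -> R) (h : R -> R).

(** The zero branch lets [rate] sum over a whole list and still depend on the past of t only, see
    [rate_past]. The level of the point does not enter. *)
Definition excitation (t : R) (x : 'rV[R]_m) (q : point) : R :=
  if point_time q < t
  then K q.1.2 x q.1.1.2 * W x q.1.1.2 * h (t - point_time q) else 0.

Definition rate (s : seq point) (t : R) (x : 'rV[R]_m) : R :=
  lam x + \sum_(q <- s) excitation t x q.

Definition thinned (Pi : set point) (H : set event) : set event :=
  [set e | exists2 r, Pi (e, r) & (r%:E <= intensity lam W K h H e.1.1 e.1.2)%E].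

Definition accepted (s : seq point) (p : point) : bool :=
  p.2 <= rate s (point_time p) p.1.1.2.

Lemma rate_past s t x : rate [seq q <- s | point_time q < t] t x = rate s t x.
Proof.
congr (_ + _); rewrite big_filter big_mkcond; apply: eq_bigr => q _.
by rewrite /excitation; case: (point_time q < t).
Qed.

Lemma intensity_local H H' t x :
  (forall e : event, e.1.1 < t -> H e <-> H' e) ->
  intensity lam W K h H t x = intensity lam W K h H' t x.
Proof.
move=> HH'; rewrite /intensity; congr (_ + esum _ _)%E.
by apply/seteqP; split => e /= [He et]; split => //; apply/HH'.
Qed.

(** Consider an earliest event of the symmetric difference, which exists by finiteness. The two
    histories agree before it, hence so do the intensities that decide about it, and it belongs to
    both sets or to none. *)
Lemma thinned_unique Pi H H' : finite_set H -> finite_set H' ->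
  H = thinned Pi H -> H' = thinned Pi H' -> H = H'.
Proof.
move=> fH fH' EH EH'; apply/seteqP.
pose D := (H `\` H') `|` (H' `\` H).
have fD : finite_set D by rewrite finite_setU; split; exact: finite_setD.
have [D0|/set0P/negP/negPn/eqP D0] := pselect (D !=set0); last first.
  split=> e He; apply: contrapT => H'e.
    by have : set0 e by rewrite -D0; left.
  by have : set0 e by rewrite -D0; right.
have [e De emin] := finite_set_min (fun e : event => e.1.1) fD D0.
have past e' : e'.1.1 < e.1.1 -> H e' <-> H' e'.
  move=> e'e; split=> He'; apply: contrapT => H'e'.
    by have := emin e' (or_introl (conj He' H'e')); rewrite leNgt e'e.
  by have := emin e' (or_intror (conj He' H'e')); rewrite leNgt e'e.
have Ieq := intensity_local e.1.2 past.
exfalso; case: De => -[].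
  by rewrite EH EH' => -[r Pr rI]; apply; exists r => //; rewrite -Ieq.
by rewrite EH EH' => -[r Pr rI]; apply; exists r => //; rewrite Ieq.
Qed.

Hypothesis excitation_ge0 : forall t x q, 0 <= excitation t x q.

Lemma intensity_rate (s : seq point) t x : uniq (map fst s) ->
  intensity lam W K h [set` map fst s] t x = (rate s t x)%:E.
Proof.
move=> us; rewrite /intensity /rate EFinD; congr (_ + _)%E.
(* Any level would do; 0 serves to evaluate [excitation] on an event. *)
pose ex (e : event) := excitation t x (e, 0).
have exE q : excitation t x q = ex q.1 by [].
rewrite (_ : [set e | _] = [set` [seq e <- map fst s | e.1.1 < t]]); last first.
  apply/seteqP; split => e /=; rewrite mem_filter; first by move=> [-> ->].
  by move=> /andP[].
rewrite esum_fset//; last first.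
  move=> e; rewrite inE /= mem_filter => /andP[et _].
  by have := excitation_ge0 t x (e, 0); rewrite /excitation /point_time /= et.
  exact: finite_seq.
rewrite -(fsbig_seq _ _ (filter_uniq _ us)) -sumEFin big_filter big_map big_mkcond.
by apply: eq_bigr => q _; rewrite /excitation /point_time; case: ifP.
Qed.

Lemma thinned_rate Pi (s : seq point) : uniq (map fst s) ->
  thinned Pi [set` map fst s] = fst @` [set p | Pi p /\ accepted s p].
Proof.
move=> us; apply/seteqP; split => [e /= [r Pr]|e [[e' r] /= [Pr rI] <-]].
  by rewrite intensity_rate// lee_fin => rI; exists (e, r).
by exists r => //; rewrite intensity_rate// lee_fin.
Qed.

End one_process.

(** For a fixed finite history, the right-hand side of the equation depends on the parameters only
    through the acceptance of the points of [Pi]. *)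
Lemma thinned_stable lam1 W1 (K1 : E -> 'rV[R]_m -> 'rV[R]_m -> R)
    lam2 W2 (K2 : E -> 'rV[R]_m -> 'rV[R]_m -> R) h Pi s :
  (forall t x q, 0 <= excitation W1 K1 h t x q) ->
  (forall t x q, 0 <= excitation W2 K2 h t x q) ->
  uniq (map fst s) ->
  [set` map fst s] = thinned lam1 W1 K1 h Pi [set` map fst s] ->
  (forall p, Pi p -> accepted lam1 W1 K1 h s p = accepted lam2 W2 K2 h s p) ->
  [set` map fst s] = thinned lam2 W2 K2 h Pi [set` map fst s].
Proof.
move=> e1 e2 us; rewrite !thinned_rate// => -> acc.
by apply/seteqP; split => _ [p [Pp ap] <-]; exists p => //=; split => //; rewrite (acc, =^~acc).
Qed.

End thinning.

(** * Regions between two graphs *)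

Section restricted_measures.
Context {R : realType} d (T : measurableType d).
Local Open Scope ereal_scope.

Lemma ge0_integral_mrestr (mu : {measure set T -> \bar R}) (A : set T)
    (mA : measurable A) (f : T -> \bar R) :
  measurable_fun setT f -> (forall x, 0 <= f x) ->
  \int[mrestr mu mA]_x f x = \int[mu]_(x in A) f x.
Proof.
move=> mf f0.
have A0 : mrestr mu mA (~` A) = 0 by rewrite /mrestr setICl measure0.
rewrite (ge0_negligible_integral (measurableC mA) measurableT mf (fun x _ => f0 x) A0).
rewrite setDE setCK setTI; apply: eq_measure_integral => B mB BA.
by rewrite /= /mrestr setIidl.
Qed.

End restricted_measures.

Section tuple_restriction.
Context {R : realType} d (S : measurableType d).
Local Open Scope ereal_scope.

Lemma tuples_in_cons (A : set S) n :
  @cons_tup _ S n @^-1` tuples_in A (n:=n.+1) = A `*` tuples_in A (n:=n).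
Proof.
apply/seteqP; split => [[p s] /= H|[p s] [/= Ap As] q].
  split => /=; first by apply: H; rewrite /= inE eqxx.
  by move=> q qs; apply: H; rewrite /= inE qs orbT.
by rewrite /= inE => /orP[/eqP ->//|]; exact: As.
Qed.

Lemma measurable_tuples_in (A : set S) n : measurable A -> measurable (tuples_in A (n:=n)).
Proof.
move=> mA; elim: n => [|n ih].
  by rewrite (_ : tuples_in A (n:=0) = setT)//; apply/seteqP; split => // s _ q; rewrite tuple0.
by rewrite tuples_inS; exact: measurable_cons_image.
Qed.

Variables (mu muA : {finite_measure set S -> \bar R}) (A : set S).
Hypotheses (mA : measurable A)
  (muAE : forall Z, measurable Z -> muA Z = mu (Z `&` A)).

Lemma tuple_measure_restr n Z : measurable Z ->
  tuple_measure muA n Z = tuple_measure mu n (Z `&` tuples_in A (n:=n)).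
Proof.
elim: n Z => [|n ih] Z mZ.
  rewrite (_ : tuples_in A (n:=0) = setT) ?setIT//.
  by apply/seteqP; split => // s _ q; rewrite tuple0.
rewrite !tuple_measureS preimage_setI tuples_in_cons.
have mAA := measurableX mA (measurable_tuples_in (n:=n) mA).
have := @product_measure_unique _ _ _ _ _ muA (tuple_measure muA n)
  (mrestr (mu \x tuple_measure mu n) mAA).
move=> -> //.
- move=> U V mU mV; rewrite /= /mrestr -setXI muAE// ih//.
  rewrite -[LHS]/((mu \x tuple_measure mu n) ((U `&` A) `*` (V `&` tuples_in A (n:=n)))).
  rewrite product_measure1E//; apply: measurableI => //.
  exact: measurable_tuples_in.
- by rewrite -[X in measurable X]setTI; exact: measurable_cons_tup.
Qed.

(** The head keeps the full measure while the tail is charged with the restricted one. Thus a bound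
    on the head section that is uniform in the strip of the head yields a bound that only involves
    the strip of the tail. *)
Lemma tuple_measure_tail n Z : measurable Z ->
  (forall s, Z s -> forall q, q \in behead (s : n.+1.-tuple S) -> A q) ->
  tuple_measure mu n.+1 Z =
  \int[tuple_measure muA n]_s mu [set p | Z (cons_tup (p, s))].
Proof.
move=> mZ ZA; rewrite tuple_measureS.
have mTA := measurableX (@measurableT _ S) (measurable_tuples_in (n:=n) mA).
have mU : measurable (@cons_tup _ S n @^-1` Z).
  by rewrite -[X in measurable X]setTI; exact: measurable_cons_tup.
have -> : @cons_tup _ S n @^-1` Z =
    @cons_tup _ S n @^-1` Z `&` [set: S] `*` tuples_in A (n:=n).
  rewrite setIidl// => -[p s] /= Zps; split => // q qs.
  exact: ZA Zps _ qs.
(* The product [\x^] measures the head for a fixed tail, the order wanted here. *)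
transitivity ((mu \x^ tuple_measure muA n) (@cons_tup _ S n @^-1` Z)).
  transitivity ((mu \x tuple_measure muA n) (@cons_tup _ S n @^-1` Z)).
    apply/esym.
    have := @product_measure_unique _ _ _ _ _ mu (tuple_measure muA n)
      (mrestr (mu \x tuple_measure mu n) mTA).
    move=> -> //.
    move=> U V mU' mV; rewrite /= /mrestr -setXI setIT tuple_measure_restr//.
    rewrite -[LHS]/((mu \x tuple_measure mu n) (U `*` (V `&` tuples_in A (n:=n)))).
    by rewrite product_measure1E//; apply: measurableI => //; exact: measurable_tuples_in.
  by apply: product_measure_unique => // U V mU' mV /=; rewrite product_measure2E.
by apply: eq_integral => s _ /=; congr (mu _); apply/seteqP; split => p; rewrite /ysection /= inE.
Qed.

End tuple_restriction.

Section between.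
Context {R : realType} d (T : measurableType d) d' (E : measurableType d').
Variables (mu : {sigma_finite_measure set T -> \bar R}) (Q : probability E R).
Local Open Scope ereal_scope.

(** For a fixed z the admissible levels form the interval between [u z] and [v z], of length |u z -
    v z|, and the mark has total mass one. *)
Lemma measure_between (D : set T) (u v : T -> R) :
  measurable D -> measurable_fun setT u -> measurable_fun setT v ->
  ((mu \x Q) \x @lebesgue_measure R)
    [set p : T * E * R | D p.1.1 /\ (p.2 <= u p.1.1)%R != (p.2 <= v p.1.1)%R] <=
  \int[mu]_(z in D) (`|u z - v z|)%:E.
Proof.
move=> mD mu_ mv.
set Z := [set p | _].
have muv : measurable_fun setT (fun z => `|u z - v z|%:E * (\1_D z)%:E).
  apply: emeasurable_funM; last exact/measurable_EFinP/measurable_indic.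
  by apply/measurable_EFinP; apply: measurableT_comp => //; exact: measurable_funB.
have uv0 z : 0 <= `|u z - v z|%:E * (\1_D z)%:E :> \bar R by rewrite mule_ge0 ?lee_fin.
have -> : \int[mu]_(z in D) (`|u z - v z|)%:E =
    \int[mu \x Q]_w (`|u w.1 - v w.1|%:E * (\1_D w.1)%:E).
  rewrite fubini_tonelli1//; last first.
    exact: (measurableT_comp muv measurable_fst).
  rewrite integral_mkcond; apply: eq_integral => z _ /=.
  rewrite /fubini_F /= integral_cst//= probability_setT mule1 patchE indicE.
  by case: (z \in D); rewrite ?mulr1 ?mulr0.
have mleq (f : T -> R) : measurable_fun setT f ->
    measurable [set p : T * E * R | (p.2 <= f p.1.1)%R].
  move=> mf; rewrite [X in measurable X](_ : _ = setT `&`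
    (fun p : T * E * R => f p.1.1 - p.2)%R @^-1` `[0%R, +oo[).
    have mg : measurable_fun setT (fun p : T * E * R => f p.1.1 - p.2)%R.
      apply: measurable_funB; last exact: measurable_snd.
      apply: measurableT_comp => //.
      by apply: (measurableT_comp measurable_fst); exact: measurable_fst.
    by apply: mg => //; exact: measurable_itv.
  by rewrite setTI; apply/seteqP; split => p /=; rewrite in_itv/= andbT subr_ge0.
have mZ : measurable Z.
  rewrite [X in measurable X](_ : _ = (fun p : T * E * R => p.1.1) @^-1` D `&`
     (([set p : T * E * R | (p.2 <= u p.1.1)%R] `\` [set p : T * E * R | (p.2 <= v p.1.1)%R])
     `|` ([set p : T * E * R | (p.2 <= v p.1.1)%R] `\` [set p : T * E * R | (p.2 <= u p.1.1)%R]))).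
    apply: measurableI.
      rewrite -[X in measurable X]setTI.
      by apply: (measurableT_comp measurable_fst measurable_fst).
    by apply: measurableU; apply: measurableD; exact: mleq.
  apply/seteqP; split => p /=.
    move=> [Dp]; case: (boolP (_ <= u _)%R); case: (boolP (_ <= v _)%R) => // ? ? _; split => //.
      by left; split => //; apply/negP.
    by right; split => //; apply/negP.
  move=> [Dp H]; split => //; case: H => -[/= h1 /negP h2].
    by rewrite h1 (negbTE h2).
  by rewrite h1 (negbTE h2).
have -> : ((mu \x Q) \x @lebesgue_measure R) Z =
    \int[mu \x Q]_w ((@lebesgue_measure R \o xsection Z) w) by [].
have mS : measurable_fun setT (@lebesgue_measure R \o xsection Z).
  exact: measurable_fun_xsection.
apply: ge0_le_integral; [by []| |exact: mS| |].
- by move=> w _; exact: measure_ge0.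
- exact: (measurableT_comp muv measurable_fst).
move=> [z b] _; rewrite [leLHS]/= [leRHS]/=.
rewrite indicE; case: (boolP (z \in D)) => zD; last first.
  rewrite (_ : xsection _ _ = set0) ?measure0 ?mule0//.
  apply/seteqP; split => // r; rewrite /xsection /= inE => -[/= /mem_set].
  by rewrite (negbTE zD).
rewrite mule1.
pose I : set R := `]Num.min (u z) (v z), Num.max (u z) (v z)]%classic.
apply: (@le_trans _ _ (lebesgue_measure I)).
  apply: le_measure; rewrite ?inE; [exact: measurable_xsection|exact: measurable_itv|].
  move=> r; rewrite /xsection /= inE => -[_ /=]; rewrite /I /= in_itv /= gt_min le_max !ltNge.
  by case: (r <= u z)%R; case: (r <= v z)%R.
rewrite lebesgue_measure_itv /= lte_fin; case: ifP => _; last by rewrite lee_fin.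
rewrite -EFinB lee_fin /Num.max /Num.min; case: ltP => uv.
  by rewrite ltr0_norm ?subr_lt0// opprB.
by rewrite ger0_norm ?subr_ge0.
Qed.

End between.

(** * Translation invariance of Lebesgue measure *)

Section lebesgue_shift.
Context {R : realType}.
Local Open Scope ereal_scope.

Definition shift_by (c : R) (x : measurableTypeR R) : measurableTypeR R := (x + c)%R.

Lemma measurable_shift_by {c} : measurable_fun setT (shift_by c).
Proof. exact: measurable_funD. Qed.

HB.instance Definition _ c :=
  isMeasurableFun.Build _ _ _ _ (shift_by c) measurable_shift_by.

Lemma lebesgue_measure_shift (c : R) (A : set R) : measurable A ->
  lebesgue_measure A = pushforward (@lebesgue_measure R) (shift_by c) A.
Proof.
have H (I : set R) : ocitv I ->
    lebesgue_measure I = pushforward (@lebesgue_measure R) (shift_by c) I.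
  move=> [[a b] _ <-] /=; rewrite /pushforward /=.
  rewrite [X in _ = lebesgue_measure X](_ : _ = `](a - c)%R, (b - c)%R]%classic); last first.
    by apply/seteqP; split => x /=; rewrite !in_itv/= /shift_by ltrBlDr lerBrDr.
  rewrite !lebesgue_measure_itv /= !lte_fin ltrD2r.
  by case: ifP => // _; rewrite -!EFinB; congr (_%:E); ring.
move=> mA; pose mu : {measure set (measurableTypeR R) -> \bar R} :=
  pushforward (@lebesgue_measure R) (shift_by c).
exact: (@lebesgue_measure_unique R (mu (measurable_shift_by (c := c))) H A mA).
Qed.

Lemma ge0_integral_shift (c : R) (f : R -> \bar R) :
  measurable_fun setT f -> (forall x, 0 <= f x) ->
  \int[@lebesgue_measure R]_x f (x + c)%R = \int[@lebesgue_measure R]_x f x.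
Proof.
move=> mf f0.
have H := @ge0_integral_pushforward _ _ _ _ R _ (measurable_shift_by (c := c))
  (@lebesgue_measure R) setT f.
apply: etrans (_ : \int[pushforward (@lebesgue_measure R) (shift_by c)]_x f x = _).
  by apply/esym/H.
apply: eq_measure_integral => A mA _.
exact: (esym (lebesgue_measure_shift c mA)).
Qed.

End lebesgue_shift.

(** * Averaging errors of the kernels *)

Section sigma_finite_product.
Context {R : realType} d d' (T : measurableType d) (T' : measurableType d').
Variable mu : {sigma_finite_measure set T -> \bar R}.
Variable mu' : {sigma_finite_measure set T' -> \bar R}.
(** A name for the product measure under which sigma-finiteness is registered, so that Tonelli's
    theorem can be iterated. *)
Definition sigma_finite_product : set (T * T') -> \bar R := (mu \x mu')%E.

HB.instance Definition _ := Measure.on sigma_finite_product.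

Let sigma_finite_product_sigma_finite : sigma_finite setT sigma_finite_product.
Proof.
have /sigma_finiteP[F [TF ndF Foo]] := sigma_finiteT mu.
have /sigma_finiteP[G [TG ndG Goo]] := sigma_finiteT mu'.
exists (fun n => F n `*` G n).
  rewrite -setXTT TF TG predeqE => -[x y]; split.
    move=> [/= [n _ Fnx] [k _ Gky]]; exists (maxn n k) => //; split.
    - by move: x Fnx; exact/subsetPset/ndF/leq_maxl.
    - by move: y Gky; exact/subsetPset/ndG/leq_maxr.
  by move=> [n _ []/= ? ?]; split; exists n.
move=> k; have [? ?] := Foo k; have [? ?] := Goo k.
split; first exact: measurableX.
by rewrite /sigma_finite_product product_measure1E// lte_mul_pinfty// ge0_fin_numE.
Qed.

HB.instance Definition _ := Measure_isSigmaFinite.Build _ _ _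
  sigma_finite_product sigma_finite_product_sigma_finite.
End sigma_finite_product.

Lemma measurable_fun_partial_integral {R : realType} d1 d2 (T1 : measurableType d1)
    (T2 : measurableType d2) {m2 : {sigma_finite_measure set T2 -> \bar R}}
    (D : set T2) (f : T1 -> T2 -> \bar R) :
  measurable D -> measurable_fun setT (fun p : T1 * T2 => f p.1 p.2) ->
  (forall x y, 0 <= f x y)%E ->
  measurable_fun setT (fun x => \int[m2]_(y in D) f x y)%E.
Proof.
move=> mD mf f0.
pose g (p : T1 * T2) := (f p.1 p.2 * (\1_D p.2)%:E)%E.
have mg : measurable_fun setT g.
  apply: emeasurable_funM => //; apply/measurable_EFinP.
  by apply: (measurableT_comp _ measurable_snd); exact: measurable_indic.
have g0 p : (0 <= g p)%E by rewrite mule_ge0 ?lee_fin.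
have := @measurable_fun_fubini_tonelli_F _ _ _ _ _ m2 g mg g0.
apply: eq_measurable_fun => x _; rewrite /fubini_F [RHS]integral_mkcond.
apply: eq_integral => y _; rewrite patchE /g /= indicE.
by case: (y \in D); rewrite ?mule1 ?mule0.
Qed.

Section approximation.
Context {R : realType} {m : nat}.
Variables (a b : 'rV[R]_m).
Local Notation X := (closed_box a b).
Local Notation leb := (@leb R m).
Variable C : forall d : nat, 'I_d -> set 'rV[R]_m.
Hypothesis C_part : forall d, (0 < d)%N -> hyperrectangle_partition X (@C d).
Hypothesis C_mesh : (fun d => mesh (@C d)) @ \oo --> 0%E.
Context {dE : measure_display} {E : measurableType dE} (LawB : probability E R).
Local Notation measurable_graphon W :=
  (measurable_fun setT (fun z : 'rV[R]_m * 'rV[R]_m => W z.1 z.2)).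
Local Notation measurable_marks K :=
  (measurable_fun setT (fun p : E * ('rV[R]_m * 'rV[R]_m) => K p.1 p.2.1 p.2.2)).
Variables (W : 'rV[R]_m -> 'rV[R]_m -> R) (CW : R)
  (B : E -> 'rV[R]_m -> 'rV[R]_m -> R) (CB : R).
Hypothesis W_meas : measurable_graphon W.
Hypothesis W_bnd : forall x y, 0 <= W x y <= CW.
Hypothesis B_meas : measurable_marks B.
Hypothesis B_ge0 : forall w x y, 0 <= B w x y.
Hypothesis CB_ge0 : 0 <= CB.
Hypothesis B_bnd : forall x y, X x -> X y ->
  (\int[LawB]_w (B w x y)%:E <= CB%:E)%E.

Local Notation W_ n := (cell_average2 (@C n.+1) W).
Local Notation B_ n := (fun w => cell_average2 (@C n.+1) (B w)).
Local Notation leb2 := (leb \x leb)%E.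
Local Notation X2 := (X `*` X).
Local Notation cell2 n := (fun ij : 'I_n.+1 * 'I_n.+1 => @C n.+1 ij.1 `*` @C n.+1 ij.2).

Let mX : measurable X := measurable_closed_box a b.
Let mX2 : measurable X2 := measurableX mX mX.
Let part2 n : cell_partition leb2 X2 (cell2 n) := box2_cell_partition C_part n.
Let leb2X : (leb2 X2 < +oo)%E := leb2_box_lty a b.
Let mcell2 n i : measurable (cell2 n i). Proof. by case: (part2 n). Qed.

Let leb2s : {sigma_finite_measure set ('rV[R]_m * 'rV[R]_m)%type -> \bar R} :=
  sigma_finite_product (@Defs.leb R m) (@Defs.leb R m).

Lemma cell_average_ge0 n (g : 'rV[R]_m -> 'rV[R]_m -> R) x y :
  (forall x y, 0 <= g x y) -> 0 <= cell_average2 (@C n) g x y.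
Proof.
move=> g0; apply: sumr_ge0 => i _; apply: sumr_ge0 => j _.
apply: mulr_ge0; first by rewrite mulr_ge0// indicE.
by apply: mulr_ge0; [rewrite invr_ge0 fine_ge0|exact: Rintegral_ge0].
Qed.

Let CW_ge0 : 0 <= CW.
Proof. by have /andP[h1 h2] := W_bnd 0 0; exact: le_trans h1 h2. Qed.

Lemma integrable_W : leb2.-integrable X2 (EFin \o (fun z => W z.1 z.2)).
Proof.
apply/integrableP; split.
  by apply/measurable_EFinP; exact: measurable_funTS.
apply: (@le_lt_trans _ _ (\int[leb2]_(z in X2) CW%:E)%E); last first.
  by rewrite integral_cst// lte_mul_pinfty.
apply: ge0_le_integral; [exact: mX2|by []| | |].
- by apply: measurableT_comp => //; apply/measurable_EFinP; exact: measurable_funTS.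
- exact: measurable_cst.
- move=> z _ /=; rewrite lee_fin; have /andP[h1 h2] := W_bnd z.1 z.2.
  by rewrite ger0_norm.
Qed.

Lemma W_average_bnd n x y : X x -> X y -> 0 <= W_ n x y <= CW.
Proof.
move=> Xx Xy; rewrite cell_average_ge0/=; last first.
  by move=> u v; have /andP[] := W_bnd u v.
have [ij cij] := cell_cover (part2 n) (conj Xx Xy : X2 (x, y)).
rewrite cell_average2E (average_on_cellsE (part2 n) _ cij) /average mulrC.
have c0 := cell_gt0 mX2 leb2X (part2 n) ij.
rewrite ler_pdivrMr; last exact: c0.
have fc := cell_fin_num mX2 leb2X (part2 n) ij.
have fi := integrable_fin_num (mcell2 ij) (integrable_cell mX2 (part2 n) ij integrable_W).
rewrite /Rintegral -lee_fin EFinM (fineK fc) (fineK fi).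
rewrite -integral_cst//; apply: ge0_le_integral; [exact: mcell2| | | |].
- by move=> z _; rewrite lee_fin; have /andP[] := W_bnd z.1 z.2.
- by apply/measurable_EFinP; exact: measurable_funTS.
- exact: measurable_cst.
- by move=> z _; rewrite lee_fin; have /andP[] := W_bnd z.1 z.2.
Qed.

Local Open Scope ereal_scope.

Let measurable_restricted_mass D : measurable D -> measurable_fun setT
  (fun w => \int[leb2]_(z in D) (B w z.1 z.2)%:E).
Proof.
move=> mD; pose f w (z : 'rV[R]_m * 'rV[R]_m) := (B w z.1 z.2)%:E.
have mf : measurable_fun setT
    (fun p : E * ('rV[R]_m * 'rV[R]_m) => (B p.1 p.2.1 p.2.2)%:E).
  exact/measurable_EFinP.
apply: (@measurable_fun_partial_integral _ _ _ _ _ leb2s _ f mD mf).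
by move=> w z; rewrite lee_fin.
Qed.

Lemma measurable_B_average n : measurable_fun setT
  (fun p : E * ('rV[R]_m * 'rV[R]_m) => B_ n p.1 p.2.1 p.2.2).
Proof.
apply: (eq_measurable_fun (fun p => (\sum_ij \1_(cell2 n ij) p.2 *
    average leb2 (cell2 n ij) (fun z => B p.1 z.1 z.2))%R)).
  by move=> [w [x y]] _; rewrite cell_average2E.
apply: measurable_sum => ij; apply: measurable_funM.
  by apply: (measurableT_comp _ measurable_snd); exact: measurable_indic.
apply: measurable_funM => //.
apply: (measurableT_comp (f := fun w =>
  (\int[leb2]_(z in cell2 n ij) B w z.1 z.2)%R) _ measurable_fst).
by apply: measurableT_comp => //; exact: measurable_restricted_mass.
Qed.

Lemma measurable_W_average n : measurable_fun setT
  (fun z : 'rV[R]_m * 'rV[R]_m => W_ n z.1 z.2).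
Proof.
apply: (eq_measurable_fun (average_on_cells leb2 (cell2 n) (fun z => W z.1 z.2))).
  by move=> [x y] _; rewrite cell_average2E.
exact: (measurable_average_on_cells (part2 n)).
Qed.

Let B_section w : measurable_fun setT (fun z : 'rV[R]_m * 'rV[R]_m => B w z.1 z.2).
Proof. exact: (measurableT_comp B_meas (measurable_pair1 w)). Qed.

(** The bound on the mean of [B] holds at fixed locations, so Tonelli's theorem first moves the
    expectation inside. *)
Lemma mean_weighted_B (g : 'rV[R]_m * 'rV[R]_m -> \bar R) :
  measurable_fun setT g -> (forall z, 0 <= g z) ->
  \int[LawB]_w \int[leb2]_(z in X2) ((B w z.1 z.2)%:E * g z) <=
  CB%:E * \int[leb2]_(z in X2) g z.
Proof.
move=> mg g0.
pose f (p : E * ('rV[R]_m * 'rV[R]_m)) := (B p.1 p.2.1 p.2.2)%:E * (g p.2 * (\1_X2 p.2)%:E).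
have mf : measurable_fun setT f.
  apply: emeasurable_funM; first exact/measurable_EFinP.
  apply: emeasurable_funM; first exact: (measurableT_comp mg measurable_snd).
  apply/measurable_EFinP; apply: (measurableT_comp _ measurable_snd).
  exact: measurable_indic.
have f0 p : 0 <= f p by rewrite !mule_ge0 ?lee_fin.
have -> : \int[LawB]_w \int[leb2]_(z in X2) ((B w z.1 z.2)%:E * g z) =
    \int[LawB]_w \int[leb2]_z f (w, z).
  apply: eq_integral => w _; rewrite integral_mkcond; apply: eq_integral => z _.
  by rewrite patchE /f /= indicE; case: (z \in _); rewrite ?mule1 ?mule0.
rewrite (@fubini_tonelli _ _ _ _ _ LawB leb2s f mf f0).
rewrite -ge0_integralZl//; last exact: measurable_funTS.
rewrite [leRHS]integral_mkcond; apply: ge0_le_integral; [by []| | | |].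
- by move=> z _; exact: integral_ge0.
- exact: measurable_fun_fubini_tonelli_G.
- apply/(measurable_restrictT _ mX2); apply: measurable_funTS.
  exact: measurable_funeM.
move=> z _; rewrite /f /= patchE indicE; case: (boolP (z \in X2)) => [|_].
  move=> /set_mem[Xz1 Xz2].
  under eq_integral do rewrite mule1.
  have mz : measurable_fun setT (fun w => (B w z.1 z.2)%:E).
    apply/measurable_EFinP.
    exact: (measurableT_comp B_meas (measurable_pair2 z)).
  rewrite ge0_integralZr//; last by move=> w _; rewrite lee_fin.
  by apply: lee_wpmul2r => //; exact: B_bnd.
by rewrite integral0_eq// => w _; rewrite !mule0.
Qed.

Let mass_B w := \int[leb2]_(z in X2) (B w z.1 z.2)%:E.

Let mean_mass_B : \int[LawB]_w mass_B w < +oo.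
Proof.
have := mean_weighted_B (measurable_cst 1) (fun=> lee01).
rewrite integral_cst// mul1e => H.
apply: (@le_lt_trans _ _ (CB%:E * leb2 X2)); last by rewrite lte_mul_pinfty.
apply: le_trans H; rewrite le_eqVlt; apply/orP; left; apply/eqP.
by apply: eq_integral => w _; apply: eq_integral => z _; rewrite mule1.
Qed.

Definition mean_error_B n : \bar R :=
  \int[LawB]_w averaging_error leb2 X2 (cell2 n) (fun z => B w z.1 z.2).

Let measurable_error_B n : measurable_fun setT
  (fun w => averaging_error leb2 X2 (cell2 n) (fun z => B w z.1 z.2)).
Proof.
apply: (eq_measurable_fun (fun w =>
    \int[leb2]_(z in X2) (`|B_ n w z.1 z.2 - B w z.1 z.2|%:E))).
  move=> w _; apply: eq_integral => z _.
  by rewrite cell_average2E -surjective_pairing.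
pose f w (z : 'rV[R]_m * 'rV[R]_m) := `|B_ n w z.1 z.2 - B w z.1 z.2|%:E.
have mf : measurable_fun setT (fun p : E * ('rV[R]_m * 'rV[R]_m) =>
    `|B_ n p.1 p.2.1 p.2.2 - B p.1 p.2.1 p.2.2|%:E).
  apply/measurable_EFinP; apply: measurableT_comp => //.
  by apply: measurable_funB => //; exact: measurable_B_average.
apply: (@measurable_fun_partial_integral _ _ _ _ _ leb2s _ f mX2 mf).
by move=> w z; rewrite lee_fin.
Qed.

(** Dominated convergence over the paths. The mass of [B w] on the square has finite mean, so almost
    every path is integrable there and its averaging error vanishes; twice that mass dominates. *)
Lemma vanishing_mean_error_B : vanishing mean_error_B.
Proof.
have mass0 w : 0 <= mass_B w by apply: integral_ge0 => z _; rewrite lee_fin.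
have mmass : measurable_fun setT mass_B by exact: measurable_restricted_mass.
have imass : LawB.-integrable setT mass_B.
  apply/integrableP; split => //.
  by under eq_integral do rewrite gee0_abs//.
have B_int w : mass_B w \is a fin_num -> leb2.-integrable X2 (EFin \o (fun z => B w z.1 z.2)).
  move=> fw; apply/integrableP; split.
    by apply/measurable_EFinP; exact: measurable_funTS.
  rewrite ltey_eq; apply/orP; left.
  rewrite (_ : \int[leb2]_(z in X2) _ = mass_B w)//.
  by apply: eq_integral => z _ /=; rewrite ger0_norm.
have ae_fin := integrable_ae measurableT imass.
pose f_ n w := averaging_error leb2 X2 (cell2 n) (fun z => B w z.1 z.2).
have f0 n w : 0 <= f_ n w by apply: integral_ge0 => z _; rewrite lee_fin.
have ae_cvg : {ae LawB, forall w, setT w -> f_ ^~ w @ \oo --> cst 0 w}.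
  apply: filterS ae_fin => w /(_ I) fw _.
  apply/(vanishing_cvgP (fun n => f0 n w)).
  exact: (box2_averaging_converges C_part C_mesh (B_int w fw)).
have ae_dom : {ae LawB, forall w n, setT w -> `|f_ n w| <= 2%:E * mass_B w}.
  apply: filterS ae_fin => w /(_ I) fw n _; rewrite gee0_abs//.
  apply: (le_trans (averaging_error_le mX2 leb2X (part2 n) (B_int w fw))).
  rewrite lee_wpmul2l//= le_eqVlt; apply/orP; left; apply/eqP.
  by apply: eq_integral => z _; rewrite ger0_norm.
have mf n : measurable_fun setT (f_ n) by exact: measurable_error_B.
have [_ _ H] := dominated_convergence measurableT mf (measurable_cst 0) ae_cvg
  (integrableZl measurableT 2%R imass) ae_dom.
rewrite integral0 in H.
have e0 n : 0 <= mean_error_B n by apply: integral_ge0 => w _; exact: f0.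
exact: (vanishing_cvgP e0).1 H.
Qed.

Definition kernel_error n w x y : R :=
  `|B_ n w x y * W_ n x y - B w x y * W x y|%R.

Lemma kernel_error_ge0 n w x y : (0 <= kernel_error n w x y)%R.
Proof. exact: normr_ge0. Qed.

Definition mean_kernel_error n : \bar R :=
  \int[LawB]_w \int[leb2]_(z in X2) (kernel_error n w z.1 z.2)%:E.

Lemma measurable_kernel_error n : measurable_fun setT
  (fun p : E * ('rV[R]_m * 'rV[R]_m) => kernel_error n p.1 p.2.1 p.2.2).
Proof.
apply: measurableT_comp => //; apply: measurable_funB; apply: measurable_funM => //.
- exact: measurable_B_average.
- exact: (measurableT_comp (measurable_W_average n) measurable_snd).
- exact: (measurableT_comp W_meas measurable_snd).
Qed.

(** The difference of the products is split as (B_n - B) W_n + B (W_n - W). Averages of [W] keep the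
    bound [CW], and in the second term the unaveraged [B] has mean at most [CB] at every pair of
    locations. *)
Lemma vanishing_mean_kernel_error : vanishing mean_kernel_error.
Proof.
have vW := vanishingZ CB_ge0 (box2_averaging_converges C_part C_mesh integrable_W).
apply: vanishing_le (vanishingD (vanishingZ CW_ge0 vanishing_mean_error_B) vW) => n.
pose eB w z := `|B_ n w z.1 z.2 - B w z.1 z.2|%:E.
pose eW z := `|W_ n z.1 z.2 - W z.1 z.2|%:E.
have meW : measurable_fun setT eW.
  apply/measurable_EFinP; apply: measurableT_comp => //.
  by apply: measurable_funB => //; exact: measurable_W_average.
have meB : measurable_fun setT (fun p : E * ('rV[R]_m * 'rV[R]_m) => eB p.1 p.2).
  apply/measurable_EFinP; apply: measurableT_comp => //.
  by apply: measurable_funB => //; exact: measurable_B_average.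
have meB' w : measurable_fun setT (eB w).
  exact: (measurableT_comp meB (measurable_pair1 w)).
have eWE : averaging_error leb2 X2 (cell2 n) (fun z => W z.1 z.2) =
    \int[leb2]_(z in X2) eW z.
  by apply: eq_integral => z _; rewrite /eW cell_average2E -surjective_pairing.
have eBE w : averaging_error leb2 X2 (cell2 n) (fun z => B w z.1 z.2) =
    \int[leb2]_(z in X2) eB w z.
  by apply: eq_integral => z _; rewrite /eB cell_average2E -surjective_pairing.
have eB0 w z : 0 <= eB w z by rewrite lee_fin.
have eW0 z : 0 <= eW z by rewrite lee_fin.
have mIeB : measurable_fun setT (fun w => \int[leb2]_(z in X2) eB w z).
  by apply: (eq_measurable_fun _ _ (measurable_error_B n)) => w _; rewrite -eBE.
have mBW : measurable_fun setT
    (fun p : E * ('rV[R]_m * 'rV[R]_m) => (B p.1 p.2.1 p.2.2)%:E * eW p.2).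
  apply: emeasurable_funM; first exact/measurable_EFinP.
  exact: (measurableT_comp meW measurable_snd).
have mIBW : measurable_fun setT
    (fun w => \int[leb2]_(z in X2) ((B w z.1 z.2)%:E * eW z)).
  pose f w (z : 'rV[R]_m * 'rV[R]_m) := (B w z.1 z.2)%:E * eW z.
  apply: (@measurable_fun_partial_integral _ _ _ _ _ leb2s _ f mX2 mBW).
  by move=> w z; rewrite mule_ge0 ?lee_fin.
have BW0 w z : 0 <= (B w z.1 z.2)%:E * eW z by rewrite mule_ge0 ?lee_fin.
rewrite eWE.
apply: (@le_trans _ _ (\int[LawB]_w (CW%:E * \int[leb2]_(z in X2) eB w z +
    \int[leb2]_(z in X2) ((B w z.1 z.2)%:E * eW z)))); last first.
  rewrite ge0_integralD//; last 3 first.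
  - by move=> w _; rewrite mule_ge0 ?lee_fin// integral_ge0.
  - exact: measurable_funeM.
  - by move=> w _; apply: integral_ge0 => z _.
  apply: leeD; last exact: mean_weighted_B.
  rewrite (_ : \int[LawB]_w (CW%:E * _) = CW%:E * mean_error_B n)//.
  rewrite (eq_integral (fun w => CW%:E * \int[leb2]_(z in X2) eB w z))//.
  rewrite ge0_integralZl//; last by move=> w _; apply: integral_ge0.
  by congr (_ * _); apply: eq_integral => w _; rewrite eBE.
have mk := measurable_kernel_error n.
have mIk : measurable_fun setT
    (fun w => \int[leb2]_(z in X2) (kernel_error n w z.1 z.2)%:E).
  pose f w (z : 'rV[R]_m * 'rV[R]_m) := (kernel_error n w z.1 z.2)%:E.
  have mf : measurable_fun setT (fun p : E * ('rV[R]_m * 'rV[R]_m) =>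
      (kernel_error n p.1 p.2.1 p.2.2)%:E) by exact/measurable_EFinP.
  apply: (@measurable_fun_partial_integral _ _ _ _ _ leb2s _ f mX2 mf).
  by move=> w z; rewrite lee_fin kernel_error_ge0.
apply: ge0_le_integral; [by []| |exact: mIk| |].
- by move=> w _; apply: integral_ge0 => z _; rewrite lee_fin kernel_error_ge0.
- by apply: emeasurable_funD => //; exact: measurable_funeM.
move=> w _.
have mBWw : measurable_fun setT (fun z => (B w z.1 z.2)%:E * eW z).
  exact: (measurableT_comp mBW (measurable_pair1 w)).
rewrite -ge0_integralZl//; last exact: measurable_funTS.
rewrite -ge0_integralD//; last 3 first.
- by move=> z _; rewrite mule_ge0 ?lee_fin.
- by apply: measurable_funTS; exact: measurable_funeM.
- exact: measurable_funTS.
apply: ge0_le_integral; [exact: mX2| | | |].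
- by move=> z _; rewrite lee_fin kernel_error_ge0.
- apply: measurable_funTS; apply/measurable_EFinP.
  exact: (measurableT_comp mk (measurable_pair1 w)).
- apply: measurable_funTS; apply: emeasurable_funD => //.
  exact: measurable_funeM.
move=> [x y] [/= Xx Xy]; rewrite /eB /eW /= -!EFinM -EFinD lee_fin /kernel_error.
have /andP[W0 W1] := W_average_bnd n Xx Xy.
rewrite (_ : (B_ n w x y * W_ n x y - B w x y * W x y =
  (B_ n w x y - B w x y) * W_ n x y + B w x y * (W_ n x y - W x y))%R); last by ring.
apply: (le_trans (ler_normD _ _)); rewrite !normrM.
rewrite (ger0_norm W0) (ger0_norm (B_ge0 _ _ _)) lerD2r mulrC.
by rewrite ler_wpM2r.
Qed.

End approximation.

(** * Comparison of the rates *)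

Section product_integrals.
Context {R : realType} d1 d2 (T1 : measurableType d1) (T2 : measurableType d2).
Variables (m1 : {sigma_finite_measure set T1 -> \bar R})
  (m2 : {sigma_finite_measure set T2 -> \bar R}).
Variables (A : set T1) (B : set T2) (f : T1 * T2 -> \bar R).
Hypotheses (mA : measurable A) (mB : measurable B)
  (mf : measurable_fun setT f) (f0 : forall z, (0 <= f z)%E).
Local Open Scope ereal_scope.

Let g z := f z * (\1_(A `*` B) z)%:E.

Let mg : measurable_fun setT g.
Proof.
apply: emeasurable_funM => //; apply/measurable_EFinP.
by apply: measurable_indic; exact: measurableX.
Qed.

Let g0 z : 0 <= g z. Proof. by rewrite mule_ge0 ?lee_fin. Qed.

Let gE x y : g (x, y) = f (x, y) * (\1_B y)%:E * (\1_A x)%:E.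
Proof. by rewrite /g !indicE in_setX /= -muleA -EFinM -natrM mulnb andbC. Qed.

Lemma ge0_integral_setX :
  \int[(m1 \x m2)%E]_(z in A `*` B) f z = \int[m1]_(x in A) \int[m2]_(y in B) f (x, y).
Proof.
rewrite [LHS]integral_mkcond.
rewrite (_ : \int[_]_z _ = \int[(m1 \x m2)%E]_z g z); last first.
  by apply: eq_integral => z _; rewrite patchE /g indicE; case: (_ \in _); rewrite ?mule1 ?mule0.
rewrite (fubini_tonelli1 _ mg g0) [RHS]integral_mkcond.
apply: eq_integral => x _; rewrite /fubini_F patchE.
rewrite (eq_integral (fun y => f (x, y) * (\1_B y)%:E * (\1_A x)%:E)); last by move=> y _; exact: gE.
rewrite indicE; case: (_ \in A); last first.
  by rewrite integral0_eq// => y _; rewrite mule0.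
rewrite [RHS]integral_mkcond; apply: eq_integral => y _.
by rewrite patchE indicE mule1; case: (_ \in B); rewrite ?mule1 ?mule0.
Qed.

Lemma ge0_integral_exchange :
  \int[m1]_(x in A) \int[m2]_(y in B) f (x, y) =
  \int[m2]_(y in B) \int[m1]_(x in A) f (x, y).
Proof.
have H2 : \int[m2]_(y in B) \int[m1]_(x in A) f (x, y) = \int[m2]_y \int[m1]_x g (x, y).
  rewrite integral_mkcond; apply: eq_integral => y _; rewrite patchE.
  rewrite [RHS](eq_integral (fun x => f (x, y) * (\1_B y)%:E * (\1_A x)%:E)); last by move=> x _; exact: gE.
  rewrite indicE; case: (_ \in B); last first.
    by rewrite integral0_eq// => x _; rewrite mule0 mul0e.
  rewrite [LHS]integral_mkcond; apply: eq_integral => x _.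
  by rewrite patchE indicE mule1; case: (_ \in A); rewrite ?mule1 ?mule0.
rewrite H2 -(fubini_tonelli2 _ mg g0) -ge0_integral_setX [LHS]integral_mkcond.
by apply: eq_integral => z _; rewrite patchE /g indicE; case: (_ \in _); rewrite ?mule1 ?mule0.
Qed.

End product_integrals.

(** * The intensity of the Poisson measure, truncated in level *)

Section point_measure.
Context {R : realType} {m : nat} {dE : measure_display} {E : measurableType dE}.
Variables (LawB : probability E R) (X : set 'rV[R]_m).
Hypotheses (mX : measurable X) (Xfin : (leb X < +oo)%E).
Local Notation point := (measurableTypeR R * 'rV[R]_m * E * measurableTypeR R)%type.
Local Open Scope ereal_scope.

Let tx : {sigma_finite_measure set (measurableTypeR R * 'rV[R]_m)%type -> \bar R} :=
  sigma_finite_product (@lebesgue_measure R) (@leb R m).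
Let txe : {sigma_finite_measure set (measurableTypeR R * 'rV[R]_m * E)%type -> \bar R} :=
  sigma_finite_product tx LawB.

Definition point_measure : {measure set point -> \bar R} :=
  (lebesgue_measure \x leb \x LawB \x lebesgue_measure)%E.

Definition window : set (measurableTypeR R * 'rV[R]_m) := `[0%R, 1%R]%classic `*` X.

Definition strip (M : nat) : set point := (window `*` setT) `*` `[0%R, M%:R]%classic.

Lemma measurable_window : measurable window.
Proof. exact: measurableX. Qed.

Lemma measurable_strip M : measurable (strip M).
Proof. by apply: measurableX => //; apply: measurableX => //; exact: measurable_window. Qed.

Lemma strip_domain M : strip M `<=` thinning_domain X.
Proof.
move=> [[[t x] w] r] /= [[[/= t01 Xx] _] r01]; move: t01 r01.
by rewrite !in_itv /= => t01 /andP[].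
Qed.

Lemma in_strip p : thinning_domain X p -> exists M0, forall M, (M0 <= M)%N -> strip M p.
Proof.
move: p => [[[t x] w] r] /= [/= t01 Xx r0].
exists (Num.truncn r).+1 => M rM; split => /=; last first.
  rewrite in_itv /= r0 /=; apply: ltW; apply: lt_le_trans (truncnS_gt r) _.
  by rewrite ler_nat.
by split => //; split.
Qed.

Lemma lebesgue_unit : lebesgue_measure (`[0%R, 1%R]%classic : set R) = 1 :> \bar R.
Proof. by rewrite lebesgue_measure_itv /= lte_fin ltr01 sube0. Qed.

Lemma lebesgue_levels (M : nat) :
  lebesgue_measure (`[0%R, M%:R]%classic : set R) = M%:R%:E :> \bar R.
Proof.
rewrite lebesgue_measure_itv /= lte_fin; case: ltP => [|]; first by rewrite sube0.
by rewrite lern0 => /eqP ->.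
Qed.

Lemma integral_strip M (g : E -> 'rV[R]_m -> \bar R) :
  measurable_fun setT (fun z : E * 'rV[R]_m => g z.1 z.2) ->
  (forall w y, 0 <= g w y) ->
  \int[point_measure]_(p in strip M) g p.1.2 p.1.1.2 =
  M%:R%:E * \int[LawB]_w \int[leb]_(y in X) g w y.
Proof.
move=> mg g0.
have mw := measurable_window.
have mg' : measurable_fun setT (fun p : R * 'rV[R]_m * E => g p.2 p.1.2).
  apply: (measurableT_comp mg (_ : measurable_fun setT (fun p : R * 'rV[R]_m * E => (p.2, p.1.2)))).
  by apply: measurable_fun_pair => //; exact: measurableT_comp.
have mgs (y : 'rV[R]_m) : measurable_fun setT (g ^~ y).
  exact: (measurableT_comp mg (measurable_pair2 y)).
have S1 := @ge0_integral_setX _ _ _ _ _ txe (@lebesgue_measure R) _ _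
  (fun p => g p.1.2 p.1.1.2) (measurableX mw (@measurableT _ E))
  (@measurable_itv R `[0%R, M%:R]) (measurableT_comp mg' measurable_fst)
  (fun _ => g0 _ _).
rewrite [LHS]S1 /=.
under eq_integral do rewrite integral_cst//= lebesgue_levels.
rewrite ge0_integralZr; last 4 first.
all: try by [exact: measurableX|exact: measurable_funTS|move=> *; exact: g0|rewrite lee_fin].
rewrite muleC; congr (_ * _).
have S2 := @ge0_integral_setX _ _ _ _ _ tx LawB _ _
  (fun p => g p.2 p.1.2) mw (@measurableT _ E) mg' (fun _ => g0 _ _).
rewrite [LHS]S2 /=.
have mh : measurable_fun setT (fun y => \int[LawB]_w g w y).
  apply: (@measurable_fun_fubini_tonelli_G _ _ _ _ _ LawB (fun z => g z.1 z.2) mg).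
  by move=> z; exact: g0.
have h0 y : 0 <= \int[LawB]_w g w y by apply: integral_ge0 => w _; exact: g0.
have S3 := @ge0_integral_setX _ _ _ _ _ (@lebesgue_measure R) (@leb R m) _ _
  (fun z : R * 'rV[R]_m => \int[LawB]_w g w z.2) (@measurable_itv R `[0%R, 1%R]) mX
  (measurableT_comp mh measurable_snd) (fun _ => h0 _).
rewrite [LHS]S3 /= integral_cst//= lebesgue_unit mule1.
exact: (@ge0_integral_exchange _ _ _ _ _ (@leb R m) LawB X setT
  (fun z => g z.2 z.1) mX measurableT (measurableT_comp mg (@measurable_swap _ _ _ _)) (fun _ => g0 _ _)).
Qed.

Lemma measure_strip M : point_measure (strip M) = M%:R%:E * leb X.
Proof.
have := @integral_strip M (fun _ _ => 1) (measurable_cst _) (fun _ _ => lee01).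
rewrite integral_cst ?mul1e; last exact: measurable_strip.
move=> ->; congr (_ * _).
rewrite (eq_integral (fun=> leb X)); last by move=> w _; rewrite integral_cst// mul1e.
by rewrite integral_cst// -[RHS]mule1; congr (_ * _); exact: probability_setT.
Qed.

Lemma measure_strip_lty M : point_measure (strip M) < +oo.
Proof. by rewrite measure_strip lte_mul_pinfty. Qed.

(** M times the volume of [X] bounds the mass of the strip per unit of time; it is the constant [c]
    given to [distinct_times]. *)
Lemma measure_strip_times M (t t' : R) : (t <= t')%R ->
  point_measure ([set p | t <= point_time p < t']%R `&` strip M) <=
  (M%:R * fine (leb X) * (t' - t))%:E.
Proof.
move=> tt'.
have mI : measurable (`[t, t'[%classic : set R) by exact: measurable_itv.
have mQ := measurableX (measurableX (measurableX mI mX) (@measurableT _ E))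
  (@measurable_itv R `[0%R, M%:R]).
apply: (@le_trans _ _ (point_measure (((`[t, t'[ `*` X) `*` setT) `*` `[0%R, M%:R]))).
  apply: le_measure; rewrite ?inE.
  - apply: measurableI; last exact: measurable_strip.
    rewrite (_ : [set p | _] = (fun p : point => p.1.1.1) @^-1` `[t, t'[%classic).
      rewrite -[X in measurable X]setTI; apply: measurableT_comp => //.
      by apply: measurableT_comp => //; exact: measurableT_comp.
    by apply/seteqP; split => p /=; rewrite in_itv.
  - exact: mQ.
  - by move=> p [/= tp [[[_ Xp] _] rp]]; split => //=; split => //; split => //=; rewrite in_itv.
have E1 := @product_measure1E _ _ _ _ R txe (@lebesgue_measure R) _ _
  (measurableX (measurableX mI mX) (@measurableT _ E)) (@measurable_itv R `[0%R, M%:R]).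
have E2 := @product_measure1E _ _ _ _ R tx LawB _ _ (measurableX mI mX) (@measurableT _ E).
have E3 := @product_measure1E _ _ _ _ R (@lebesgue_measure R) (@leb R m) _ _ mI mX.
have EQ : point_measure (((`[t, t'[ `*` X) `*` setT) `*` `[0%R, M%:R]) =
    lebesgue_measure (`[t, t'[%classic : set R) * leb X * M%:R%:E.
  apply: (etrans E1); congr (_ * _); last exact: lebesgue_levels.
  apply: (etrans E2); rewrite -[RHS]mule1.
  by congr (_ * _); [exact: E3|exact: probability_setT].
rewrite EQ lebesgue_measure_itv /= -[X in _ * X * _](@fineK _ (leb X)); last first.
  by rewrite ge0_fin_numE.
rewrite lte_fin; case: ltP => [_|_].
  rewrite -EFinB -!EFinM lee_fin le_eqVlt; apply/orP; left; apply/eqP; ring.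
rewrite !mul0e lee_fin mulr_ge0 ?subr_ge0//.
by rewrite mulr_ge0// fine_ge0.
Qed.

End point_measure.

Section point_measurability.
Context {R : realType} {m : nat} {dE : measure_display} {E : measurableType dE}.
Local Notation tx := (measurableTypeR R * 'rV[R]_m)%type.
Local Notation point := (tx * E * measurableTypeR R)%type.
Local Notation decreasing := (sorted (fun p q : point => point_time q < point_time p)).
Local Notation measurable_graphon W :=
  (measurable_fun setT (fun z : 'rV[R]_m * 'rV[R]_m => W z.1 z.2)).
Local Notation measurable_marks K :=
  (measurable_fun setT (fun p : E * ('rV[R]_m * 'rV[R]_m) => K p.1 p.2.1 p.2.2)).

Lemma measurable_point_time : measurable_fun setT (fun p : point => point_time p).
Proof. exact: (measurableT_comp measurable_fst (measurableT_comp measurable_fst measurable_fst)). Qed.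

Lemma measurable_decreasing n : measurable [set s : n.-tuple point | decreasing s].
Proof.
case: n => [|n].
  have -> : [set s : 0.-tuple point | decreasing s] = setT; last exact: measurableT.
  by apply/seteqP; split => // s _ /=; rewrite tuple0.
pose later (i : 'I_n) := [set s : n.+1.-tuple point |
  point_time (tnth s (lift ord0 i)) < point_time (tnth s (widen_ord (leqnSn n) i))].
have -> : [set s : n.+1.-tuple point | decreasing s] = \bigcap_(i in [set: 'I_n]) later i.
  apply/seteqP; split => s /=.
    move=> /(sortedP (thead s)) H i _; have := H i.
    by rewrite size_tuple ltnS ltn_ord /later /= !(tnth_nth (thead s)) /= => /(_ isT).
  move=> H; apply/(sortedP (thead s)) => i; rewrite size_tuple ltnS => ilt.
  by have := H (Ordinal ilt) I; rewrite /later /= !(tnth_nth (thead s)).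
apply: fin_bigcap_measurable; first exact: finite_finset.
move=> i _; rewrite -[X in measurable X]setTI.
apply: (measurable_fun_ltr _ _ measurableT (Y := [set true])) => //.
- exact: (measurableT_comp measurable_point_time (measurable_tnth _)).
- exact: (measurableT_comp measurable_point_time (measurable_tnth _)).
Qed.

Lemma measurable_sum_tuple n d (T : measurableType d) (f : T -> point -> R) :
  measurable_fun setT (fun z : T * point => f z.1 z.2) ->
  measurable_fun setT (fun z : T * n.-tuple point => \sum_(q <- z.2) f z.1 q).
Proof.
move=> mf.
apply: (eq_measurable_fun (fun z : T * n.-tuple point => \sum_(i < n) f z.1 (tnth z.2 i))).
  by move=> z _; rewrite big_tuple.
apply: measurable_sum => i.
apply: (measurableT_comp mf (_ : measurable_fun setT (fun z : T * n.-tuple point => (z.1, tnth z.2 i)))).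
apply: measurable_fun_pair => //.
exact: (measurableT_comp (measurable_tnth i) measurable_snd).
Qed.

Section rate.
Variables (lam : 'rV[R]_m -> R) (W : 'rV[R]_m -> 'rV[R]_m -> R)
  (K : E -> 'rV[R]_m -> 'rV[R]_m -> R) (h : R -> R).
Hypotheses (mlam : measurable_fun setT lam)
  (mW : measurable_graphon W)
  (mK : measurable_marks K)
  (mh : measurable_fun setT (h : measurableTypeR R -> R)).

Lemma measurable_excitation : measurable_fun setT
  (fun z : tx * point => excitation W K h z.1.1 z.1.2 z.2).
Proof.
have mt : measurable_fun setT (fun z : tx * point => z.1.1).
  exact: (measurableT_comp measurable_fst measurable_fst).
have mx : measurable_fun setT (fun z : tx * point => z.1.2).
  exact: (measurableT_comp measurable_snd measurable_fst).
have mtau : measurable_fun setT (fun z : tx * point => point_time z.2).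
  exact: (measurableT_comp measurable_point_time measurable_snd).
have my : measurable_fun setT (fun z : tx * point => z.2.1.1.2).
  exact: (measurableT_comp measurable_snd (measurableT_comp measurable_fst (measurableT_comp measurable_fst measurable_snd))).
have mw : measurable_fun setT (fun z : tx * point => z.2.1.2).
  exact: (measurableT_comp measurable_snd (measurableT_comp measurable_fst measurable_snd)).
have mxy : measurable_fun setT (fun z : tx * point => (z.1.2, z.2.1.1.2)).
  exact: measurable_fun_pair.
apply: measurable_fun_ifT => //; first exact: measurable_fun_ltr.
apply: measurable_funM; first apply: measurable_funM.
- exact: (measurableT_comp mK (measurable_fun_pair mw mxy)).
- exact: (measurableT_comp mW mxy).
- apply: (measurableT_comp mh (_ : measurable_fun setT (fun z : tx * point => z.1.1 - point_time z.2))).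
  exact: measurable_funB.
Qed.

Lemma measurable_rate n : measurable_fun setT
  (fun z : tx * n.-tuple point => rate lam W K h z.2 z.1.1 z.1.2).
Proof.
apply: measurable_funD.
  exact: (measurableT_comp mlam (measurableT_comp measurable_snd measurable_fst)).
exact: (@measurable_sum_tuple n _ tx (fun z q => excitation W K h z.1 z.2 q)
  measurable_excitation).
Qed.

Lemma measurable_accepted n : measurable_fun setT
  (fun z : point * n.-tuple point => accepted lam W K h z.2 z.1).
Proof.
apply: measurable_fun_ler; first exact: (measurableT_comp measurable_snd measurable_fst).
have mp : measurable_fun setT (fun z : point * n.-tuple point => (z.1.1.1, z.2)).
  apply: measurable_fun_pair => //.
  exact: (measurableT_comp measurable_fst (measurableT_comp measurable_fst measurable_fst)).
have H := measurableT_comp (@measurable_rate n) mp.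
exact: H.
Qed.

Lemma measurable_rate_at (s : seq point) :
  measurable_fun setT (fun z : tx => rate lam W K h s z.1 z.2).
Proof. exact: (measurableT_comp (@measurable_rate _) (measurable_pair2 (in_tuple s))). Qed.

Lemma measurable_accepted_at (s : seq point) :
  measurable_fun setT (fun p : point => accepted lam W K h s p).
Proof. exact: (measurableT_comp (@measurable_accepted _) (measurable_pair2 (in_tuple s))). Qed.

End rate.
End point_measurability.

Section rate_comparison.
Context {R : realType} {m : nat} {dE : measure_display} {E : measurableType dE}.
Local Notation tx := (measurableTypeR R * 'rV[R]_m)%type.
Local Notation point := (tx * E * measurableTypeR R)%type.
Local Notation decreasing := (sorted (fun p q : point => point_time q < point_time p)).
Local Notation measurable_graphon W :=
  (measurable_fun setT (fun z : 'rV[R]_m * 'rV[R]_m => W z.1 z.2)).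
Local Notation measurable_marks K :=
  (measurable_fun setT (fun p : E * ('rV[R]_m * 'rV[R]_m) => K p.1 p.2.1 p.2.2)).
Variables (LawB : probability E R) (X : set 'rV[R]_m).
Hypotheses (mX : measurable X) (Xfin : (leb X < +oo)%E).
Variables (lam1 lam2 : 'rV[R]_m -> R) (W1 W2 : 'rV[R]_m -> 'rV[R]_m -> R)
  (K1 K2 : E -> 'rV[R]_m -> 'rV[R]_m -> R) (h : R -> R).
Hypotheses (mlam1 : measurable_fun setT lam1) (mlam2 : measurable_fun setT lam2)
  (mW1 : measurable_graphon W1)
  (mW2 : measurable_graphon W2)
  (mK1 : measurable_marks K1)
  (mK2 : measurable_marks K2)
  (mh : measurable_fun setT (h : measurableTypeR R -> R))
  (h_ge0 : forall t, 0 <= h t)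
  (h_int : lebesgue_measure.-integrable setT (EFin \o h)).
Local Notation rate1 := (rate lam1 W1 K1 h).
Local Notation rate2 := (rate lam2 W2 K2 h).
Local Open Scope ereal_scope.

Let mtx : {sigma_finite_measure set tx -> \bar R} :=
  sigma_finite_product (@lebesgue_measure R) (@leb R m).

Definition h_mass : R := fine (\int[lebesgue_measure]_t (h t)%:E).

Let h_massE : \int[lebesgue_measure]_t (h t)%:E = h_mass%:E.
Proof. by rewrite /h_mass fineK//; exact: integrable_fin_num. Qed.

Lemma h_mass_ge0 : (0 <= h_mass)%R.
Proof. by apply: fine_ge0; apply: integral_ge0 => t _; rewrite lee_fin. Qed.

Definition kernel_gap w x y : R := `|K1 w x y * W1 x y - K2 w x y * W2 x y|%R.

Lemma measurable_kernel_gap : measurable_marks kernel_gap.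
Proof.
apply: measurableT_comp => //; apply: measurable_funB; apply: measurable_funM => //.
- exact: (measurableT_comp mW1 measurable_snd).
- exact: (measurableT_comp mW2 measurable_snd).
Qed.

Let measurable_kernel_gap_section w y : measurable_fun setT (fun x => kernel_gap w x y).
Proof.
apply: (measurableT_comp measurable_kernel_gap
  (_ : measurable_fun setT (fun x : 'rV[R]_m => (w, (x, y))))).
by apply: measurable_fun_pair => //; apply: measurable_fun_pair.
Qed.

Let exc_gap (z : tx) (q : point) :=
  (`|excitation W1 K1 h z.1 z.2 q - excitation W2 K2 h z.1 z.2 q|%R)%:E.

Let measurable_exc_gap : measurable_fun setT (fun z : tx * point => exc_gap z.1 z.2).
Proof.
apply/measurable_EFinP; apply: measurableT_comp => //.
by apply: measurable_funB; exact: measurable_excitation.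
Qed.

(** Time and space separate. By translation invariance the time factor, h shifted to start at the
    time of [q], integrates over [0,1] to at most the total mass of h, wherever [q] sits. *)
Lemma excitation_gap q :
  \int[mtx]_(z in window X) exc_gap z q <=
  h_mass%:E * \int[leb]_(x in X) (kernel_gap q.1.2 x q.1.1.2)%:E.
Proof.
pose f (z : tx) := (h (z.1 - point_time q) * kernel_gap q.1.2 z.2 q.1.1.2)%:E.
have mhq : measurable_fun setT (fun t : measurableTypeR R => (h (t - point_time q))%:E).
  apply/measurable_EFinP; apply: (measurableT_comp mh (_ : measurable_fun setT
    (fun t : measurableTypeR R => t - point_time q)%R)).
  exact: measurable_funB.
have mk : measurable_fun setT (fun x => (kernel_gap q.1.2 x q.1.1.2)%:E).
  exact/measurable_EFinP.
have k0 x : 0 <= (kernel_gap q.1.2 x q.1.1.2)%:E by rewrite lee_fin normr_ge0.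
have mf : measurable_fun setT f.
  rewrite /f; apply: (eq_measurable_fun (fun z : tx =>
      (h (z.1 - point_time q))%:E * (kernel_gap q.1.2 z.2 q.1.1.2)%:E)) => //.
  apply: emeasurable_funM; first exact: (measurableT_comp mhq measurable_fst).
  exact: (measurableT_comp mk measurable_snd).
have f0 z : 0 <= f z by rewrite lee_fin mulr_ge0// normr_ge0.
apply: (@le_trans _ _ (\int[mtx]_(z in window X) f z)).
  apply: ge0_le_integral; [exact: measurable_window| | | |].
  - by move=> z _; rewrite lee_fin normr_ge0.
  - by apply: measurable_funTS; exact: (measurableT_comp measurable_exc_gap (measurable_pair2 q)).
  - exact: measurable_funTS.
  move=> z _; rewrite lee_fin /excitation /kernel_gap; case: ifP => _; last first.
    by rewrite subrr normr0 mulr_ge0// normr_ge0.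
  by rewrite -mulrBl normrM mulrC (ger0_norm (h_ge0 _)).
have S := @ge0_integral_setX _ _ _ _ _ (@lebesgue_measure R) (@leb R m) _ _ f
  (@measurable_itv R `[0%R, 1%R]) mX mf f0.
rewrite [leLHS]S.
have I0 : 0 <= \int[leb]_(x in X) (kernel_gap q.1.2 x q.1.1.2)%:E by exact: integral_ge0.
rewrite (eq_integral (fun t : measurableTypeR R => (h (t - point_time q))%:E *
    \int[leb]_(x in X) (kernel_gap q.1.2 x q.1.1.2)%:E)); last first.
  by move=> t _; rewrite -ge0_integralZl ?lee_fin//; exact: measurable_funTS.
rewrite ge0_integralZr//; last 2 first.
all: try by [exact: measurable_funTS|move=> *; rewrite lee_fin].
apply: lee_wpmul2r => //; rewrite -h_massE.
have mhT : measurable_fun setT (EFin \o h).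
  by apply/measurable_EFinP.
rewrite -(ge0_integral_shift (- point_time q) mhT); last by move=> t; rewrite lee_fin.
by apply: ge0_subset_integral => // t _; rewrite lee_fin.
Qed.

Lemma rate_gap (s : seq point) :
  \int[mtx]_(z in window X) (`|rate1 s z.1 z.2 - rate2 s z.1 z.2|)%:E <=
  \int[leb]_(x in X) (`|lam1 x - lam2 x|)%:E +
  \sum_(q <- s) h_mass%:E * \int[leb]_(x in X) (kernel_gap q.1.2 x q.1.1.2)%:E.
Proof.
have mw := measurable_window mX.
have ml : measurable_fun setT (fun x => (`|lam1 x - lam2 x|)%:E).
  by apply/measurable_EFinP; apply: measurableT_comp => //; exact: measurable_funB.
have mlw : measurable_fun setT (fun z : tx => (`|lam1 z.2 - lam2 z.2|)%:E).
  exact: (measurableT_comp ml measurable_snd).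
have me q : measurable_fun setT (fun z => exc_gap z q).
  exact: (measurableT_comp measurable_exc_gap (measurable_pair2 q)).
apply: (@le_trans _ _ (\int[mtx]_(z in window X)
    ((`|lam1 z.2 - lam2 z.2|)%:E + \sum_(q <- s) exc_gap z q))).
  apply: ge0_le_integral; [exact: mw| | | |].
  - by move=> z _; rewrite lee_fin.
  - apply: measurable_funTS; apply/measurable_EFinP; apply: measurableT_comp => //.
    by apply: measurable_funB; exact: measurable_rate_at.
  - apply: measurable_funTS; apply: emeasurable_funD => //.
    exact: emeasurable_sum.
  move=> z _; rewrite /exc_gap sumEFin -EFinD lee_fin /rate opprD addrACA -sumrB.
  by apply: (le_trans (ler_normD _ _)); rewrite lerD2l; exact: ler_norm_sum.
rewrite ge0_integralD//; last 3 first.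
- exact: measurable_funTS.
- by move=> z _; apply: sume_ge0 => q _; rewrite lee_fin.
- by apply: measurable_funTS; exact: emeasurable_sum.
apply: leeD.
  have S := @ge0_integral_setX _ _ _ _ _ (@lebesgue_measure R) (@leb R m) _ _
    (fun z : tx => (`|lam1 z.2 - lam2 z.2|)%:E) (@measurable_itv R `[0%R, 1%R]) mX mlw
    (fun z => (normr_ge0 _ : 0 <= _%:E)).
  by rewrite [leLHS]S /= integral_cst//= lebesgue_unit mule1.
rewrite ge0_integral_sum//; last 2 first.
- by move=> q; exact: measurable_funTS.
- by move=> q z _; rewrite lee_fin.
by apply: lee_sum => q _; exact: excitation_gap.
Qed.

Lemma integral_square (f : 'rV[R]_m * 'rV[R]_m -> \bar R) :
  measurable_fun setT f -> (forall z, 0 <= f z) ->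
  \int[leb]_(y in X) \int[leb]_(x in X) f (x, y) = \int[(leb \x leb)%E]_(z in X `*` X) f z.
Proof.
move=> mf f0; rewrite (ge0_integral_setX _ _ mX mX mf f0).
by rewrite (ge0_integral_exchange _ _ mX mX mf f0).
Qed.

Definition strip_measure M : {finite_measure set point -> \bar R} :=
  mfrestr (measurable_strip mX M) (measure_strip_lty LawB mX Xfin M).

Definition strip_mass M : R := M%:R * fine (leb X).

Lemma strip_measureE M Z : strip_measure M Z = point_measure LawB (Z `&` strip X M).
Proof. by []. Qed.

Lemma strip_measureT M : strip_measure M setT = (strip_mass M)%:E.
Proof.
rewrite strip_measureE setTI measure_strip// /strip_mass EFinM fineK//.
by rewrite ge0_fin_numE.
Qed.

Lemma strip_mass_ge0 M : (0 <= strip_mass M)%R.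
Proof. by rewrite mulr_ge0// fine_ge0. Qed.

Section sums_over_tuples.
Variable g : E -> 'rV[R]_m -> \bar R.
Hypotheses (mg : measurable_fun setT (fun z : E * 'rV[R]_m => g z.1 z.2))
  (g0 : forall w y, 0 <= g w y).

Let mg' : measurable_fun setT (fun p : point => g p.1.2 p.1.1.2).
Proof.
have mp : measurable_fun setT (fun p : point => (p.1.2, p.1.1.2)).
  apply: measurable_fun_pair; first exact: (measurableT_comp measurable_snd measurable_fst).
  exact: (measurableT_comp measurable_snd (measurableT_comp measurable_fst measurable_fst)).
exact: (measurableT_comp mg mp).
Qed.

Lemma measurable_tuple_sum n : measurable_fun setT
  (fun s : n.-tuple point => \sum_(q <- s) g q.1.2 q.1.1.2).
Proof.
apply: (eq_measurable_fun (fun s : n.-tuple point =>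
    \sum_(i < n) g (tnth s i).1.2 (tnth s i).1.1.2)).
  by move=> s _; rewrite big_tuple.
by apply: emeasurable_sum => i; exact: (measurableT_comp mg' (measurable_tnth i)).
Qed.

Lemma integral_tuple_strip M n :
  \int[tuple_measure (strip_measure M) n]_s (\sum_(q <- s) g q.1.2 q.1.1.2) =
  (n%:R * (strip_mass M ^+ n.-1 * M%:R))%:E * \int[LawB]_w \int[leb]_(y in X) g w y.
Proof.
rewrite (integral_tuple_measure_sum (strip_measure M) n mg'); last by move=> p; exact: g0.
rewrite strip_measureT (ge0_integral_mrestr (point_measure LawB) (measurable_strip mX M) mg'); last first.
  by move=> p; exact: g0.
by rewrite integral_strip// -EFin_expe !EFinM -!muleA.
Qed.

(** Markov's inequality for the power measure. Decreasing times are part of [Z] so that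
    [campbell_decreasing] can transfer the bound to [Psi]. *)
Lemma tuple_markov M n (delta : R) : (0 < delta)%R ->
  let Z := [set s : n.-tuple point |
    decreasing s /\ delta%:E < \sum_(q <- s) g q.1.2 q.1.1.2] in
  measurable Z /\ tuple_measure (strip_measure M) n Z <=
  (delta^-1 * (n%:R * (strip_mass M ^+ n.-1 * M%:R)))%:E *
    \int[LawB]_w \int[leb]_(y in X) g w y.
Proof.
move=> d0 Z; have ms := @measurable_tuple_sum n.
have mZ : measurable Z.
  apply: measurableI; first exact: measurable_decreasing.
  rewrite -[X in measurable X]setTI; exact: emeasurable_fun_o_infty.
split => //; rewrite EFinM -muleA -integral_tuple_strip.
have di0 : 0 <= delta^-1%:E by rewrite lee_fin invr_ge0 ltW.
rewrite -ge0_integralZl//; last by move=> s _; apply: sume_ge0 => q _.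
rewrite -[leLHS]mul1e -[X in X * _]/(1%R%:E) -integral_cst// integral_mkcond.
apply: ge0_le_integral; [by []| | | |].
- by move=> s _; rewrite patchE; case: ifP.
- by apply/(measurable_restrictT _ mZ); exact: measurable_cst.
- exact: measurable_funeM.
move=> s _; have S0 : 0 <= \sum_(q <- s) g q.1.2 q.1.1.2 by exact: sume_ge0.
rewrite patchE; case: ifPn => [/set_mem[_ /ltW ds]|_].
  rewrite -(lee_pmul2l (_ : delta%:E \is a fin_num)) ?lte_fin// mule1 muleA -EFinM.
  by rewrite divff ?gt_eqF// mul1e.
by rewrite mule_ge0.
Qed.

End sums_over_tuples.

Local Notation accepted1 := (accepted lam1 W1 K1 h).
Local Notation accepted2 := (accepted lam2 W2 K2 h).

(** The tail is a history and the head a point that the two rules treat differently given this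
    history. The head is only placed in the window of times and locations: its level compares with
    an intensity, which has no bound known in advance. *)
Definition disagreement M n : set (n.+1.-tuple point) :=
  [set s : n.+1.-tuple point | [/\ decreasing s, forall q, q \in behead s -> strip X M q,
    window X (thead s).1.1 &
    accepted1 (behead s) (thead s) != accepted2 (behead s) (thead s)]].

Arguments disagreement : clear implicits.

Lemma measurable_xor d (T : measurableType d) (f f' : T -> bool) :
  measurable_fun setT f -> measurable_fun setT f' -> measurable [set x | f x != f' x].
Proof.
move=> mf mf'.
have mt b (u : T -> bool) : measurable_fun setT u -> measurable (u @^-1` [set b]).
  by move=> mu; rewrite -[X in measurable X]setTI; exact: mu.
rewrite (_ : mkset _ = (f @^-1` [set true] `&` f' @^-1` [set false]) `|`
    (f @^-1` [set false] `&` f' @^-1` [set true])).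
  by apply: measurableU; apply: measurableI; exact: mt.
by apply/seteqP; split => x /=; case: (f x); case: (f' x) => //=; intuition.
Qed.

Lemma measurable_disagreement M n : measurable (disagreement M n).
Proof.
have mth : measurable_fun setT (fun s : n.+1.-tuple point => thead s).
  exact: measurable_tnth.
have mbe : measurable_fun setT (fun s : n.+1.-tuple point => [tuple of behead s]).
  exact: measurable_behead.
have mpair : measurable_fun setT
    (fun s : n.+1.-tuple point => (thead s, [tuple of behead s])).
  exact: measurable_fun_pair.
have ma lam W K : measurable_fun setT lam ->
    measurable_graphon W ->
    measurable_marks K ->
    measurable_fun setT (fun s : n.+1.-tuple point =>
      accepted lam W K h (behead s) (thead s)).
  move=> ml mW mK; have H := @measurable_accepted _ _ _ _ _ _ _ _ ml mW mK mh n.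
  exact: (measurableT_comp H mpair).
rewrite (_ : disagreement M n = [set s : n.+1.-tuple point | decreasing s] `&`
   (fun s : n.+1.-tuple point => [tuple of behead s]) @^-1` tuples_in (strip X M) (n:=n) `&`
   (fun s : n.+1.-tuple point => (thead s).1.1) @^-1` window X `&`
   [set s : n.+1.-tuple point |
     accepted1 (behead s) (thead s) != accepted2 (behead s) (thead s)]).
  apply: measurableI; last by apply: measurable_xor; exact: ma.
  apply: measurableI; last first.
    rewrite -[X in measurable X]setTI.
    have H := measurableT_comp (measurableT_comp measurable_fst measurable_fst) mth.
    by apply: H => //; exact: measurable_window.
  apply: measurableI; first exact: measurable_decreasing.
  rewrite -[X in measurable X]setTI; apply: mbe => //.
  by apply: measurable_tuples_in; exact: measurable_strip.
apply/seteqP; split => s /=; first by case.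
by move=> [[[? ?] ?] ?].
Qed.

(** For a fixed tail the head lies between the two rates, so [measure_between] and [rate_gap] bound
    its section by the baseline error plus one kernel error per point of the tail. Integrating over
    tails in the strip of level [M] gives a bound free of [M']. *)
Lemma tuple_disagreement_le M M' n : (M <= M')%N ->
  tuple_measure (strip_measure M') n.+1 (disagreement M n) <=
  (strip_mass M ^+ n)%:E * \int[leb]_(x in X) (`|lam1 x - lam2 x|)%:E +
  (n%:R * (strip_mass M ^+ n.-1 * M%:R) * h_mass)%:E *
    \int[LawB]_w \int[(leb \x leb)%E]_(z in X `*` X) (kernel_gap w z.1 z.2)%:E.
Proof.
move=> MM'.
have sub : (strip X M : set point) `<=` strip X M'.
  move=> p [? rM]; split => //; move: rM; rewrite /= !in_itv /= => /andP[-> rM] /=.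
  by apply: le_trans rM _; rewrite ler_nat.
have muE Z : measurable Z ->
    strip_measure M Z = strip_measure M' (Z `&` strip X M).
  by move=> mZ; rewrite !strip_measureE -setIA (setIidl sub).
rewrite (@tuple_measure_tail _ _ _ (strip_measure M') (strip_measure M) (strip X M)
  (measurable_strip mX M) muE _ _ (@measurable_disagreement M n)); last by move=> s [].
set eL := \int[leb]_(x in X) _.
pose k w y := h_mass%:E * \int[leb]_(x in X) (kernel_gap w x y)%:E.
have k0 w y : 0 <= k w y.
  rewrite mule_ge0 ?lee_fin ?h_mass_ge0//.
  by apply: integral_ge0 => x _; rewrite lee_fin normr_ge0.
have mkg w : measurable_fun setT
    (fun z : 'rV[R]_m * 'rV[R]_m => (kernel_gap w z.1 z.2)%:E).
  apply/measurable_EFinP.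
  exact: (measurableT_comp measurable_kernel_gap (measurable_pair1 w)).
have mkI : measurable_fun setT (fun z : E * 'rV[R]_m =>
    \int[leb]_(x in X) (kernel_gap z.1 x z.2)%:E).
  pose f (z : E * 'rV[R]_m) x := (kernel_gap z.1 x z.2)%:E.
  apply: (@measurable_fun_partial_integral _ _ _ _ _ (@leb R m) X f mX); last first.
    by move=> z x; rewrite lee_fin normr_ge0.
  have mp : measurable_fun setT (fun p : E * 'rV[R]_m * 'rV[R]_m => (p.1.1, (p.2, p.1.2))).
    apply: measurable_fun_pair; first exact: (measurableT_comp measurable_fst measurable_fst).
    apply: measurable_fun_pair => //.
    exact: (measurableT_comp measurable_snd measurable_fst).
  have H := measurableT_comp measurable_kernel_gap mp.
  exact/measurable_EFinP.
have mk : measurable_fun setT (fun z : E * 'rV[R]_m => k z.1 z.2) by exact: measurable_funeM.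
have eL0 : 0 <= eL by apply: integral_ge0 => x _; rewrite lee_fin.
have mS := @measurable_tuple_sum k mk n.
apply: (@le_trans _ _ (\int[tuple_measure (strip_measure M) n]_s
    (eL + \sum_(q <- s) k q.1.2 q.1.1.2))); last first.
  rewrite ge0_integralD//; last by move=> s _; exact: sume_ge0.
  rewrite integral_tuple_strip//; apply: leeD.
    rewrite integral_cst// muleC le_eqVlt; apply/orP; left; apply/eqP.
    congr (_ * _); rewrite EFin_expe -strip_measureT.
    exact: tuple_measure_setT.
  rewrite [in leRHS]EFinM -muleA; apply: lee_wpmul2l.
    by rewrite lee_fin !mulr_ge0// exprn_ge0// strip_mass_ge0.
  rewrite (eq_integral (fun w => h_mass%:E *
    \int[(leb \x leb)%E]_(z in X `*` X) (kernel_gap w z.1 z.2)%:E)); last first.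
    move=> w _; rewrite -(integral_square (mkg w)); last first.
      by move=> z; rewrite lee_fin normr_ge0.
    rewrite ge0_integralZl ?lee_fin ?h_mass_ge0//.
    - by apply: measurable_funTS; exact: (measurableT_comp mkI (measurable_pair1 w)).
    - by move=> y _; apply: integral_ge0 => x _; rewrite lee_fin normr_ge0.
  rewrite ge0_integralZl ?lee_fin ?h_mass_ge0//; last first.
    by move=> w _; apply: integral_ge0 => x _; rewrite lee_fin normr_ge0.
  apply: (eq_measurable_fun (fun w => \int[leb]_(y in X) \int[leb]_(x in X) (kernel_gap w x y)%:E)).
    move=> w _; rewrite -(integral_square (mkg w))//.
    by move=> z; rewrite lee_fin normr_ge0.
  pose f w y := \int[leb]_(x in X) (kernel_gap w x y)%:E.
  apply: (@measurable_fun_partial_integral _ _ _ _ _ (@leb R m) X f mX mkI).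
  by move=> w y; apply: integral_ge0 => x _; rewrite lee_fin normr_ge0.
have mU : measurable (@cons_tup _ point n @^-1` disagreement M n).
  rewrite -[X in measurable X]setTI.
  by apply: measurable_cons_tup => //; exact: measurable_disagreement.
have yE s : ysection (@cons_tup _ point n @^-1` disagreement M n) s =
    [set p | disagreement M n (cons_tup (p, s))].
  by apply/seteqP; split => p; rewrite /ysection /= inE.
apply: ge0_le_integral; [by []|by move=> s _| | |].
- have H := measurable_fun_ysection (strip_measure M') mU.
  by apply: (eq_measurable_fun _ _ H) => s _; rewrite /= yE.
- exact: emeasurable_funD.
move=> s _.
have B := @measure_between _ _ _ _ _ mtx LawB (window X)
  (fun z => rate1 s z.1 z.2) (fun z => rate2 s z.1 z.2)
  (measurable_window mX)
  (measurable_rate_at mlam1 mW1 mK1 mh s) (measurable_rate_at mlam2 mW2 mK2 mh s).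
apply: (le_trans _ (rate_gap s)); apply: (le_trans _ B).
rewrite strip_measureE; apply: le_measure; rewrite ?inE.
- apply: measurableI; last exact: measurable_strip.
  by rewrite -yE; exact: measurable_ysection.
- apply: measurableI.
    rewrite -[X in measurable X]setTI.
    have H := measurableT_comp measurable_fst (@measurable_fst _ _ (tx * E)%type (measurableTypeR R)).
    by apply: H => //; exact: measurable_window.
  by apply: measurable_xor; exact: measurable_accepted_at.
by move=> p [[_ _ wp acc] _]; split.
Qed.

End rate_comparison.

(** * The event of agreement *)

Section solution_points.
Context {R : realType} {m : nat} {dE : measure_display} {E : measurableType dE}.
Local Notation event := (R * 'rV[R]_m * E)%type.
Local Notation point := (R * 'rV[R]_m * E * R)%type.
Local Notation decreasing := (sorted (fun p q : point => point_time q < point_time p)).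
Implicit Types (s : seq point) (Pi : set point).

Lemma later_trans : transitive (fun p q : point => point_time q < point_time p).
Proof. by move=> q p r /= qp rq; exact: lt_trans rq qp. Qed.

Lemma decreasing_uniq_times s : decreasing s -> uniq (map point_time s).
Proof.
move=> sd; apply: (@sorted_uniq _ (fun t t' : R => t' < t)).
- by move=> y x z /= yx zy; exact: lt_trans zy yx.
- by move=> x /=; rewrite ltxx.
- by rewrite sorted_map.
Qed.

Lemma decreasing_uniq s : decreasing s -> uniq (map fst s).
Proof.
move=> sd; apply: (@map_uniq _ _ (fun e : event => e.1.1)); rewrite -map_comp.
exact: decreasing_uniq_times.
Qed.

(* Points are compared through their times: the diagonal of [E] need not be
   measurable. *)
Definition mismatch (lam : 'rV[R]_m -> R) W (K : E -> 'rV[R]_m -> 'rV[R]_m -> R) h s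
    (p : point) : bool :=
  has (fun q => point_time q == point_time p) s != accepted lam W K h s p.

Section one_equation.
Variables (lam : 'rV[R]_m -> R) (W : 'rV[R]_m -> 'rV[R]_m -> R)
  (K : E -> 'rV[R]_m -> 'rV[R]_m -> R) (h : R -> R).
Hypothesis excitation_ge0 : forall t x q, 0 <= excitation W K h t x q.
Variable Pi : set point.
Hypothesis simple : forall p q, Pi p -> Pi q -> point_time p = point_time q -> p = q.

(** Lifts a solution from events to points of [Pi]. By simplicity exactly one point lies over each
    event, so finiteness is inherited, and the times are distinct, so the points can be listed with
    decreasing times. *)
Lemma solution_points (H : set event) :
  finite_set H -> H = thinned lam W K h Pi H ->
  exists s, [/\ decreasing s, forall q, q \in s -> Pi q &
    forall p, Pi p -> ~~ mismatch lam W K h s p].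
Proof.
move=> fH HE; pose A := [set p | Pi p /\ H p.1].
have fA : finite_set A.
  (* [xget] picks a level over the event; simplicity makes it the only one, and the default 0 is
     never reached over an event of [A]. *)
  apply: (sub_finite_set _ (finite_image (fun e => (e, xget 0 [set r | Pi (e, r)])) fH)).
  move=> [e r] [Pp He]; exists e => //; congr pair.
  have Pe : Pi (e, xget 0 [set r | Pi (e, r)]) by apply: (xgetI 0 (Pp : [set r | Pi (e, r)] r)).
  by have [] := simple Pe Pp erefl.
have inj p q : A p -> A q -> point_time p = point_time q -> p = q.
  by move=> [Pp _] [Pq _]; exact: simple.
have [s sd AE] := decreasing_enum fA inj.
have sA p : p \in s <-> A p by rewrite AE.
have HS : H = [set` map fst s].
  apply/seteqP; split => e /=.
    move=> He; have := He; rewrite {1}HE => -[r Pr _].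
    by apply/mapP; exists (e, r) => //; apply/sA.
  by move=> /mapP[p /sA[_ Hp] ->].
exists s; split=> // [q /sA[]//|p Pp].
have TE := thinned_rate lam excitation_ge0 Pi (decreasing_uniq sd).
rewrite /mismatch negbK; apply/eqP; apply/idP/idP.
  move=> /hasP[q qs /eqP qp]; have [Pq Hq] := (sA q).1 qs.
  have {}qp : q = p by exact: simple.
  move: Hq; rewrite qp HE HS TE => -[q' [Pq' aq'] q'p].
  by rewrite -(simple Pq' Pp _)// /point_time q'p.
move=> ap; apply/hasP; exists p => //; apply/sA; split => //.
by rewrite HE HS TE; exists p.
Qed.

(** Converse of [solution_points], by uniqueness. It lets the event [explained], which is defined
    from [Psi] alone, determine the process. *)
Lemma solution_from_points s (H : set event) :
  decreasing s -> (forall q, q \in s -> Pi q) ->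
  (forall p, Pi p -> ~~ mismatch lam W K h s p) ->
  finite_set H -> H = thinned lam W K h Pi H ->
  H = [set` map fst s].
Proof.
move=> sd sPi sm fH HE.
apply: (thinned_unique fH _ HE); first exact: finite_seq.
rewrite thinned_rate//; last exact: decreasing_uniq.
apply/seteqP; split => e /=.
  move=> /mapP[p ps ->]; exists p => //; split; first exact: sPi.
  have := sm _ (sPi _ ps); rewrite /mismatch negbK => /eqP <-.
  by apply/hasP; exists p.
move=> [p [Pp ap] <-]; have := sm _ Pp; rewrite /mismatch negbK ap => /eqP.
move=> /hasP[q qs /eqP qp].
by rewrite -(simple (sPi _ qs) Pp qp); apply/mapP; exists q.
Qed.

End one_equation.

(** If the two rules agreed on all points of [Pi] given the history [s], then [s] would solve the
    second equation as well and uniqueness would force equality. At a point p of disagreement only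
    the part [s'] of [s] before p matters, and dropping the rest makes p followed by [s']
    decreasing. *)
Lemma solutions_differ lam1 W1 (K1 : E -> 'rV[R]_m -> 'rV[R]_m -> R)
    lam2 W2 (K2 : E -> 'rV[R]_m -> 'rV[R]_m -> R) h Pi s (H' : set event) :
  (forall t x q, 0 <= excitation W1 K1 h t x q) ->
  (forall t x q, 0 <= excitation W2 K2 h t x q) ->
  decreasing s -> (forall q, q \in s -> Pi q) ->
  [set` map fst s] = thinned lam1 W1 K1 h Pi [set` map fst s] ->
  finite_set H' -> H' = thinned lam2 W2 K2 h Pi H' -> H' <> [set` map fst s] ->
  exists p s', [/\ Pi p, {subset s' <= s}, (size s' <= size s)%N,
    decreasing (p :: s') & accepted lam2 W2 K2 h s' p != accepted lam1 W1 K1 h s' p].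
Proof.
move=> e1 e2 sd sPi sE fH' H'E neq; apply: contrapT => noex; apply: neq.
apply: (thinned_unique fH' _ H'E); first exact: finite_seq.
apply: (thinned_stable e1 e2 (decreasing_uniq sd) sE) => p Pp.
apply/eqP/negPn/negP => acc; apply: noex.
exists p, [seq q <- s | point_time q < point_time p]; split => //.
- by move=> q; rewrite mem_filter => /andP[].
- by rewrite size_filter count_size.
- rewrite /= (path_sortedE later_trans) filter_all/=.
  exact: (sorted_filter later_trans).
- by rewrite /accepted !rate_past eq_sym.
Qed.

End solution_points.

Lemma uniq_map_eq (T T' : eqType) (f : T -> T') (s : seq T) p q :
  uniq (map f s) -> p \in s -> q \in s -> f p = f q -> p = q.
Proof.
elim: s => //= x s ih /andP[fx us]; rewrite !inE.
move=> /predU1P[->|ps] /predU1P[->|qs] // fpq; last exact: ih.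
  by rewrite fpq map_f in fx.
by rewrite -fpq map_f in fx.
Qed.

(** * The distance of two processes with the same events *)

Section distance_of_marks.
Context {R : realType} {m : nat} {dE : measure_display} {E : measurableType dE}.
Local Notation point := (R * 'rV[R]_m * E * R)%type.
Variables (X : set 'rV[R]_m) (K1 K2 : E -> 'rV[R]_m -> 'rV[R]_m -> R).

Lemma event_at_marked (K : E -> 'rV[R]_m -> 'rV[R]_m -> R) (s : seq point)
    (A : set 'rV[R]_m) (p : point) :
  uniq (map point_time s) -> p \in s -> A p.1.1.2 ->
  event_at (restrict_pp (marked K [set` map fst s]) A) (point_time p) =
  (point_time p, p.1.1.2, fun x => K p.1.2 x p.1.1.2).
Proof.
move=> us ps Ap; rewrite /event_at; case: xgetP => [e -> [[He Ae] et]|H].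
  case: He => _ /= /mapP[q qs ->] qe; move: et; rewrite -qe /= => qp.
  have -> // : p = q.
  exact: (uniq_map_eq us ps qs).
exfalso; apply: (H (point_time p, p.1.1.2, fun x => K p.1.2 x p.1.1.2)).
by split => //; split => //; exists p.1 => //=; apply/mapP; exists p.
Qed.

(** Times and locations coincide, so only the mark terms remain. The bound does not involve [A] and
    hence controls the supremum over all subregions at once. *)
Lemma pp_dist_marked (s : seq point) (A : set 'rV[R]_m) :
  uniq (map point_time s) ->
  (pp_dist X (restrict_pp (marked K1 [set` map fst s]) A)
             (restrict_pp (marked K2 [set` map fst s]) A) <=
   \sum_(q <- s) \int[leb]_(x in X) (`|K1 q.1.2 x q.1.1.2 - K2 q.1.2 x q.1.1.2|)%:E)%E.
Proof.
move=> us.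
set N1 := restrict_pp _ _; set N2 := restrict_pp _ _.
pose T := [set t | exists2 q, q \in s & A q.1.1.2 /\ t = point_time q].
have TE K : event_times (restrict_pp (marked K [set` map fst s]) A) = T.
  apply/seteqP; split => t /=.
    move=> [e [[e' /= /mapP[q qs e'q] <-] /= Aq] <-] /=.
    by exists q => //; rewrite e'q in Aq *.
  move=> [q qs [Aq ->]]; exists (point_time q, q.1.1.2, fun x => K q.1.2 x q.1.1.2) => //.
  by split => //; exists q.1 => //=; apply/mapP; exists q.
rewrite /pp_dist !TE setIid setDv setU0 esum_set0 adde0.
have Ts : T = [set` map point_time [seq q <- s | `[< A q.1.1.2 >]]].
  apply/seteqP; split => t /=.
    move=> [q qs [Aq ->]]; apply/mapP; exists q => //.
    by rewrite mem_filter qs andbT; apply/asboolP.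
  move=> /mapP[q]; rewrite mem_filter => /andP[/asboolP Aq qs] ->.
  by exists q.
have us' : uniq (map point_time [seq q <- s | `[< A q.1.1.2 >]]).
  by apply: subseq_uniq us; apply: map_subseq; exact: filter_subseq.
rewrite Ts esum_fset; [|exact: finite_seq|]; last first.
  move=> t _; apply: adde_ge0; first by rewrite lee_fin sqrtr_ge0.
  by apply: integral_ge0 => x _; rewrite lee_fin.
rewrite -(fsbig_seq _ _ us')/= big_map big_filter big_mkcond/= big_seq [leRHS]big_seq.
apply: lee_sum => q qs; case: asboolP => [Aq|_]; last first.
  by apply: integral_ge0 => x _; rewrite lee_fin.
rewrite !event_at_marked//= subrr (_ : enorm 0 = 0) ?add0e//.
by rewrite /enorm big1 ?sqrtr0// => i _; rewrite mxE expr0n.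
Qed.

End distance_of_marks.

(** * Measurable events expressed through the truncated point sets *)

Section thinning_events.
Context {R : realType} {m : nat} {dE : measure_display} {E : measurableType dE}.
Local Notation tx := (measurableTypeR R * 'rV[R]_m)%type.
Local Notation point := (tx * E * measurableTypeR R)%type.
Local Notation decreasing := (sorted (fun p q : point => point_time q < point_time p)).
Local Notation measurable_graphon W :=
  (measurable_fun setT (fun z : 'rV[R]_m * 'rV[R]_m => W z.1 z.2)).
Local Notation measurable_marks K :=
  (measurable_fun setT (fun p : E * ('rV[R]_m * 'rV[R]_m) => K p.1 p.2.1 p.2.2)).
Variables (LawB : probability E R) (X : set 'rV[R]_m).
Hypotheses (mX : measurable X) (Xfin : (leb X < +oo)%E).
Context d (Omega : measurableType d) (P : probability Omega R).
Local Notation strips M := (strip_measure LawB mX Xfin M).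

Lemma poisson_strips (Pi : Omega -> set point) :
  poisson_random_measure P (thinning_domain X) (point_measure LawB) Pi ->
  exists Psi : nat -> Omega -> set point,
    [/\ forall M, finite_poisson P (strips M) (Psi M),
        forall M w, Psi M w `<=` strip X M &
        {ae P, forall w, forall M, Psi M w = Pi w `&` strip X M}].
Proof.
move=> Pi_PRM.
have H M := poisson_restrict (measurable_strip mX M) Pi_PRM (@strip_domain _ _ _ E X M)
  (measure_strip_lty LawB mX Xfin M).
have [Psi HPsi] := choice H.
exists Psi; split.
- by move=> M; have [] := HPsi M.
- by move=> M; have [] := HPsi M.
- by apply: ae_foralln => M; have [] := HPsi M.
Qed.

Variable Psi : nat -> Omega -> set point.
Hypotheses (Psi_poisson : forall M, finite_poisson P (strips M) (Psi M))
  (Psi_strip : forall M w, Psi M w `<=` strip X M).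

Let tau01 M w p : Psi M w p -> 0 <= point_time p <= 1.
Proof. by move=> /Psi_strip[[[/= + _] _] _]; rewrite in_itv. Qed.

Lemma simple_strips : {ae P, forall w, forall M p q,
  Psi M w p -> Psi M w q -> point_time p = point_time q -> p = q}.
Proof.
apply: ae_foralln => M.
apply: (distinct_times (Psi_poisson M) measurable_point_time (@tau01 M)
  (c := M%:R * fine (leb X))).
  by rewrite mulr_ge0// fine_ge0.
by move=> t t' tt'; rewrite strip_measureE; exact: measure_strip_times.
Qed.

Section explained.
Variables (lam : 'rV[R]_m -> R) (W : 'rV[R]_m -> 'rV[R]_m -> R)
  (K : E -> 'rV[R]_m -> 'rV[R]_m -> R) (h : R -> R).
Hypotheses (mlam : measurable_fun setT lam)
  (mW : measurable_graphon W)
  (mK : measurable_marks K)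
  (mh : measurable_fun setT (h : measurableTypeR R -> R)).

(* The solution consists of [j] events, all at levels below [k]. *)
Definition explained k j : set Omega :=
  [set w | exists2 s : j.-tuple point, tuples_in (Psi k w) s &
    decreasing s /\ forall M p, Psi M w p -> ~~ mismatch lam W K h s p].

Let measurable_mismatch d' (T : measurableType d') j :
  measurable [set y : T * j.-tuple point * point | mismatch lam W K h y.1.2 y.2].
Proof.
have ms : measurable_fun setT (fun y : T * j.-tuple point * point => y.1.2).
  exact: (measurableT_comp measurable_snd measurable_fst).
apply: measurable_xor; last first.
  have mp : measurable_fun setT (fun y : T * j.-tuple point * point => (y.2, y.1.2)).
    exact: measurable_fun_pair.
  exact: (measurableT_comp (@measurable_accepted _ _ _ _ _ _ _ _ mlam mW mK mh j) mp).
apply: (measurable_fun_bool true); rewrite setTI.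
rewrite (_ : _ @^-1` _ = \bigcup_(i in [set: 'I_j])
    [set y : T * j.-tuple point * point | point_time (tnth y.1.2 i) == point_time y.2]).
  apply: fin_bigcup_measurable; first exact: finite_finset.
  move=> i _; rewrite -[X in measurable X]setTI.
  have mt : measurable_fun setT (fun y : T * j.-tuple point * point =>
      point_time (tnth y.1.2 i) == point_time y.2).
    apply: measurable_fun_eqr; last exact: (measurableT_comp measurable_point_time measurable_snd).
    exact: (measurableT_comp measurable_point_time (measurableT_comp (measurable_tnth i) ms)).
  exact: (mt measurableT [set true]).
apply/seteqP; split => y /=.
  by move=> /hasP[q /tnthP[i ->] qy]; exists i.
move=> [i _ iy]; apply/hasP; exists (tnth y.1.2 i) => //; exact: mem_tnth.
Qed.

(** Both quantifiers run over random finite sets. The inner one is handled on the product of the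
    sample space with the tuples, by a countable union over the levels. *)
Lemma measurable_explained k j : measurable (explained k j).
Proof.
pose unexplained := \bigcup_M [set z : Omega * j.-tuple point |
  exists2 p, Psi M z.1 p & mismatch lam W K h z.2 p].
have mU : measurable unexplained.
  apply: bigcupT_measurable => M; have [rf _ _] := Psi_poisson M.
  have rf' := random_finite_comp (@measurable_fst _ _ Omega (j.-tuple point)) rf.
  exact: (random_finite_exists rf' (@measurable_mismatch _ Omega j)).
have md : measurable [set z : Omega * j.-tuple point | decreasing z.2].
  rewrite -[X in measurable X]setTI.
  have md := @measurable_decreasing R m _ E j.
  exact: (@measurable_snd _ _ Omega (j.-tuple point) measurableT _ md).
have H := random_finite_exists (random_finite_tuples (Psi_poisson k) j) (measurableD md mU).
rewrite (_ : explained k j = [set w | exists2 s, tuples_in (Psi k w) (n:=j) s &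
  ([set z : Omega * j.-tuple point | decreasing z.2] `\` unexplained) (w, s)])//.
apply/seteqP; split => w [s sk].
  move=> [sd smm]; exists s => //; split => // -[M _ [p pM mm]].
  by have /negP := smm M p pM; apply.
move=> [sd smm]; exists s => //; split => // M p pM.
by apply/negP => mm; apply: smm; exists M => //; exists p.
Qed.

End explained.

Section disagreements.
Variables (lam1 lam2 : 'rV[R]_m -> R) (W1 W2 : 'rV[R]_m -> 'rV[R]_m -> R)
  (K1 K2 : E -> 'rV[R]_m -> 'rV[R]_m -> R) (h : R -> R).
Hypotheses (mlam1 : measurable_fun setT lam1) (mlam2 : measurable_fun setT lam2)
  (mW1 : measurable_graphon W1)
  (mW2 : measurable_graphon W2)
  (mK1 : measurable_marks K1)
  (mK2 : measurable_marks K2)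
  (mh : measurable_fun setT (h : measurableTypeR R -> R))
  (h_ge0 : forall t, 0 <= h t)
  (h_int : lebesgue_measure.-integrable setT (EFin \o h)).
Variable F : set Omega.
Hypotheses (mF : measurable F)
  (Psi_mono : forall w, ~ F w -> forall M M', (M <= M')%N -> Psi M w `<=` Psi M' w).
Local Open Scope ereal_scope.

(** The strip of level k + l is there to catch the head, as l grows. Removing [F], outside of which
    [Psi] increases with the level, makes these events increase with l. *)
Definition disagreeing k n l : set Omega :=
  [set w | exists2 s : n.+1.-tuple point, tuples_in (Psi (k + l)%N w) s &
    disagreement X lam1 lam2 W1 W2 K1 K2 h k s] `\` F.

Lemma measurable_disagreeing k n l : measurable (disagreeing k n l).
Proof.
apply: measurableD => //.
apply: (campbell_decreasing (Psi_poisson (k + l)%N) measurable_point_time (@tau01 (k + l)%N) _ _).1.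
- exact: measurable_disagreement.
- by move=> s [].
Qed.

(** The bound of [tuple_disagreement_le] only knows the level k of the tail, so it survives the
    increasing union over l. *)
Lemma probability_disagreeing k n :
  P (\bigcup_l disagreeing k n l) <=
  (strip_mass X k ^+ n)%:E * \int[leb]_(x in X) (`|lam1 x - lam2 x|)%:E +
  (n%:R * (strip_mass X k ^+ n.-1 * k%:R) * h_mass h)%:E *
    \int[LawB]_w \int[(leb \x leb)%E]_(z in X `*` X) (kernel_gap W1 W2 K1 K2 w z.1 z.2)%:E.
Proof.
have mD := measurable_disagreeing k n.
have nd : nondecreasing_seq (disagreeing k n).
  move=> l l' ll'; apply/subsetPset => w [[s sM sd] nF]; split => //.
  exists s => // q qs; apply: (Psi_mono nF _ (sM q qs)).
  by rewrite leq_add2l.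
apply: (cvge_le _ (nondecreasing_cvg_mu mD (bigcupT_measurable _ mD) nd)).
apply: nearW => l /=.
have mdis := @measurable_disagreement _ _ _ _ _ mX _ _ _ _ _ _ _
  mlam1 mlam2 mW1 mW2 mK1 mK2 mh k n.
have [mE PE] := campbell_decreasing (Psi_poisson (k + l)%N) measurable_point_time
  (@tau01 (k + l)%N) mdis (fun s H => let: And4 h1 _ _ _ := H in h1).
apply: (le_trans (le_measure _ _ _ (@subDsetl _ _ F))); rewrite ?inE//.
  exact: mD.
apply: (le_trans PE).
exact: (tuple_disagreement_le LawB mX Xfin mlam1 mlam2 mW1 mW2 mK1 mK2 mh h_ge0 h_int
  n (leq_addr l k)).
Qed.

End disagreements.

End thinning_events.

(** * The exceptional event outside of which the processes coincide *)

Section coupling.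
Context {R : realType} {m : nat}.
Variables (a b : 'rV[R]_m).
Local Notation X := (closed_box a b).
Local Notation leb := (@leb R m).
Variable C : forall d : nat, 'I_d -> set 'rV[R]_m.
Hypothesis C_part : forall d, (0 < d)%N -> hyperrectangle_partition X (@C d).
Hypothesis C_mesh : (fun d => mesh (@C d)) @ \oo --> 0%E.
Context {dE : measure_display} {E : measurableType dE} (LawB : probability E R).
Local Notation measurable_graphon W :=
  (measurable_fun setT (fun z : 'rV[R]_m * 'rV[R]_m => W z.1 z.2)).
Local Notation measurable_marks K :=
  (measurable_fun setT (fun p : E * ('rV[R]_m * 'rV[R]_m) => K p.1 p.2.1 p.2.2)).
Variables (lam : 'rV[R]_m -> R) (W : 'rV[R]_m -> 'rV[R]_m -> R) (CW : R)
  (B : E -> 'rV[R]_m -> 'rV[R]_m -> R) (CB : R) (h : R -> R).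
Hypotheses (lam_meas : measurable_fun setT lam)
  (lam_int : leb.-integrable X (EFin \o lam)).
Hypothesis W_meas : measurable_graphon W.
Hypothesis W_bnd : forall x y, 0 <= W x y <= CW.
Hypothesis B_meas : measurable_marks B.
Hypothesis B_ge0 : forall w x y, 0 <= B w x y.
Hypothesis CB_ge0 : 0 <= CB.
Hypothesis B_bnd : forall x y, X x -> X y ->
  (\int[LawB]_w (B w x y)%:E <= CB%:E)%E.
Hypotheses (h_meas : measurable_fun setT (h : measurableTypeR R -> R))
  (h_ge0 : forall t, 0 <= h t)
  (h_int : lebesgue_measure.-integrable setT (EFin \o h)).
Local Notation point := (measurableTypeR R * 'rV[R]_m * E * measurableTypeR R)%type.
Local Notation decreasing := (sorted (fun p q : point => point_time q < point_time p)).
Context d (Omega : measurableType d) (P : probability Omega R).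
Variables (Pi : Omega -> set point)
  (N : Omega -> set (R * 'rV[R]_m * E)) (Nt : nat -> Omega -> set (R * 'rV[R]_m * E)).
Local Notation lam_ n := (cell_average1 (@C n.+1) lam).
Local Notation W_ n := (cell_average2 (@C n.+1) W).
Local Notation B_ n := (fun w => cell_average2 (@C n.+1) (B w)).
Hypotheses (Pi_PRM : poisson_random_measure P (thinning_domain X) (point_measure LawB) Pi)
  (N_hawkes : hawkes_process lam W B h P Pi N)
  (Nt_hawkes : forall n, hawkes_process (lam_ n) (W_ n) (B_ n) h P Pi (Nt n)).
Local Open Scope ereal_scope.

Let mX : measurable X := measurable_closed_box a b.
Let Xfin : leb X < +oo := leb_closed_box_lty a b.

Definition mark_error n (s : seq point) : \bar R :=
  \sum_(q <- s) \int[leb]_(x in X) (`|B_ n q.1.2 x q.1.1.2 - B q.1.2 x q.1.1.2|)%:E.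

Let g n w y := \int[leb]_(x in X) (`|B_ n w x y - B w x y|)%:E.

Let gap_meas n : measurable_fun setT (fun p : E * ('rV[R]_m * 'rV[R]_m) =>
  (`|B_ n p.1 p.2.1 p.2.2 - B p.1 p.2.1 p.2.2|)%:E).
Proof.
apply/measurable_EFinP; apply: measurableT_comp => //.
apply: measurable_funB; last exact: B_meas.
exact: (measurable_B_average C_part B_meas B_ge0 n).
Qed.

Let g_meas n : measurable_fun setT (fun z : E * 'rV[R]_m => g n z.1 z.2).
Proof.
pose f (z : E * 'rV[R]_m) x := (`|B_ n z.1 x z.2 - B z.1 x z.2|)%:E.
have mp : measurable_fun setT (fun p : E * 'rV[R]_m * 'rV[R]_m => (p.1.1, (p.2, p.1.2))).
  apply: measurable_fun_pair; first exact: (measurableT_comp measurable_fst measurable_fst).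
  apply: measurable_fun_pair => //.
  exact: (measurableT_comp measurable_snd measurable_fst).
apply: (@measurable_fun_partial_integral _ _ _ _ _ leb X f mX).
  exact: (measurableT_comp (gap_meas n) mp).
by move=> z x; rewrite lee_fin.
Qed.

Let g_ge0 n w y : 0 <= g n w y.
Proof. by apply: integral_ge0 => x _; rewrite lee_fin. Qed.

Let integral_g n : \int[LawB]_w \int[leb]_(y in X) g n w y = mean_error_B a b C LawB B n.
Proof.
apply: eq_integral => w _.
have mw : measurable_fun setT (fun z : 'rV[R]_m * 'rV[R]_m =>
    (`|B_ n w z.1 z.2 - B w z.1 z.2|)%:E).
  exact: (measurableT_comp (gap_meas n) (measurable_pair1 w)).
have g0 (z : 'rV[R]_m * 'rV[R]_m) : 0 <= (`|B_ n w z.1 z.2 - B w z.1 z.2|)%:E.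
  by rewrite lee_fin.
apply: (etrans (integral_square mX mw g0)).
by apply: eq_integral => z _; rewrite cell_average2E -surjective_pairing.
Qed.

(** The tolerance [e] pays once for the tightness of [N]. The number of cases and the constants in
    [v] depend on it but not on n, which is the shape that [vanishing_approx] consumes. *)
Lemma coupling_close (e delta : R) : (0 < e)%R -> (0 < delta)%R ->
  exists (Bad : nat -> set Omega) (v : nat -> \bar R),
    [/\ forall n, measurable (Bad n), vanishing v,
        forall n, P (Bad n) <= v n + e%:E &
        forall n w, ~ Bad n w -> exists s : seq point,
          [/\ N w = [set` map fst s], Nt n w = N w, uniq (map point_time s),
              forall q, q \in s -> thinning_domain X q &
              mark_error n s <= delta%:E]].
Proof.
move=> e0 delta0.
have [Psi [PsiP Psi_strip Psi_ae]] := poisson_strips mX Xfin Pi_PRM.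
have Psi_simple := simple_strips PsiP Psi_strip.
have Nt_ae := ae_foralln Nt_hawkes.
(* All almost sure statements, for every level and every n, are gathered here so that one measurable
   null set [F] disposes of them and the rest is pathwise. *)
pose G w := [/\ forall M, Psi M w = Pi w `&` strip X M,
  forall M p q, Psi M w p -> Psi M w q -> point_time p = point_time q -> p = q,
  finite_set (N w) /\ N w = thinned lam W B h (Pi w) (N w) &
  forall n, finite_set (Nt n w) /\ Nt n w = thinned (lam_ n) (W_ n) (B_ n) h (Pi w) (Nt n w)].
have G_ae : {ae P, forall w, G w}.
  apply: filterS2 (filterI Psi_ae Psi_simple) (filterI N_hawkes Nt_ae).
  by move=> w [h1 h2] [h3 h4]; split.
have [F [mF PF GF]] : P.-negligible (~` [set w | G w]) by exact: G_ae.
have good w : ~ F w -> G w by move=> nF; apply: contrapT => nG; exact/nF/GF.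
have PiD w p : Pi w p -> thinning_domain X p by case: Pi_PRM => + _ _ _ _ => /(_ w)[_]; apply.
have Psi_mono w : ~ F w -> forall M M', (M <= M')%N -> Psi M w `<=` Psi M' w.
  move=> /good[PsiE _ _ _] M M' MM' p; rewrite !PsiE => -[Pp [pw rM]].
  split => //; split => //; move: rM; rewrite /= !in_itv /= => /andP[-> rM] /=.
  by apply: le_trans rM _; rewrite ler_nat.
have Pi_Psi w p : ~ F w -> Pi w p -> exists M0, forall M, (M0 <= M)%N -> Psi M w p.
  move=> /good[PsiE _ _ _] Pp; have [M0 HM0] := in_strip (E := E) (PiD _ _ Pp).
  by exists M0 => M MM; rewrite PsiE; split => //; exact: HM0.
have Pi_simple w : ~ F w -> forall p q, Pi w p -> Pi w q -> point_time p = point_time q -> p = q.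
  move=> nF p q /(Pi_Psi _ _ nF)[M1 H1] /(Pi_Psi _ _ nF)[M2 H2].
  have [_ simple _ _] := good _ nF.
  by apply: (simple (maxn M1 M2)); [apply: H1; exact: leq_maxl|apply: H2; exact: leq_maxr].
have exc0 t x q : (0 <= excitation W B h t x q)%R.
  rewrite /excitation; case: ifP => // _; rewrite !mulr_ge0//.
  by have /andP[] := W_bnd x q.1.1.2.
have exc0_ n t x q : (0 <= excitation (W_ n) (B_ n) h t x q)%R.
  rewrite /excitation; case: ifP => // _; rewrite !mulr_ge0// cell_average_ge0//.
  by move=> y z; have /andP[] := W_bnd y z.
have mlam_ n : measurable_fun setT (lam_ n).
  exact: (measurable_average_on_cells (box_cell_partition C_part n) lam).
have mW_ n := measurable_W_average C_part W n.
have mB_ n := measurable_B_average C_part B_meas B_ge0 n.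
(* Enumerates the pairs (level, number of events); integers that encode no pair fall back on (0,
   0). *)
pose kj (c : nat) : nat * nat := odflt (0%N, 0%N) (@choice.unpickle (nat * nat)%type c).
pose V c := explained Psi lam W B h (kj c).1 (kj c).2.
have mV c : measurable (V c) by exact: (measurable_explained PsiP lam_meas W_meas B_meas h_meas).
pose U K := \bigcup_(c in `I_K) V c.
have mU K : measurable (U K) by apply: fin_bigcup_measurable => //; exact: finite_II.
have coverU w : ~ F w -> exists c, V c w.
  move=> nF; have [PsiE _ [fN NE] _] := good _ nF.
  have [s [sd sPi smm]] := solution_points exc0 (Pi_simple _ nF) fN NE.
  have [k Hk] : exists k, forall q, q \in s -> Psi k w q.
    elim: s sPi {sd smm} => [|p s ih] sPi; first by exists 0%N.
    have [|k1 H1] := ih; first by move=> q qs; apply: sPi; rewrite inE qs orbT.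
    have [k2 H2] := Pi_Psi _ _ nF (sPi p (mem_head _ _)).
    exists (maxn k1 k2) => q; rewrite inE => /predU1P[->|/H1].
      by apply: H2; exact: leq_maxr.
    by apply: Psi_mono => //; exact: leq_maxl.
  exists (choice.pickle (k, size s)); rewrite /V /kj choice.pickleK /=.
  exists (in_tuple s) => //; split => // M p; rewrite PsiE => -[Pp _]; exact: smm.
(* Outside [F] every sample point is explained by some pair, so the complements decrease to a null
   set and finitely many pairs suffice. *)
have [K UK] : exists K, P (~` U K) <= e%:E.
  have mcU K : measurable (~` U K) by exact: measurableC.
  have niU : nonincreasing_seq (fun K => ~` U K).
    move=> K K' KK'; apply/subsetPset; apply: subsetC => w [c cK Vc].
    by exists c => //; exact: leq_trans cK KK'.
  have H := nonincreasing_cvg_mu (le_lt_trans (probability_le1 P (mcU 0%N)) (ltry 1))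
    mcU (bigcapT_measurable mcU) niU.
  have P0 : P (\bigcap_K ~` U K) = 0.
    apply: (subset_measure0 _ _ _ PF) => //; first exact: bigcapT_measurable.
    move=> w wU; apply: contrapT => /coverU[c Vc].
    by apply: (wU c.+1) => //; exists c => //=.
  have H0 : (fun K => P (~` U K)) @ \oo --> 0 by rewrite -P0; exact: H.
  have [n0 Hn0] := (vanishing_cvgP (fun K => measure_ge0 P (~` U K))).1 H0 e e0.
  by exists n0; exact: Hn0.
(* Here i is the number of events before the disagreeing point. *)
pose RB n c i := \bigcup_l disagreeing X Psi (lam_ n) lam (W_ n) W (B_ n) B h F (kj c).1 i l.
pose MB n c := [set w | exists2 s : (kj c).2.-tuple point, tuples_in (Psi (kj c).1 w) s &
  decreasing s /\ delta%:E < \sum_(q <- s) g n q.1.2 q.1.1.2].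
have mRB n c i : measurable (RB n c i).
  apply: bigcupT_measurable => l.
  exact: (measurable_disagreeing PsiP Psi_strip (mlam_ n) lam_meas (mW_ n) W_meas (mB_ n) B_meas h_meas mF).
have tau01 M w p : Psi M w p -> (0 <= point_time p <= 1)%R.
  by move=> /Psi_strip[[[/= + _] _] _]; rewrite in_itv.
have MBP n c := tuple_markov LawB mX Xfin (g_meas n) (g_ge0 n) (kj c).1 (kj c).2 delta0.
have MBcam n c := campbell_decreasing (PsiP (kj c).1) measurable_point_time
  (@tau01 (kj c).1) (MBP n c).1 (fun s H => H.1).
have mMB n c : measurable (MB n c) by exact: (MBcam n c).1.
(* The relevant history is part of a list of length [(kj c).2], so its own length ranges from 0 to
   that number included. *)
pose Q n c := (\big[setU/set0]_(i < (kj c).2.+1) RB n c i) `|` MB n c.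
have mQ n c : measurable (Q n c).
  by apply: measurableU => //; apply: bigsetU_measurable.
pose bR n c (i : nat) := (strip_mass X (kj c).1 ^+ i)%:E *
    \int[leb]_(x in X) (`|lam_ n x - lam x|)%:E +
  (i%:R * (strip_mass X (kj c).1 ^+ i.-1 * (kj c).1%:R) * h_mass h)%:E *
    mean_kernel_error a b C LawB W B n.
pose bM n c := (delta^-1 * ((kj c).2%:R *
  (strip_mass X (kj c).1 ^+ (kj c).2.-1 * (kj c).1%:R)))%:E * mean_error_B a b C LawB B n.
pose v n := \sum_(c < K) ((\sum_(i < (kj c).2.+1) bR n c i) + bM n c).
have mass0 k : (0 <= strip_mass X k :> R)%R by exact: strip_mass_ge0.
exists (fun n => F `|` ~` U K `|` \big[setU/set0]_(c < K) Q n c), v; split.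
- move=> n; apply: measurableU; first by apply: measurableU => //; exact: measurableC.
  by apply: bigsetU_measurable => c _; exact: mQ.
- apply: vanishing_sum => c; apply: vanishingD; last first.
    apply: vanishingZ; last exact: (vanishing_mean_error_B C_part C_mesh B_meas B_ge0 CB_ge0 B_bnd).
    apply: mulr_ge0; first by rewrite invr_ge0 ltW.
    by rewrite !mulr_ge0// exprn_ge0.
  apply: vanishing_sum => i; apply: vanishingD; apply: vanishingZ.
  + exact: exprn_ge0.
  + exact: (box_averaging_converges C_part C_mesh lam_int).
  + by rewrite !mulr_ge0 ?exprn_ge0 ?h_mass_ge0.
  + exact: (vanishing_mean_kernel_error C_part C_mesh W_meas W_bnd B_meas B_ge0 CB_ge0 B_bnd).
- move=> n.
  have mb : measurable (\big[setU/set0]_(c < K) Q n c).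
    by apply: bigsetU_measurable => c _; exact: mQ.
  have mcU : measurable (~` U K) by exact: measurableC.
  apply: (le_trans (measureU2 _ (measurableU _ _ mF mcU) mb)); rewrite addeC; apply: leeD.
    apply: (le_trans (Boole_inequality P (fun c _ => mQ n c))).
    apply: lee_sum => c _; apply: (le_trans (measureU2 _ _ (mMB n c))).
      by apply: bigsetU_measurable.
    apply: leeD.
      apply: (le_trans (Boole_inequality P (fun i _ => mRB n c i))).
      apply: lee_sum => i _.
      exact: (probability_disagreeing PsiP Psi_strip (mlam_ n) lam_meas (mW_ n) W_meas
        (mB_ n) B_meas h_meas h_ge0 h_int mF Psi_mono (kj c).1 i).
    apply: (le_trans (MBcam n c).2); apply: (le_trans (MBP n c).2).
    by rewrite integral_g.
  apply: (le_trans (measureU2 _ mF mcU)); rewrite -[leRHS]add0e.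
  by apply: leeD; [rewrite le_eqVlt; apply/orP; left; apply/eqP; exact: PF|exact: UK].
move=> n w nBad.
have nF : ~ F w by move=> Fw; apply: nBad; left; left.
have [c cK [s sPsi [sd smm]]] : U K w by apply: contrapT => nU; apply: nBad; left; right.
have nQ : ~ Q n c w.
  move=> Qw; apply: nBad; right; rewrite -bigcup_mkord; exists c => //.
have [PsiE _ [fN NE] Nt_eq] := good _ nF.
have sPi q : q \in (s : seq point) -> Pi w q by move=> /sPsi; rewrite PsiE => -[].
have smm' p : Pi w p -> ~~ mismatch lam W B h s p.
  by move=> /(Pi_Psi _ _ nF)[M0 HM0]; apply: smm; exact: HM0.
have Ns := solution_from_points exc0 (Pi_simple _ nF) sd sPi smm' fN NE.
exists s; split => //.
- have [fNt NtE] := Nt_eq n.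
  apply: contrapT => neq.
  have sE : [set` map fst s] = thinned lam W B h (Pi w) [set` map fst s] by rewrite -Ns.
  have neq' : Nt n w <> [set` map fst s] by rewrite -Ns.
  have [p [s' [Pp s's ss' sd' acc]]] := solutions_differ exc0 (exc0_ n) sd sPi sE fNt NtE neq'.
  have [M0 HM0] := Pi_Psi _ _ nF Pp.
  apply: nQ; left; rewrite -bigcup_mkord; exists (size s').
    by rewrite /= ltnS; apply: (leq_trans ss'); rewrite size_tuple.
  (* The level [k + M0] is large enough for both: at least [M0] for the disagreeing point, at least
     k for its history. *)
  exists M0 => //; split => //; exists (cons_tup (p, in_tuple s')).
    move=> q; rewrite inE => /predU1P[->|/s's/sPsi]; first by apply: HM0; exact: leq_addl.
    by apply: Psi_mono => //; exact: leq_addr.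
  split => //.
  + by move=> q /s's/sPsi/Psi_strip.
  + by rewrite theadE; have [t01 Xp _] := PiD _ _ Pp; split => //=; rewrite in_itv.
- exact: decreasing_uniq_times.
- by move=> q /sPi/PiD.
- rewrite leNgt; apply/negP => ds; apply: nQ; right; by exists s.
Qed.

End coupling.

Section restriction_to_domain.
Context {R : realType} {m : nat} {dE : measure_display} {E : measurableType dE}.
Variable X : set 'rV[R]_m.

Lemma cell_average1_congr d (C : 'I_d -> set 'rV[R]_m) (f g : 'rV[R]_m -> R) :
  (forall i, C i `<=` X) -> (forall x, X x -> f x = g x) ->
  cell_average1 C f = cell_average1 C g.
Proof.
move=> CX fg; apply/funext => x; apply: eq_bigr => i _; congr (_ * (_ * _)).
by apply: eq_Rintegral => y; rewrite inE => /CX; exact: fg.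
Qed.

Lemma cell_average2_congr d (C : 'I_d -> set 'rV[R]_m) (f g : 'rV[R]_m -> 'rV[R]_m -> R) :
  (forall i, C i `<=` X) -> (forall x y, X x -> X y -> f x y = g x y) ->
  cell_average2 C f = cell_average2 C g.
Proof.
move=> CX fg; apply/funext => x; apply/funext => y.
apply: eq_bigr => i _; apply: eq_bigr => j _; congr (_ * (_ * _)).
by apply: eq_Rintegral => z; rewrite inE => -[/CX ? /CX ?]; exact: fg.
Qed.

(** Points of [Pi], hence events, have their locations in [X], and h is evaluated at positive
    delays. The equation therefore only sees the parameters there, and they may be extended by
    zero. *)
Lemma hawkes_process_congr (lam lam' : 'rV[R]_m -> R) (W W' : 'rV[R]_m -> 'rV[R]_m -> R)
    (K K' : E -> 'rV[R]_m -> 'rV[R]_m -> R) (h h' : R -> R)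
    d (Omega : measurableType d) (P : probability Omega R)
    (Pi : Omega -> set (R * 'rV[R]_m * E * R)) N :
  (forall w, Pi w `<=` thinning_domain X) ->
  (forall x, X x -> lam x = lam' x) ->
  (forall x y, X x -> X y -> W x y = W' x y) ->
  (forall e x y, X x -> X y -> K e x y = K' e x y) ->
  (forall t, 0 <= t -> h t = h' t) ->
  hawkes_process lam W K h P Pi N -> hawkes_process lam' W' K' h' P Pi N.
Proof.
move=> PiX lamE WE KE hE; apply: filterS => w [fN NE]; split => //.
have NX e : N w e -> X e.1.2 by rewrite NE => -[r /PiX[]].
have iE e : X e.1.2 ->
    intensity lam W K h (N w) e.1.1 e.1.2 = intensity lam' W' K' h' (N w) e.1.1 e.1.2.
  move=> Xe; rewrite /intensity lamE//; congr (_ + _)%E; apply: eq_esum => q [/NX Xq qe].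
  by rewrite KE// WE// hE// subr_ge0 ltW.
rewrite {1}NE; apply/seteqP; split => e [r Pr].
  by rewrite iE; [exists r|have [] := PiX _ _ Pr].
by move=> re; exists r => //; rewrite iE//; have [] := PiX _ _ Pr.
Qed.

End restriction_to_domain.

Theorem theorem2 (R : realType) (m : nat) (m_gt0 : (0 < m)%N)
  (* the hyperrectangle *)
  (a b : 'rV[R]_m) (ab : forall i, a ord0 i < b ord0 i)
  (X : set 'rV[R]_m) (XE : X = closed_box a b)
  (* the baseline intensity *)
  (lam : 'rV[R]_m -> R) (lam_ge0 : forall x, X x -> 0 <= lam x)
  (lam_L1 : in_Lp X 1%E lam) (lam_Loo : in_Lp X +oo%E lam)
  (lam_TV : (TV_norm X lam < +oo)%E)
  (* the excitation kernel *)
  (h : R -> R) (h_ge0 : forall t : R, 0 <= t -> 0 <= h t)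
  (h_L1 : lebesgue_measure.-integrable `[0%R, +oo[ (EFin \o h))
  (* the graphon *)
  (W : 'rV[R]_m -> 'rV[R]_m -> R) (CW : R)
  (W_meas : measurable_fun (X `*` X) (fun z => W z.1 z.2))
  (W_bnd : forall x y, X x -> X y -> 0 <= W x y <= CW)
  (W_BV : forall y, X y -> in_BV X (W ^~ y))
  (W_supTV : (ereal_sup [set TV_norm X (W ^~ y) | y in X] < +oo)%E)
  (* the mark process, as a process on its path space (E, Law(B)) *)
  (dE : measure_display) (E : measurableType dE) (LawB : probability E R)
  (B : E -> 'rV[R]_m -> 'rV[R]_m -> R) (CB : R)
  (B_meas : measurable_fun (setT `*` X `*` X) (fun z => B z.1.1 z.1.2 z.2))
  (B_ge0 : forall w x y, X x -> X y -> 0 <= B w x y)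
  (B_sep : separable_process LawB (X `*` X) (fun w z => B w z.1 z.2))
  (B_bnd : forall x y, X x -> X y ->
    ('E_LawB[(fun w => B w x y)] <= CB%:E)%E)
  (B_BV : {ae leb, forall y, X y ->
    {ae LawB, forall w, in_BV X (B w ^~ y)}})
  (B_supTV : (ereal_sup [set \int[LawB]_w TV_norm X (B w ^~ y) | y in X]
    < +oo)%E)
  (EB : 'rV[R]_m -> 'rV[R]_m -> R)
  (EBE : forall x y, EB x y = fine 'E_LawB[(fun w => B w x y)])
  (* the conjugate exponents *)
  (pq : exists p q : \bar R, [/\ (1 <= p)%E, q = hoelder_conjugate p &
    {ae leb, forall y, X y -> in_Lp X p (W ^~ y) /\ in_Lp X q (EB ^~ y)}])
  (rho_lt1 : (spectral_radius X (T_hom X h EB W) < 1)%E)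
  (* the partitions *)
  (C : forall d : nat, 'I_d -> set 'rV[R]_m)
  (C_part : forall d, (0 < d)%N -> hyperrectangle_partition X (C d))
  (C_mono : forall d d', (0 < d)%N -> (d <= d')%N ->
    (mesh (C d') <= mesh (C d))%E)
  (C_mesh : (fun d => mesh (C d)) @ \oo --> 0%E)
  (* the common Poisson random measure *)
  (dO : measure_display) (Omega : measurableType dO) (P : probability Omega R)
  (Pi : Omega -> set (R * 'rV[R]_m * E * R))
  (Pi_PRM : poisson_random_measure P
    (thinning_domain X)
    (lebesgue_measure \x leb \x LawB \x lebesgue_measure)%E Pi)
  (* the process and its approximations *)
  (N : Omega -> set (R * 'rV[R]_m * E))
  (N_hawkes : hawkes_process lam W B h P Pi N)
  (Nt : nat -> Omega -> set (R * 'rV[R]_m * E))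
  (Nt_hawkes : forall d, (0 < d)%N ->
    hawkes_process (cell_average1 (C d) lam) (cell_average2 (C d) W)
      (fun w => cell_average2 (C d) (B w)) h P Pi (Nt d))
  (delta : R) (delta_gt0 : 0 < delta)
  (A : set 'rV[R]_m) (A_compact : compact A) (A_convex : convex_set A)
  (A_nondeg : interior A !=set0) (A_sub : A `<=` X) :
  (fun d => mu_ext P [set w | (delta%:E < ereal_sup
      [set pp_dist X
         (restrict_pp (marked (fun w' => cell_average2 (C d) (B w')) (Nt d w)) A')
         (restrict_pp (marked B (N w)) A')
      | A' in [set A' | [/\ A' `<=` A, compact A' & convex_set A']]])%E])
    @ \oo --> 0%E.

Proof.
subst X; set X := closed_box a b in lam_ge0 *.
have mX : measurable X := measurable_closed_box a b.
have Xa : X a by move=> i; rewrite lexx ltW.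
have PiX w : Pi w `<=` thinning_domain X by case: Pi_PRM => /(_ w)[].
have CX n i : C n.+1 i `<=` X.
  by have [_ _ _ CE] := C_part n.+1 isT; rewrite /X -CE => x Cx; exists i.
(* The hypotheses hold on [X] and on the half-line only. The zero extensions have measurability and
   sign everywhere, as the coupling section assumes. *)
pose lam0 := lam \_ X.
pose W0 x y := ((fun z => W z.1 z.2) \_ (X `*` X)) (x, y).
pose B0 w x y := ((fun z => B z.1.1 z.1.2 z.2) \_ (setT `*` X `*` X)) (w, x, y).
pose h0 := h \_ `[0, +oo[.
have lamE x : X x -> lam x = lam0 x by move=> Xx; rewrite /lam0 patchE mem_set.
have WE x y : X x -> X y -> W x y = W0 x y.
  by move=> Xx Xy; rewrite /W0 patchE mem_set.
have BE w x y : X x -> X y -> B w x y = B0 w x y.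
  by move=> Xx Xy; rewrite /B0 patchE mem_set.
have hE t : 0 <= t -> h t = h0 t.
  by move=> t0; rewrite /h0 patchE mem_set//= in_itv /= t0.
have CW0 : 0 <= CW by have /andP[w0 w1] := W_bnd a a Xa Xa; exact: le_trans w0 w1.
have lam0_meas : measurable_fun setT lam0.
  by apply/(measurable_restrictT _ mX); case: lam_L1.
have lam0_int : leb.-integrable X (EFin \o lam0).
  apply/integrableP; split; first by apply/measurable_EFinP; exact: measurable_funTS.
  case: lam_L1 => _; rewrite /finite_norm Lnorm1 => H.
  apply: le_lt_trans H; apply: ge0_subset_integral => //.
  by do 2 apply: measurableT_comp => //.
have W0_meas : measurable_fun setT (fun z : 'rV[R]_m * 'rV[R]_m => W0 z.1 z.2).
  apply: (eq_measurable_fun ((fun z => W z.1 z.2) \_ (X `*` X))).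
    by move=> [x y] _.
  by apply/(measurable_restrictT _ (measurableX mX mX)).
have W0_bnd x y : 0 <= W0 x y <= CW.
  rewrite /W0 patchE; case: ifPn => [|_]; last by rewrite lexx.
  by rewrite inE => -[Xx Xy]; exact: W_bnd.
have B0_meas : measurable_fun setT
    (fun p : E * ('rV[R]_m * 'rV[R]_m) => B0 p.1 p.2.1 p.2.2).
  have mr : measurable_fun setT
      ((fun z : E * 'rV[R]_m * 'rV[R]_m => B z.1.1 z.1.2 z.2) \_ (setT `*` X `*` X)).
    by apply/(measurable_restrictT _ (measurableX (measurableX measurableT mX) mX)).
  have mp : measurable_fun setT
      (fun p : E * ('rV[R]_m * 'rV[R]_m) => (p.1, p.2.1, p.2.2)).
    apply: measurable_fun_pair; last exact: (measurableT_comp measurable_snd measurable_snd).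
    apply: measurable_fun_pair => //.
    exact: (measurableT_comp measurable_fst measurable_snd).
  exact: (measurableT_comp mr mp).
have B0_ge0 w x y : 0 <= B0 w x y.
  rewrite /B0 patchE; case: ifPn => [|_]; last by rewrite lexx.
  by rewrite inE => -[[_ Xx] Xy]; exact: B_ge0.
have B0_bnd x y : X x -> X y -> (\int[LawB]_w (B0 w x y)%:E <= CB%:E)%E.
  move=> Xx Xy; have := B_bnd x y Xx Xy; rewrite unlock; apply: le_trans.
  by rewrite le_eqVlt; apply/orP; left; apply/eqP; apply: eq_integral => w _; rewrite -BE.
have CB0 : 0 <= CB.
  rewrite -lee_fin; apply: le_trans (B0_bnd a a Xa Xa).
  by apply: integral_ge0 => w _; rewrite lee_fin.
have [h_meas _] := integrableP _ _ _ h_L1.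
have h0_meas : measurable_fun setT (h0 : measurableTypeR R -> R).
  by apply/(measurable_restrictT _ (measurable_itv _)); apply/measurable_EFinP.
have h0_ge0 t : 0 <= h0 t.
  rewrite /h0 patchE; case: ifPn => [|_]; last by rewrite lexx.
  by rewrite inE /= in_itv /= andbT => /h_ge0.
have h0_int : lebesgue_measure.-integrable setT (EFin \o h0).
  rewrite (_ : EFin \o h0 = (EFin \o h) \_ `[0, +oo[).
    by rewrite -integrable_mkcond.
  by apply/funext => t; rewrite /h0 /= !patchE; case: ifP.
have N0 : hawkes_process lam0 W0 B0 h0 P Pi N.
  exact: hawkes_process_congr PiX lamE WE BE hE N_hawkes.
have lamE_ n : cell_average1 (@C n.+1) lam = cell_average1 (@C n.+1) lam0.
  exact: cell_average1_congr (CX n) lamE.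
have WE_ n : cell_average2 (@C n.+1) W = cell_average2 (@C n.+1) W0.
  exact: cell_average2_congr (CX n) WE.
have BE_ n w : cell_average2 (@C n.+1) (B w) = cell_average2 (@C n.+1) (B0 w).
  exact: cell_average2_congr (CX n) (BE w).
have Nt0 n : hawkes_process (cell_average1 (@C n.+1) lam0) (cell_average2 (@C n.+1) W0)
    (fun w => cell_average2 (@C n.+1) (B0 w)) h0 P Pi (Nt n.+1).
  apply: hawkes_process_congr PiX _ _ _ hE (Nt_hawkes n.+1 isT).
  - by move=> x _; rewrite lamE_.
  - by move=> x y _ _; rewrite WE_.
  - by move=> w x y _ _; rewrite BE_.
(* The limit is taken along [n.+1], since partitions and averaged processes are given for positive
   indices. *)
rewrite -cvg_shiftS; set u := (X in X @ _ --> _).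
have u0 n : (0 <= u n)%E by exact: mu_ext_ge0.
apply/(vanishing_cvgP u0); apply: vanishing_approx => e e0.
have [Bad [v [mBad vv PBad close]]] := coupling_close C_part C_mesh lam0_meas lam0_int
  W0_meas W0_bnd B0_meas B0_ge0 CB0 B0_bnd h0_meas h0_ge0 h0_int Pi_PRM N0 Nt0 e0 delta_gt0.
exists v => // n; apply: (le_trans _ (PBad n)); rewrite -(measurable_mu_extE P (mBad n)).
(* The event involves a supremum over uncountably many regions and may fail to be measurable;
   monotonicity of the outer measure bounds it by the measurable [Bad n]. *)
apply: le_mu_ext => w /=; rewrite ltNge => /negP far; apply: contrapT => nBad; apply: far.
have [s [Ns NtN us sD err]] := close n w nBad.
rewrite NtN Ns; apply: ge_ereal_sup => _ [A' _ <-].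
apply: (le_trans (pp_dist_marked _ _ _ _ us)); apply: (le_trans _ err).
rewrite le_eqVlt; apply/orP; left; apply/eqP.
rewrite /mark_error !big_seq; apply: eq_bigr => q /sD[_ Xq _].
by apply: eq_integral => x; rewrite inE => Xx; rewrite BE_ (BE _ _ _ Xx Xq).
Qed.
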